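(* Let $g\in\mathbb Q^*$ with $g\neq -1$ and $g$ not the square of a rational number. Let $h$ be the largest positive integer such that $g$ is an $h$-th power of a rational number, and let $\Delta$ be the discriminant of the quadratic field $\mathbb Q(\sqrt g)$. Let $f\ge1$ and $1\le a\le f$ be integers with $(a,f)=1$. Put $b=\Delta/(f,\Delta)$ and, if $b$ is odd, $\gamma=(-1)^{(b-1)/2}(f,\Delta)$. Then $$\delta(a,f,g)=\frac{A(a,f,h)}{\varphi(f)}\left(1+\left(\frac{\gamma}{a}\right)\frac{\mu(2|b|)}{\prod_{p\mid b,\ p\mid h}(p-2)\prod_{p\mid b,\ p\nmid h}(p^2-p-1)}\right),$$ where, when $b$ is even (so that $\mu(2|b|)=0$ and $(\gamma/a)$ is undefined), the term involving $\mu(2|b|)$ is taken to be zero.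
   Context: $p$ always denotes a rational prime; $\zeta_m=e^{2\pi i/m}$; $\mu$ is the Möbius function and $\varphi$ Euler's totient; $(x,y)$ denotes the positive gcd. For $(a,f)=1$, $\sigma_a$ is the automorphism of $\mathbb Q(\zeta_f)$ with $\sigma_a(\zeta_f)=\zeta_f^a$. For $n\ge1$, $g^{1/n}$ denotes an $n$-th root of $g$ (the field $\mathbb Q(\zeta_n,g^{1/n})$ does not depend on the choice). Define $c_a(n)=1$ if the restriction of $\sigma_a$ to $\mathbb Q(\zeta_f)\cap\mathbb Q(\zeta_n,g^{1/n})$ is the identity and $c_a(n)=0$ otherwise, and $$\delta(a,f,g)=\sum_{n=1}^\infty\frac{\mu(n)c_a(n)}{[\mathbb Q(\zeta_f,\zeta_n,g^{1/n}):\mathbb Q]}.$$ Define $A(a,f,h)=\prod_{p\mid (a-1,f)}(1-\frac1p)\prod_{p\nmid f,\ p\mid h}(1-\frac1{p-1})\prod_{p\nmid f,\ p\nmid h}\left(1-\frac1{p(p-1)}\right)$ if $(a-1,f,h)=1$, and $A(a,f,h)=0$ otherwise. $(\gamma/a)$ denotes the Kronecker symbol. *)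

(* Defs.v *)
From HB Require Import structures.
From mathcomp Require Import all_boot all_order all_algebra all_field.
From mathcomp Require Import all_classical all_reals all_analysis.

Set Implicit Arguments.
Unset Strict Implicit.
Unset Printing Implicit Defensive.

Import Order.TTheory GRing.Theory Num.Theory.
Import numFieldNormedType.Exports.
Local Open Scope classical_set_scope.
Local Open Scope ring_scope.

(* The number field Q(s) generated by finitely many algebraic numbers, as an
   abstract extension of rat with an embedding into algC. *)
Definition numfield (s : seq algC) : fieldExtType rat := tag (num_field_exists s).

Definition numfield_emb (s : seq algC) : {rmorphism numfield s -> algC} :=
  tag (tagged (num_field_exists s)).

Definition in_numfield (s : seq algC) (x : algC) : Prop :=
  exists y : numfield s, numfield_emb s y = x.

Definition numfield_degree (s : seq algC) : nat := \dim {: numfield s}.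

Definition field_trace (K : fieldExtType rat) (x : K) : rat :=
  \tr (passmx.mxof (vbasis {:K}) (vbasis {:K}) (amull x)).

Definition integral_basis (K : fieldExtType rat) (w : (\dim {:K}).-tuple K) : Prop :=
  basis_of {:K} w /\
  forall x : K, integralOver (intr : int -> K) x <-> inIntSpan w x.

Definition is_discriminant (K : fieldExtType rat) (D : int) : Prop :=
  exists2 w : (\dim {:K}).-tuple K, integral_basis w &
    D%:~R = \det (\matrix_(i < \dim {:K}, j < \dim {:K}) field_trace (w`_i * w`_j)).

(* m.-root (-1) is the root of least non-negative argument, i.e., e^(i pi / m)
   for m > 0; hence this is e^(2 i pi / m). *)
Definition zeta (m : nat) : algC := m.-root (-1) ^+ 2.

Definition Qzeta (f : nat) : fieldExtType rat := numfield [:: zeta f].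

Definition is_sigma (f a : nat) (s : {rmorphism Qzeta f -> Qzeta f}) : Prop :=
  forall z, numfield_emb [:: zeta f] z = zeta f -> s z = z ^+ a.

(* The default value idfun is irrelevant when a is prime to f, see sigmaP. *)
Definition sigma (f a : nat) : {rmorphism Qzeta f -> Qzeta f} :=
  if pselect (exists s, is_sigma (f := f) a s) is left e
  then projT1 (cid e) else idfun.

(* n.-root is the principal n-th root in algC. *)
Definition Qkummer_gens (g : rat) (n : nat) : seq algC :=
  [:: zeta n; n.-root (ratr g)].

Definition c_ (f : nat) (g : rat) (a n : nat) : bool :=
  `[< forall x : Qzeta f,
        in_numfield (Qkummer_gens g n) (numfield_emb [:: zeta f] x) ->
        sigma f a x = x >].

Definition moebius (n : nat) : int :=
  if (0 < n)%N && all (fun p => logn p n == 1%N) (primes n)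
  then (-1) ^+ size (primes n) else 0.

Definition delta_term (R : realType) (a f : nat) (g : rat) (n : nat) : R :=
  (moebius n)%:~R * (c_ f g a n)%:R
    / (numfield_degree (zeta f :: Qkummer_gens g n))%:R.

Definition delta_series (R : realType) (a f : nat) (g : rat) : R^nat :=
  fun N => \sum_(1 <= n < N.+1) delta_term R a f g n.

Definition delta (R : realType) (a f : nat) (g : rat) : R :=
  limn (delta_series R a f g).

Definition artin_partial (R : realType) (f h : nat) : R^nat :=
  fun N => \prod_(0 <= p < N | [&& prime p, ~~ (p %| f)%N & ~~ (p %| h)%N])
    (1 - (p%:R * (p%:R - 1))^-1).

Definition artin_A (R : realType) (a f h : nat) : R :=
  if gcdn (gcdn (a - 1)%N f) h == 1%N then
    \prod_(p <- primes (gcdn (a - 1)%N f)) (1 - p%:R^-1)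
    * \prod_(p <- primes h | ~~ (p %| f)%N) (1 - (p%:R - 1)^-1)
    * limn (artin_partial R f h)
  else 0.

Definition kronecker_prime (m : int) (p : nat) : int :=
  if (p %| m)%Z then 0
  else if p == 2%N then
    if ((m %% 8)%Z == 1) || ((m %% 8)%Z == 7) then 1 else -1
  else if [exists x : 'I_p, (p %| x%:Z ^+ 2 - m)%Z] then 1 else -1.

(* Kronecker symbol (m / n), for n >= 0. *)
Definition kronecker (m : int) (n : nat) : int :=
  if n == 0%N then (`|m|%N == 1%N)%:R
  else \prod_(p <- primes n) kronecker_prime m p ^+ logn p n.

Definition is_largest_power (g : rat) (h : nat) : Prop :=
  [/\ (0 < h)%N, exists x : rat, g = x ^+ h &
      forall k : nat, (0 < k)%N -> (exists x : rat, g = x ^+ k) -> (k <= h)%N].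

Definition b_ (f : nat) (D : int) : int := (D %/ gcdz f D)%Z.

(* Meaningful only when b_ f D is odd; the exponent may be negative. *)
Definition gamma_ (f : nat) (D : int) : int :=
  (-1) ^ ((b_ f D - 1) %/ 2)%Z * gcdz f D.

Definition correction (R : realType) (a f h : nat) (D : int) : R :=
  let b := `|b_ f D|%N in
  if odd b then
    (kronecker (gamma_ f D) a)%:~R * (moebius (2 * b)%N)%:~R
    / (\prod_(p <- primes b | (p %| h)%N) (p%:R - 2)
       * \prod_(p <- primes b | ~~ (p %| h)%N) (p%:R ^+ 2 - p%:R - 1))
  else 0.

Lemma numfield_embP (s : seq algC) :
  exists2 s1 : seq (numfield s),
    map (numfield_emb s) s1 = s & <<1 & s1>>%VS = fullv.
Proof.
rewrite /numfield_emb /numfield.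
by case: (num_field_exists s) => K [e [s1 /= h1 h2]]; exists s1.
Qed.

Lemma zetaX (f : nat) : (0 < f)%N -> zeta f ^+ f = 1.
Proof. by move=> f0; rewrite /zeta exprAC rootCK // sqrrN expr1n. Qed.

Lemma sigmaP (f a : nat) : (0 < f)%N -> coprime a f -> is_sigma a (sigma f a).
Proof.
move=> f0 co; rewrite /sigma; case: pselect => [e|[]]; first exact: projT2 (cid e).
have [u uE] := Qn_aut_exists co.
have [s1 s1E gen] := numfield_embP [:: zeta f].
case: s1 s1E gen => [|z [|? ?]] //= [zE] gen.
set e := numfield_emb _ in zE *.
have [x|s sE] := @restrict_aut_to_num_field _ e u.
  have /Fadjoin_polyP[p pK ->] : x \in <<1; z>>%VS by rewrite -adjoin_seq1 gen memvf.
  exists p.[z ^+ a]; rewrite -!horner_map /= -map_poly_comp map_Qnum_poly //.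
  rewrite rmorphXn /= zE. by rewrite uE // zetaX.
exists s => w wE; apply: (fmorph_inj e).
by rewrite sE wE uE ?zetaX // rmorphXn wE.
Qed.

Lemma artin_partial_cvg (R : realType) (f h : nat) : cvgn (artin_partial R f h).
Proof.
have fac (p : nat) : prime p ->
    0 <= 1 - (p%:R * (p%:R - 1))^-1 :> R /\ 1 - (p%:R * (p%:R - 1))^-1 <= 1 :> R.
  move=> /prime_gt1 p1.
  have le1 : 1 <= (p%:R * (p%:R - 1)) :> R.
    have -> : p%:R - 1 = (p - 1)%:R :> R by rewrite natrB // ltnW.
    by rewrite -natrM ler1n muln_gt0 subn_gt0 p1 ltnW.
  by split; rewrite ?subr_ge0 ?invf_le1 ?lerBlDr ?lerDl ?invr_ge0 ?(le_trans ler01) // (lt_le_trans ltr01).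
have ge0 N : 0 <= artin_partial R f h N.
  by apply: prodr_ge0 => p /and3P[/fac[]].
apply: nonincreasing_is_cvgn; last by exists 0 => _ [N _ <-].
apply/nonincreasing_seqP => N; rewrite /artin_partial big_mkcond big_nat_recr //=.
rewrite -big_mkcond /=; case: ifP => [/and3P[/fac[? ?] _ _]|_]; last by rewrite mulr1.
by rewrite ler_piMr // ge0.
Qed.

(* Main.v *)
(* Write Delta = D m with D in {1, -4, 8, -8} and m = 1 mod 4 squarefree, so
   that g = Delta q^2.  For squarefree n, Kummer theory over Q(zeta_L) with
   L = lcm(f, n) shows that g^(1/n) has degree n / (gcd(n, h) eps) over Q(zeta_L),
   where eps = 2 if 2 | n and Delta | L, and eps = 1 otherwise; for odd b the
   latter divisibility means b | n, and for even b the case eps = 2 never occurs.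
   When eps = 2, Delta = gamma b', where b' = +-b and gamma are discriminants,
   sqrt gamma lies in Q(zeta_f) and sqrt b' in Q(zeta_n), so the intersection of Q(zeta_f) with Q(zeta_n, g^(1/n)) contains
   sqrt gamma, on which sigma_a acts by the Kronecker symbol (gamma/a).  Hence
   sigma_a is trivial on the intersection iff a = 1 mod gcd(f, n) and, when
   eps = 2, (gamma/a) = 1.  The n-th term of the series is therefore
   V(n) / phi(f), multiplied by 1 + (gamma/a) when 2b | n, with V multiplicative
   and supported on squarefree integers; summing V over all n and over the
   multiples of 2b gives the two Euler products of the formula. *)
Require Import Defs.
From HB Require Import structures.
From mathcomp Require Import all_boot all_order all_algebra all_field.
From mathcomp Require Import cyclic.
From mathcomp Require Import all_classical all_reals all_analysis.
From mathcomp Require Import ring lra zify.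

Set Implicit Arguments.
Unset Strict Implicit.
Unset Printing Implicit Defensive.

Import Order.TTheory GRing.Theory Num.Theory.
Import numFieldNormedType.Exports.
Local Open Scope classical_set_scope.
Local Open Scope ring_scope.

Local Notation pQtoC := (map_poly (ratr : rat -> algC)).
Local Notation pZtoC := (map_poly (intr : int -> algC)).
Local Notation algCaut := {rmorphism algC -> algC}.

Inductive Qin (s : seq algC) : algC -> Prop :=
| Qin_rat (q : rat) : Qin s (ratr q)
| Qin_mem x of x \in s : Qin s x
| Qin_add x y of Qin s x & Qin s y : Qin s (x + y)
| Qin_mul x y of Qin s x & Qin s y : Qin s (x * y).

Definition fixes (s : seq algC) (x : algC) : Prop :=
  forall nu : algCaut, {in s, forall y, nu y = y} -> nu x = x.

Lemma Qin_fixes s x : Qin s x -> fixes s x.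
Proof.
move=> Qx nu nus; elim: Qx => [q|{}x|{}x y _ IHx _ IHy|{}x y _ IHx _ IHy].
- by rewrite fmorph_rat.
- exact: nus.
- by rewrite rmorphD /= IHx IHy.
- by rewrite rmorphM /= IHx IHy.
Qed.

Lemma Qin_horner s (p : {poly algC}) x :
  (forall i, Qin s p`_i) -> Qin s x -> Qin s p.[x].
Proof.
move=> Qp Qx; rewrite horner_coef.
have Q0 : Qin s 0 by rewrite -(rmorph0 ratr); apply: Qin_rat.
have Q1 : Qin s 1 by rewrite -(rmorph1 ratr); apply: Qin_rat.
elim/big_ind: _ => // [u v|i _]; first exact: Qin_add.
apply: Qin_mul => //; elim: (i : nat) => [|k IH]; first by rewrite expr0.
by rewrite exprS; apply: Qin_mul.
Qed.

Lemma Qin_sub s t x : {subset s <= t} -> Qin s x -> Qin t x.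
Proof.
move=> st; elim=> [q|{}x xs|{}x y _ IHx _ IHy|{}x y _ IHx _ IHy].
- exact: Qin_rat.
- exact/Qin_mem/st.
- exact: Qin_add.
- exact: Qin_mul.
Qed.

Lemma Qin_preim (K : fieldExtType rat) (e : {rmorphism K -> algC})
    (s : seq K) x : Qin (map e s) x -> exists2 z, z \in <<1 & s>>%VS & e z = x.
Proof.
elim=> [q|_ /mapP[z zs ->]|{}x y _ [z zs <-] _ [w ws <-]
        |{}x y _ [z zs <-] _ [w ws <-]].
- exists q%:A; last by rewrite alg_num_field fmorph_rat.
  exact/rpredZ/mem1v.
- by exists z => //; apply: seqv_sub_adjoin.
- by exists (z + w); rewrite ?rmorphD // rpredD.
- by exists (z * w); rewrite ?rmorphM // rpredM.
Qed.

Lemma mem_adjoinP (K : fieldExtType rat) (e : {rmorphism K -> algC})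
    (s : seq K) y : y \in <<1 & s>>%VS <-> Qin (map e s) (e y).
Proof.
split.
  elim/last_ind: s y => [|s a IH] y.
    rewrite Fadjoin_nil => /vlineP[c ->].
    by rewrite alg_num_field fmorph_rat; apply: Qin_rat.
  rewrite adjoin_rcons => /Fadjoin_polyP[p /polyOverP pP ->].
  rewrite -!horner_map /=; apply: Qin_horner => [i|].
    rewrite coef_map /=; apply: Qin_sub (IH _ (pP i)) => z zs.
    by rewrite map_rcons mem_rcons in_cons zs orbT.
  by apply: Qin_mem; rewrite map_rcons mem_rcons mem_head.
by case/Qin_preim => z zs /fmorph_inj <-.
Qed.

(** * Automorphisms of algC over a finitely generated field *)

Lemma extend_conj (s : seq algC) (x y : algC) :
  (forall p : {poly algC}, (forall i, Qin s p`_i) -> root p x -> root p y) ->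
  exists2 nu : algCaut, {in s, forall z, nu z = z} & nu x = y.
Proof.
move=> Hy.
have [z _ [ps Ds]] := algC_PET [:: y, x & s].
have [p [Dp mon_p] /(_ p) pz0] := minCpolyP z; rewrite dvdpp in pz0.
have [r Dr] := closed_field_poly_normal (pQtoC p : {poly algC}).
rewrite lead_coef_map {mon_p}(monicP mon_p) rmorph1 scale1r in Dr.
have{pz0} rz: z \in r by rewrite -root_prod_XsubC -Dr.
have [Qr [QrC [rr Drr genQr]]] := num_field_exists r.
have{rz} [zz Dz]: {zz | QrC zz = z}.
  by move: rz; rewrite -Drr => /mapP/sig2_eqW[zz]; exists zz.
have polyC_ q : QrC (map_poly (in_alg Qr) q).[zz] = (pQtoC q).[z].
  rewrite -horner_map Dz -map_poly_comp; congr (_.[_]).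
  by apply: eq_map_poly => a; rewrite /= alg_num_field fmorph_rat.
pose pre q := (map_poly (in_alg Qr) q).[zz].
have [y1 [x1 [s1 [y1E x1E s1E]]]] : exists y1 x1 s1,
    [/\ QrC y1 = y, QrC x1 = x & map QrC s1 = s].
  case: ps Ds => [|p1 [|p2 ps]] //= [-> -> ->].
  exists (pre p1), (pre p2), (map pre ps); split; rewrite ?polyC_ //.
  by rewrite -map_comp; apply: eq_map => q /=; rewrite polyC_.
pose F := <<1 & s1>>%AS.
pose m := minPoly F x1.
have rooty : root (map_poly \1%VF m) y1.
  rewrite map_poly_id => [|c]; last by rewrite id_lfunE.
  rewrite -(fmorph_root QrC) y1E; apply: Hy => [i|].
    by rewrite coef_map /= -s1E; apply/mem_adjoinP/polyOverP/minPolyOver.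
  by rewrite -x1E fmorph_root root_minPoly.
have hom1 : kHom F F (\1%VF : 'End(Qr)) by rewrite kHom1.
have := kHomExtendP (subvv F) hom1 rooty; set f := kHomExtend _ _ _ _ => hom_f.
have Qpr : map_poly (in_alg Qr) p \is a polyOver 1%VS.
  by apply/polyOverP=> i; rewrite coef_map memvZ ?memv_line.
have splitQr: splittingFieldFor <<F; x1>> (map_poly (in_alg Qr) p) fullv.
  apply: splittingFieldForS (sub1v _) (subvf _) _; exists rr => //.
  congr (_ %= _): (eqpxx (map_poly (in_alg Qr) p)); apply/(map_poly_inj QrC).
  rewrite -map_poly_comp.
  rewrite (eq_map_poly (_ : _ =1 ratr)); last first.
    by move=> a; rewrite /= alg_num_field fmorph_rat.
  rewrite Dr -Drr big_map rmorph_prod /=; apply: eq_bigr => w _.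
  by rewrite map_polyXsubC.
have [f1 aut_f1 Df1] := kHom_extends (subv_adjoin F x1) hom_f (polyOverSv (sub1v F) Qpr) splitQr.
pose f1mM := GRing.isMonoidMorphism.Build _ _ f1
  (kHom_monoid_morphism (kHomSl (sub1v F) aut_f1)).
pose phi : {rmorphism Qr -> Qr} := HB.pack (fun_of_lfun f1) f1mM.
have [nu nuE] := extend_algC_subfield_aut QrC phi.
exists nu => [w|].
  rewrite -s1E => /mapP[c c_s1 ->]; rewrite -nuE /=; congr (QrC _).
  have cF : c \in F by apply: seqv_sub_adjoin.
  rewrite -Df1 ?subv_adjoin ?(subvP (subv_adjoin F x1)) //.
  by rewrite /f kHomExtend_id ?id_lfunE.
rewrite -x1E -nuE -y1E /=; congr (QrC _).
by rewrite -Df1 ?memv_adjoin // /f (kHomExtend_val hom1).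
Qed.

Lemma Qin_poly_preim (K : fieldExtType rat) (e : {rmorphism K -> algC})
    (s : seq K) (p : {poly algC}) : (forall i, Qin (map e s) p`_i) ->
  exists2 q, q \is a polyOver <<1 & s>>%AS & p = map_poly e q.
Proof.
move=> pP; have [CtoK C0 CK] := num_field_proj e.
have pE i : exists2 c, c \in <<1 & s>>%AS & e c = p`_i by apply: Qin_preim.
exists (map_poly CtoK p).
  apply/polyOverP => i; rewrite coef_map_id0 //.
  by have [c cF <-] := pE i; rewrite CK.
apply/polyP => i; rewrite coef_map coef_map_id0 //=.
by have [c cF <-] := pE i; rewrite CK.
Qed.

Lemma fixes_mem_adjoin (K : fieldExtType rat) (e : {rmorphism K -> algC})
    (s : seq K) x : fixes (map e s) (e x) -> x \in <<1 & s>>%VS.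
Proof.
move=> fix_x; pose F := <<1 & s>>%AS; change (x \in F).
have mx0 := root_minPoly F x; set m := minPoly F x in mx0.
suff root1 y : root (map_poly e m) y -> y = e x.
  have [r Dr] := closed_field_poly_normal (map_poly e m).
  rewrite lead_coef_map (monicP (monic_minPoly F x)) rmorph1 scale1r in Dr.
  have sepm : separable_poly m.
    apply: pcharf0_separable => p; rewrite (fmorph_pchar (in_alg K)).
    exact: pchar_num.
  have uniqr : uniq r.
    by rewrite -separable_prod_XsubC -Dr separable_map.
  have : size r = 1%N.
    have rx y : y \in r -> y = e x by rewrite -root_prod_XsubC -Dr; apply: root1.
    have : e x \in r by rewrite -root_prod_XsubC -Dr fmorph_root.
    case: r uniqr rx {Dr} => [|a [|b r]] //= /and3P[/negP nab _ _] rx _.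
    by case: nab; rewrite (rx a) ?mem_head // (rx b) ?mem_head // !inE eqxx ?orbT.
  move=> sz1; have : size m = 2%N.
    by rewrite -(size_map_poly e) Dr size_prod_XsubC sz1.
  by move/eqP; rewrite size_minPoly eqSS adjoin_deg_eq1.
move=> rooty; have [|nu nus <-] := @extend_conj (map e s) (e x) y.
  move=> p pP rootx.
  have [q qF Dq] := Qin_poly_preim pP.
  rewrite Dq fmorph_root in rootx *.
  have /dvdpP[q1 ->] : m %| q by rewrite minPoly_dvdp.
  by rewrite rmorphM rootM rooty orbT.
exact: fix_x.
Qed.

Lemma fixes_Crat x : fixes [::] x -> x \in Crat.
Proof.
move=> fix_x; have [K [e [s1 Ds _]]] := num_field_exists [:: x].
case: s1 Ds => [|x1 [|]] //= [x1E].
have : x1 \in <<1 & [::]>>%VS by apply: (@fixes_mem_adjoin _ e); rewrite x1E.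
rewrite Fadjoin_nil => /vlineP[c Dx1].
by rewrite -x1E Dx1 alg_num_field fmorph_rat Crat_rat.
Qed.

Lemma unit_circle_eq (R : realFieldType) (c s C T : R) :
  c ^+ 2 + s ^+ 2 = 1 -> C ^+ 2 + T ^+ 2 = 1 -> 0 < s -> 0 <= T ->
  C <= c -> c * T <= C * s -> C = c /\ T = s.
Proof.
move=> cs1 CT1 s0 T0 Cc cTCs.
have [c0|c0] := leP 0 c.
  have C0 : 0 <= C by nra.
  have Ts : s <= T by nra.
  have CE : C = c by nra.
  by split=> //; subst C; nra.
have Ts : T <= s by nra.
have CE : C = c by nra.
by split=> //; subst C; nra.
Qed.

Lemma norm_root_N1 (z : algC) n : (0 < n)%N -> z ^+ n = -1 -> `|z| = 1.
Proof.
move=> n0 zn; apply/eqP; rewrite -(@pexpr_eq1 _ _ n) ?normr_ge0 //.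
by rewrite -normrX zn normrN1.
Qed.

(** * Roots of unity and their automorphisms *)

(* [y] has the largest real part among the [n]-th roots of -1 in the upper half
   plane; rotating any other one by [y ^- 2] increases its real part. *)
Lemma rootN1_extremal n (y := n.-root (-1) : algC) (z : algC) : (1 < n)%N ->
  z ^+ n = -1 -> 0 <= 'Im z -> 'Re (z * y ^- 2) <= 'Re z -> z = y.
Proof.
move=> n1 zn Iz Rz; have n0 : (0 < n)%N by apply: ltnW.
have yn : y ^+ n = -1 by rewrite rootCK.
have ny := norm_root_N1 n0 yn; have nz := norm_root_N1 n0 zn.
have Iy : 0 <= 'Im y by apply: Im_rootC_ge0.
have Rzy : 'Re z <= 'Re y by apply: rootC_Re_max.
have cs1 := normC2_Re_Im y; have CT1 := normC2_Re_Im z.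
rewrite ny expr1n in cs1; rewrite nz expr1n in CT1.
have yV : y^-1 = y^* by rewrite invC_norm ny expr1n invr1 mul1r.
have := Rz; rewrite -exprVn yV expr2 !ReM !ImM !Re_conj !Im_conj.
set c := in_algR (Creal_Re y); set s := in_algR (Creal_Im y).
set C := in_algR (Creal_Re z); set T := in_algR (Creal_Im z).
have cs2 : c ^+ 2 + s ^+ 2 = 1 by apply/val_inj.
have CT2 : C ^+ 2 + T ^+ 2 = 1 by apply/val_inj.
move=> Rz'.
have {Rz'}Rz' : C * (c * c - (- s) * (- s)) - T * (c * (- s) + c * (- s)) <= C.
  exact: Rz'.
have s0 : 0 <= s by exact: Iy.
have T0 : 0 <= T by exact: Iz.
have Cc : C <= c by exact: Rzy.
rewrite (algCrect z) (algCrect y) -[X in X + _]/(val C) -['Im z]/(val T).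
rewrite -['Re y]/(val c) -['Im y]/(val s).
have [s_gt0|] := ltP 0 s.
  have [|CE TE] := unit_circle_eq cs2 CT2 s_gt0 T0 Cc.
    have Ccs : C * (c ^+ 2 + s ^+ 2) = C by rewrite cs2 mulr1.
    by rewrite -subr_ge0 -(pmulr_rge0 _ s_gt0); nra.
  by rewrite CE TE.
move=> s_le0; have {s_le0}s0 : s = 0 by apply/le_anti/andP.
have [cE|cE] : c = 1 \/ c = -1.
  have : (c - 1) * (c + 1) = 0 by rewrite s0 in cs2; nra.
  by move=> /eqP; rewrite mulf_eq0 subr_eq0 addr_eq0 => /orP[] /eqP; auto.
- have : y = 1 by rewrite (algCrect y) -['Re y]/(val c) -['Im y]/(val s) s0 cE /= mulr0 addr0.
  move=> y1; move: yn; rewrite y1 expr1n => /eqP.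
  by rewrite -subr_eq0 opprK -mulr2n pnatr_eq0.
- have CE : C = -1 by nra.
  have TE : T = 0 by nra.
  by rewrite s0 cE CE TE.
Qed.

Lemma rootN1_prim n (y := n.-root (-1) : algC) : (0 < n)%N ->
  (2 * n).-primitive_root y.
Proof.
move=> n0; have yn : y ^+ n = -1 by rewrite rootCK.
have y2n : y ^+ (2 * n) = 1 by rewrite mulnC exprM yn sqrrN expr1n.
have [n1|n1] := leqP n 1.
  have {n0 n1}n1 : n = 1%N by lia.
  have yN1 : y = -1 by rewrite /y n1 root1C.
  have y2 : y ^+ 2 = 1 by rewrite yN1 sqrrN expr1n.
  have [d prim_d d2] := prim_order_exists (isT : 0 < 2)%N y2.
  rewrite n1 muln1; move: d2 prim_d; rewrite dvdn_divisors // !inE.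
  move=> /orP[] /eqP -> // /prim_expr_order; rewrite expr1 yN1 => /eqP.
  by rewrite -subr_eq0 -opprD oppr_eq0 -mulr2n pnatr_eq0.
have [w prim_w] : {w : algC | (2 * n).-primitive_root w}.
  by apply: C_prim_root_exists; rewrite muln_gt0.
have wn : w ^+ n = -1.
  have : (w ^+ n) ^+ 2 == 1 by rewrite -exprM mulnC prim_expr_order.
  rewrite sqrf_eq1 => /orP[|/eqP//].
  by rewrite -(prim_order_dvd prim_w) gtnNdvd //; lia.
pose F (j : 'I_n) := in_algR (Creal_Re (w * (y ^+ 2) ^+ j)).
have [j _ jmax] : extremum_spec >=%O xpredT F [arg max_(i > Ordinal n0) F i]%O.
  exact: arg_maxP.
pose z := w * (y ^+ 2) ^+ j.
have zmax k : 'Re (w * (y ^+ 2) ^+ k) <= 'Re z.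
  have := jmax (Ordinal (ltn_pmod k n0)) isT.
  rewrite [X in is_true X]/('Re (w * (y ^+ 2) ^+ (k %% n)) <= 'Re z).
  by rewrite expr_mod // -exprM.
have y2u : y ^+ 2 \is a GRing.unit.
  by rewrite unitfE expf_eq0 /= rootC_eq0 // oppr_eq0 oner_eq0.
have y2V : y ^- 2 = (y ^+ 2) ^+ n.-1.
  by apply: (mulrI y2u); rewrite divrr // -exprS prednK // -exprM.
have zn : z ^+ n = -1.
  have y2n1 : (y ^+ 2) ^+ n = 1 by rewrite -exprM.
  by rewrite exprMn wn (exprAC (y ^+ 2)) y2n1 expr1n mulr1.
have y_pow : exists k, w = y ^+ k.
  have powV i : (y ^+ i)^-1 = y ^+ (i * (2 * n).-1).
    have yu : y ^+ i \is a GRing.unit.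
      by rewrite unitfE expf_eq0 rootC_eq0 // oppr_eq0 oner_eq0 andbF.
    apply: (mulrI yu); rewrite divrr // -exprD -mulnS prednK ?muln_gt0 //.
    by rewrite mulnC exprM y2n expr1n.
  have wE : w = z * (y ^+ (2 * j))^-1.
    by rewrite /z -exprM mulfK // expf_eq0 rootC_eq0 // oppr_eq0 oner_eq0 andbF.
  have [Iz|Iz] := boolP (0 <= 'Im z).
    have zy : z = y.
      apply: rootN1_extremal => //.
      by rewrite -/y y2V /z -mulrA -exprD; apply: zmax.
    by rewrite wE zy powV -exprS; eexists.
  have zy : z^* = y.
    apply: rootN1_extremal => //.
    - by rewrite -rmorphXn zn rmorphN1.
    - rewrite Im_conj oppr_ge0; move: Iz; rewrite -real_ltNge ?Creal_Im //; apply: ltW.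
    - rewrite -/y; have <- : ((z * y ^+ 2)^*) = z^* * y ^- 2.
        rewrite rmorphM rmorphXn /= -exprVn invC_norm (norm_root_N1 n0 yn).
        by rewrite expr1n invr1 mul1r.
      by rewrite !Re_conj /z -mulrA -exprSr zmax.
  have -> : w = y^-1 * (y ^+ (2 * j))^-1.
    have -> : y^-1 = z; last exact: wE.
    by rewrite invC_norm (norm_root_N1 n0 yn) expr1n invr1 mul1r -zy conjCK.
  by rewrite -{1}[y]expr1 !powV -exprD; eexists.
have [k wk] := y_pow.
have n2_gt0 : (0 < 2 * n)%N by rewrite muln_gt0.
have [d prim_d d2n] := prim_order_exists n2_gt0 y2n.
suff -> : (2 * n)%N = d by [].
apply/eqP; rewrite eqn_dvd d2n andbT (prim_order_dvd prim_w).
by rewrite wk exprAC (prim_expr_order prim_d) expr1n.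
Qed.

Lemma zeta_prim n : (0 < n)%N -> n.-primitive_root (zeta n).
Proof.
move=> n0; have := dvdn_prim_root (rootN1_prim n0) (dvdn_mull 2 (dvdnn n)).
by rewrite mulnK.
Qed.

Lemma zeta_neq0 n : (0 < n)%N -> zeta n != 0.
Proof.
move=> n0; apply/eqP => z0; have /eqP := prim_expr_order (zeta_prim n0).
by rewrite z0 expr0n gtn_eqF // eq_sym oner_eq0.
Qed.

Lemma unity_zeta n (x : algC) : (0 < n)%N -> x ^+ n = 1 -> exists k, x = zeta n ^+ k.
Proof.
by move=> n0 /(prim_rootP (zeta_prim n0))[k ->]; exists k.
Qed.

Lemma zeta_dvd d n : (0 < n)%N -> (d %| n)%N -> exists k, zeta d = zeta n ^+ k.
Proof.
move=> n0 dn; apply: unity_zeta => //.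
have d0 := dvdn_gt0 n0 dn.
have [q ->] := dvdnP dn.
by rewrite mulnC exprM (prim_expr_order (zeta_prim d0)) expr1n.
Qed.

Lemma aut_zeta_dvd (nu : algCaut) d n a : (0 < n)%N -> (d %| n)%N ->
  nu (zeta n) = zeta n ^+ a -> nu (zeta d) = zeta d ^+ a.
Proof.
move=> n0 /(zeta_dvd n0)[k ->] nuE.
by rewrite rmorphXn /= nuE exprAC.
Qed.

Lemma aut_zeta_exp (nu : algCaut) n : (0 < n)%N ->
  exists2 a, coprime a n & nu (zeta n) = zeta n ^+ a.
Proof.
move=> n0; have pz := zeta_prim n0.
have nuz : n.-primitive_root (nu (zeta n)) by rewrite fmorph_primitive_root.
have [a nuE] := unity_zeta n0 (prim_expr_order nuz).
by exists a; rewrite // -(prim_root_exp_coprime a pz) -nuE.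
Qed.

Lemma aut_zeta_exists a n : (0 < n)%N -> coprime a n ->
  exists nu : algCaut, nu (zeta n) = zeta n ^+ a.
Proof.
move=> n0 co; have [nu nuE] := Qn_aut_exists co.
by exists nu; rewrite nuE // (prim_expr_order (zeta_prim n0)).
Qed.

Lemma chinese_gcd m n a b : (0 < m)%N -> (0 < n)%N ->
  a = b %[mod gcdn m n] -> exists2 c, c = a %[mod m] & c = b %[mod n].
Proof.
move=> m0 n0 ab.
have [u v uv _] := egcdnP n m0.
pose b' := (b + a * n)%N.
have b'E : b' = b %[mod n] by rewrite /b' addnC modnMDl.
have ab' : (a <= b')%N by apply: leq_trans (leq_pmulr a n0) (leq_addl _ _).
have /dvdnP[t tE] : (gcdn m n %| b' - a)%N.
  by rewrite -eqn_mod_dvd // /b' -modnDmr (eqP (dvdn_mull a (dvdn_gcdr m n))) addn0 ab.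
exists (a + u * t * m)%N; first by rewrite addnC modnMDl.
rewrite -b'E; have -> : (a + u * t * m = v * t * n + b')%N.
  by rewrite mulnAC uv mulnDl [(gcdn m n * t)%N]mulnC -tE addnCA subnKC // mulnAC.
by rewrite modnMDl.
Qed.

Lemma aut_chinese m n a b : (0 < m)%N -> (0 < n)%N -> coprime a m -> coprime b n ->
  a = b %[mod gcdn m n] -> exists nu : algCaut,
  nu (zeta m) = zeta m ^+ a /\ nu (zeta n) = zeta n ^+ b.
Proof.
move=> m0 n0 am bn /(chinese_gcd m0 n0)[c ca cb].
have cm : coprime c m by rewrite -coprime_modl ca coprime_modl.
have cn : coprime c n by rewrite -coprime_modl cb coprime_modl.
have L0 : (0 < m * n)%N by rewrite muln_gt0 m0.
have [|nu nuE] := @aut_zeta_exists c (m * n) L0; first by rewrite coprimeMr cm.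
exists nu; split.
  rewrite (aut_zeta_dvd L0 (dvdn_mulr n (dvdnn m)) nuE).
  by apply/eqP; rewrite (eq_prim_root_expr (zeta_prim m0)) ca.
rewrite (aut_zeta_dvd L0 (dvdn_mull m (dvdnn n)) nuE).
by apply/eqP; rewrite (eq_prim_root_expr (zeta_prim n0)) cb.
Qed.

Definition Zin (z x : algC) : Prop := exists p : {poly int}, x = (pZtoC p).[z].

Section Zin.
Variable z : algC.

Lemma Zin_gen : Zin z z.
Proof. by exists 'X; rewrite map_polyX hornerX. Qed.

Lemma Zin_int (m : int) : Zin z m%:~R.
Proof. by exists m%:P; rewrite map_polyC hornerC. Qed.

Lemma ZinD x y : Zin z x -> Zin z y -> Zin z (x + y).
Proof. by move=> [p ->] [q ->]; exists (p + q); rewrite rmorphD hornerD. Qed.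

Lemma ZinN x : Zin z x -> Zin z (- x).
Proof. by move=> [p ->]; exists (- p); rewrite rmorphN hornerN. Qed.

Lemma ZinM x y : Zin z x -> Zin z y -> Zin z (x * y).
Proof. by move=> [p ->] [q ->]; exists (p * q); rewrite rmorphM hornerM. Qed.

Lemma ZinX x k : Zin z x -> Zin z (x ^+ k).
Proof. by move=> [p ->]; exists (p ^+ k); rewrite rmorphXn horner_exp. Qed.
End Zin.

Lemma Zin_trans w z x : Zin w z -> Zin z x -> Zin w x.
Proof.
move=> [q ->] [p ->]; exists (p \Po q).
by rewrite map_comp_poly horner_comp.
Qed.

Lemma Zin_Aint z x : z \in Aint -> Zin z x -> x \in Aint.
Proof.
move=> zA [p ->]; rewrite horner_coef rpred_sum // => i _.
by rewrite rpredM ?rpredX // coef_map Aint_int.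
Qed.

Lemma pchar_poly_expr p k (P : {poly 'F_p}) : prime p ->
  P ^+ (p ^ k) = P \Po 'X^(p ^ k).
Proof.
move=> p_pr; have pcharX : p \in [pchar {poly 'F_p}].
  by rewrite (rmorph_pchar polyC) ?pchar_Fp.
have base (Q : {poly 'F_p}) : Q ^+ p = Q \Po 'X^p.
  elim/poly_ind: Q => [|Q c IH]; first by rewrite expr0n gtn_eqF ?prime_gt0 // comp_poly0.
  rewrite -(pFrobenius_autE pcharX) rmorphD rmorphM /= !pFrobenius_autE IH.
  rewrite comp_polyD comp_polyM comp_polyX comp_polyC -rmorphXn /=.
  by have := expf_card c; rewrite card_Fp // => ->.
elim: k => [|k IH]; first by rewrite expn0 !expr1 comp_polyXr.
rewrite expnSr exprM IH base -comp_polyA; congr (_ \Po _).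
by rewrite rmorphXn /= comp_polyX -exprM mulnC.
Qed.

Lemma int_poly_expr p k (P : {poly int}) : prime p ->
  exists Q : {poly int}, P ^+ (p ^ k) = (P \Po 'X^(p ^ k)) + p%:Z *: Q.
Proof.
move=> p_pr; pose D := P ^+ (p ^ k) - (P \Po 'X^(p ^ k)).
have D0 : map_poly (intr : int -> 'F_p) D = 0.
  by rewrite rmorphB rmorphXn /= map_comp_poly map_polyXn pchar_poly_expr ?subrr.
have Ddvd i : (p %| D`_i)%Z.
  have /eqP := congr1 (fun q : {poly 'F_p} => q`_i) D0.
  by rewrite coef_map coef0 /= -(dvdz_pcharf (pchar_Fp p_pr)).
exists (\poly_(i < size D) (D`_i %/ p)%Z).
rewrite -[LHS](subrK (P \Po 'X^(p ^ k))) -/D addrC; congr (_ + _).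
apply/polyP => i; rewrite coefZ coef_poly; case: ltnP => [_|/leq_sizeP/(_ i (leqnn _)) ->].
  by rewrite mulrC divzK.
by rewrite mulr0.
Qed.

(* Frobenius congruence: [x ^+ (p ^ k)] is congruent modulo [p] to the image of
   [x] under [zeta n |-> zeta n ^+ (p ^ k)]. *)
Lemma Zin_expr p k n x : prime p -> (0 < n)%N -> Zin (zeta n) x ->
  exists2 y, Zin (zeta n) y &
    forall nu : algCaut, nu (zeta n) = zeta n ^+ (p ^ k) ->
    x ^+ (p ^ k) = nu x + p%:R * y.
Proof.
move=> p_pr n0 [P ->]; have [Q PE] := int_poly_expr k P p_pr.
exists (pZtoC Q).[zeta n]; first by exists Q.
move=> nu nuE; rewrite -horner_exp -rmorphXn /= PE rmorphD hornerD; congr (_ + _).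
  rewrite /= map_comp_poly map_polyXn /= horner_comp hornerXn -nuE -horner_map -map_poly_comp.
  by congr (_.[_]); apply: eq_map_poly => c; rewrite /= rmorph_int.
by rewrite /= map_polyZ hornerZ.
Qed.

(* Frobenius to the power [totient n] is trivial as [p] does not divide [n], so
   [x] is congruent modulo [p] to a high power of itself. *)
Lemma Zin_reduced p n x y : prime p -> (0 < n)%N -> ~~ (p %| n)%N ->
  Zin (zeta n) x -> Zin (zeta n) y -> x ^+ 2 = p%:R * y ->
  exists2 w, Zin (zeta n) w & x = p%:R * w.
Proof.
move=> p_pr n0 pn Zx Zy x2.
have [w Zw /(_ idfun)] := Zin_expr (totient n) p_pr n0 Zx.
have pz := zeta_prim n0.
have -> : zeta n ^+ (p ^ totient n) = zeta n.
  rewrite -{2}[zeta n]expr1; apply/eqP; rewrite (eq_prim_root_expr pz).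
  by apply/eqP/Euler_exp_totient; rewrite prime_coprime.
move=> /(_ erefl) /= xE.
have q2 : (2 <= p ^ totient n)%N.
  apply: leq_trans (prime_gt1 p_pr) _.
  by rewrite -{1}[p]expn1 leq_exp2l ?prime_gt1 // totient_gt0.
exists (y * x ^+ (p ^ totient n - 2) - w).
  by apply: ZinD; [apply: ZinM => //; apply: ZinX | apply: ZinN].
by rewrite mulrBr mulrA -x2 -exprD subnKC // xE addrK.
Qed.

(** * Square roots of discriminants in cyclotomic fields *)

Definition sqfree (n : nat) : bool :=
  (0 < n)%N && all (fun p => logn p n == 1%N) (primes n).

Lemma sqfreeP n : reflect ((0 < n)%N /\ forall p, (logn p n <= 1)%N) (sqfree n).
Proof.
apply: (iffP andP) => -[n0 H]; split=> //.
  move=> p; have [/(allP H)/eqP -> //|] := boolP (p \in primes n).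
  by rewrite -logn_gt0 lt0n negbK => /eqP ->.
by apply/allP => p; rewrite -logn_gt0 => lp; rewrite eqn_leq H.
Qed.

Lemma sqfree_gt0 n : sqfree n -> (0 < n)%N.
Proof. by case/andP. Qed.

Lemma sqfree_dvd d n : (d %| n)%N -> sqfree n -> sqfree d.
Proof.
move=> dn /sqfreeP[n0 H]; apply/sqfreeP; split=> [|p]; first exact: dvdn_gt0 dn.
exact: leq_trans (dvdn_leq_log p n0 dn) (H p).
Qed.

Lemma sqfree_coprime m n : sqfree m -> sqfree n -> coprime m n -> sqfree (m * n).
Proof.
move=> /sqfreeP[m0 Hm] /sqfreeP[n0 Hn] co; apply/sqfreeP.
rewrite muln_gt0 m0; split=> // p; rewrite lognM //.
have [->|lm] := posnP (logn p m); first exact: Hn.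
suff -> : logn p n = 0%N by rewrite addn0.
apply/eqP; rewrite -leqn0 leqNgt; apply/negP => ln.
move: lm ln; rewrite !logn_gt0 !mem_primes => /and3P[p_pr _ pm] /and3P[_ _ pn].
have : (p %| gcdn m n)%N by rewrite dvdn_gcd pm.
by rewrite (eqP co) dvdn1 => /eqP p1; rewrite p1 in p_pr.
Qed.

Lemma sqfree_prime p : prime p -> sqfree p.
Proof.
by move=> p_pr; rewrite /sqfree prime_gt0 // primes_prime //= logn_prime // eqxx.
Qed.

Lemma sqfreeMp p n : prime p -> sqfree (p * n) = ~~ (p %| n)%N && sqfree n.
Proof.
move=> p_pr; apply/idP/andP => [sf|[pn sn]]; last first.
  by apply: sqfree_coprime => //; [apply: sqfree_prime|rewrite prime_coprime].
have n0 : (0 < n)%N by have := sqfree_gt0 sf; rewrite muln_gt0 => /andP[].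
split; last exact: sqfree_dvd (dvdn_mull p (dvdnn n)) sf.
apply/negP => pn; have /sqfreeP[_ /(_ p)] := sf.
rewrite lognM ?(prime_gt0 p_pr) // logn_prime // eqxx add1n ltnS leqn0 => /eqP l0.
by have := pfactor_dvdn 1 p_pr n0; rewrite expn1 pn l0.
Qed.

Lemma sqfree_ind (P : nat -> Prop) : P 1%N ->
  (forall p n, prime p -> ~~ (p %| n)%N -> sqfree n -> P n -> P (p * n)%N) ->
  forall n, sqfree n -> P n.
Proof.
move=> P1 PS; elim/ltn_ind => n IH sn.
have n0 := sqfree_gt0 sn.
have [n1|n1] := leqP n 1; first by have -> : n = 1%N by lia.
have p_pr := pdiv_prime n1; have [k nE] := dvdnP (pdiv_dvd n).
move: sn p_pr nE n0 n1; set p := pdiv n => sn p_pr nE n0 n1.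
move: sn IH; rewrite nE mulnC sqfreeMp // => /andP[pk sk] IH.
apply: PS => //; apply: IH => //.
by rewrite -[X in (X < _)%N]mul1n ltn_pmul2r ?prime_gt1 ?sqfree_gt0.
Qed.

Lemma sqfree_dvdn m n : sqfree m ->
  (forall p, prime p -> (p %| m)%N -> (p %| n)%N) -> (m %| n)%N.
Proof.
move=> sm; elim/sqfree_ind: m / sm => // p k p_pr pk sk IH H.
rewrite Gauss_dvd ?prime_coprime // (H p) ?dvdn_mulr //=.
by apply: IH => q q_pr qk; apply: H; rewrite // dvdn_mull.
Qed.

Section PrimeStar.
Variable q : nat.
Hypotheses (q_pr : prime q) (q_odd : odd q).

Lemma prod_1_sub_root (z : algC) : q.-primitive_root z ->
  \prod_(1 <= k < q) (1 - z ^+ k) = q%:R.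
Proof.
move=> pz; have q0 := prime_gt0 q_pr.
have := factor_Xn_sub_1 pz; rewrite subrX1 big_ltn // expr0.
move=> /(mulfI (negbT (polyXsubC_eq0 _)))/(congr1 (fun p => p.[1])).
rewrite horner_prod (eq_bigr (fun k => 1 - z ^+ k)) => [->|k _]; last by rewrite !hornerE.
rewrite horner_sum (eq_bigr (fun=> 1)) => [|i _]; last by rewrite hornerXn expr1n.
by rewrite sumr_const card_ord.
Qed.

Definition star : int := (-1) ^+ q./2 * q%:Z.

(* The square root is obtained by pairing the factors [k] and [q - k] of
   [q = \prod_(0 < k < q) (1 - zeta q ^+ (2 * k))], without Gauss sums. *)
Lemma sqrt_star : exists2 S, Zin (zeta q) S & S ^+ 2 = star%:~R.
Proof.
have q0 := prime_gt0 q_pr; have pw := zeta_prim q0; set w := zeta q in pw *.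
have w0 : w != 0 by apply: zeta_neq0.
exists (\prod_(1 <= k < q./2.+1) (w ^+ k - w ^+ (q - k))).
  elim/big_ind: _ => [|x y|k _]; [exact: (Zin_int w 1)|exact: ZinM|].
  by apply: ZinD; [|apply: ZinN]; apply: ZinX; apply: Zin_gen.
have pz : q.-primitive_root (w ^+ 2).
  by rewrite prim_root_exp_coprime // coprime_sym coprimen2.
have qE : q = q./2.*2.+1 by have := odd_double_half q; lia.
rewrite /star rmorphM /= -[q%:~R]/(q%:R) -(prod_1_sub_root pz).
have qh : (q./2.+1 <= q)%N by rewrite [X in (_ <= X)%N]qE ltnS -addnn leq_addr.
rewrite [X in _ = _ * X](big_cat_nat (n := q./2.+1)) //=.
have -> : \prod_(q./2.+1 <= k < q) (1 - (w ^+ 2) ^+ k) =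
          \prod_(1 <= k < q./2.+1) (1 - (w ^+ 2) ^+ (q - k)).
  rewrite -[X in \prod_(X <= _ < q) _]add1n big_addn.
  rewrite (_ : (q - q./2)%N = q./2.+1); last by rewrite {1}qE; lia.
  by rewrite big_nat_rev; apply: eq_big_nat => k kr; congr (1 - _ ^+ _); lia.
rewrite -big_split /= rmorphXn rmorphN1.
have -> : (-1) ^+ q./2 = \prod_(1 <= k < q./2.+1) (-1 : algC).
  by rewrite prodr_const_nat subn1.
rewrite -big_split /= -prodrXl; apply: eq_big_nat => k /andP[k1 kr].
have wk : w ^+ k * w ^+ (q - k) = 1.
  by rewrite -exprD subnKC ?(prim_expr_order pw) //; lia.
by rewrite -!(exprM w) ![(2 * _)%N]mulnC !exprM; ring: wk.
Qed.
End PrimeStar.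

Lemma Zin_zeta_dvd d n x : (0 < n)%N -> (d %| n)%N -> Zin (zeta d) x -> Zin (zeta n) x.
Proof.
move=> n0 dn; apply: Zin_trans; have [k ->] := zeta_dvd n0 dn.
exact/ZinX/Zin_gen.
Qed.

Lemma Zin_eq_aut z x (nu nu' : algCaut) : nu z = nu' z -> Zin z x -> nu x = nu' x.
Proof.
move=> nuz [p ->]; rewrite -!horner_map nuz -!map_poly_comp; congr (_.[_]).
by apply: eq_map_poly => c; rewrite /= !rmorph_int.
Qed.

Lemma Zin_aut z x (nu : algCaut) : nu z = z -> Zin z x -> nu x = x.
Proof. exact: (@Zin_eq_aut z x nu idfun). Qed.

Lemma abs_star q : `|star q|%N = q.
Proof. by rewrite /star abszMsign. Qed.

Lemma star_mod4 q : odd q -> (4 %| star q - 1)%Z.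
Proof.
move=> qo; have qE : q = q./2.*2.+1 by have := odd_double_half q; lia.
have hE := odd_double_half q./2; apply/dvdzP; rewrite /star -signr_odd.
case: odd hE => hE; rewrite ?expr1 ?expr0.
  by exists (- (q./2./2)%:Z - 1); lia.
by exists (q./2./2)%:Z; lia.
Qed.

Lemma mod4_divr (x y : int) : (4 %| y - 1)%Z -> (4 %| x * y - 1)%Z -> (4 %| x - 1)%Z.
Proof.
move=> y4 xy4; have -> : x - 1 = (x * y - 1) - x * (y - 1) by ring.
by rewrite rpredB // dvdz_mull.
Qed.

Lemma sqrt_odd_disc (m : int) : sqfree `|m|%N -> (4 %| m - 1)%Z ->
  exists2 S, Zin (zeta `|m|%N) S & S ^+ 2 = m%:~R.
Proof.
move=> sm; move: {2}`|m|%N (erefl `|m|%N) sm => n nE; rewrite nE => sn.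
elim/sqfree_ind: n / sn m nE => [|p n p_pr pn sn IH] m nE m4.
  have -> : m = 1 by lia.
  by exists 1; rewrite ?expr1n //; apply: (Zin_int _ 1).
have n0 := sqfree_gt0 sn.
have p_odd : odd p.
  have : odd `|m|%N by lia.
  by rewrite nE oddM => /andP[].
have ps := star_mod4 p_odd.
have [Sp Zp Sp2] := sqrt_star p_pr p_odd.
have /dvdzP[m' mE] : (star p %| m)%Z by rewrite dvdzE abs_star nE dvdn_mulr.
have m'E : `|m'|%N = n.
  apply/eqP; rewrite -(eqn_pmul2r (prime_gt0 p_pr)) -{1}(abs_star p) -abszM -mE nE.
  by rewrite mulnC.
have [|S ZS S2] := IH m' m'E.
  by rewrite mE in m4; apply: mod4_divr ps m4.
have pn0 : (0 < p * n)%N by rewrite muln_gt0 prime_gt0.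
exists (S * Sp); last by rewrite mE intrM exprMn S2 Sp2.
apply: ZinM; first exact: Zin_zeta_dvd (dvdn_mull p (dvdnn n)) ZS.
exact: Zin_zeta_dvd (dvdn_mulr n (dvdnn p)) Zp.
Qed.

Lemma zeta4_sqr : zeta 4 ^+ 2 = -1.
Proof.
have p4 := zeta_prim (isT : 0 < 4)%N.
have /eqP : (zeta 4 ^+ 2) ^+ 2 = 1 by rewrite -exprM (prim_expr_order p4).
by rewrite sqrf_eq1 -(prim_order_dvd p4) => /orP[|/eqP].
Qed.

Lemma zeta8_4 : zeta 8 ^+ 4 = -1.
Proof.
have p4 := zeta_prim (isT : 0 < 8)%N.
have /eqP : (zeta 8 ^+ 4) ^+ 2 = 1 by rewrite -exprM (prim_expr_order p4).
by rewrite sqrf_eq1 -(prim_order_dvd p4) => /orP[|/eqP].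
Qed.

Definition even_disc : seq int := [:: 1; -4; 8; -8].

Definition sqrt_even (D : int) : algC :=
  if D == 1 then 1 else if D == -4 then 2 * zeta 4
  else if D == 8 then 2 * (zeta 8 - zeta 8 ^+ 3)
  else 2 * zeta 8 ^+ 2 * (zeta 8 - zeta 8 ^+ 3).

Lemma sqrt_even_sqr D : D \in even_disc -> sqrt_even D ^+ 2 = D%:~R.
Proof.
have z8 := zeta8_4; have z4 := zeta4_sqr.
rewrite !inE => /or4P[] /eqP ->; rewrite /sqrt_even /=.
- by rewrite expr1n.
- by ring: z4.
- by ring: z8.
- by ring: z8.
Qed.

Lemma sqrt_even_Zin D : D \in even_disc -> Zin (zeta `|D|%N) (sqrt_even D).
Proof.
rewrite !inE => /or4P[] /eqP ->; rewrite /sqrt_even /=.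
- exact: (Zin_int _ 1).
- by apply: ZinM; [apply: (Zin_int _ 2)|apply: Zin_gen].
- apply: ZinM; [apply: (Zin_int _ 2)|apply: ZinD; last apply: ZinN; last apply: ZinX];
    exact: Zin_gen.
- apply: ZinM; [apply: ZinM; [apply: (Zin_int _ 2)|apply: ZinX]
  |apply: ZinD; last apply: ZinN; last apply: ZinX]; exact: Zin_gen.
Qed.

(* The discriminant of the quadratic field (or of Q itself) is [D * m]. *)
Definition fund_disc (D m : int) : bool :=
  [&& D \in even_disc, sqfree `|m|%N & (4 %| m - 1)%Z].

Lemma sqrt_disc D m : fund_disc D m ->
  exists2 S, Zin (zeta (absz (D * m))) S & S ^+ 2 = (D * m)%:~R.
Proof.
case/and3P => DD sm m4; have [S ZS S2] := sqrt_odd_disc sm m4.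
have D0 : (0 < `|D|)%N by move: DD; rewrite !inE => /or4P[] /eqP ->.
have Dm0 : (0 < absz (D * m)%R)%N by rewrite abszM muln_gt0 D0 sqfree_gt0.
exists (sqrt_even D * S); last by rewrite exprMn S2 sqrt_even_sqr // intrM.
apply: ZinM.
  by apply: Zin_zeta_dvd Dm0 _ (sqrt_even_Zin DD); rewrite abszM dvdn_mulr.
by apply: Zin_zeta_dvd Dm0 _ ZS; rewrite abszM dvdn_mull.
Qed.

Lemma even_disc_gt0 D : D \in even_disc -> (0 < `|D|)%N.
Proof. by rewrite !inE => /or4P[] /eqP ->. Qed.

Lemma even_disc_dvd8 D : D \in even_disc -> (`|D| %| 8)%N.
Proof. by rewrite !inE => /or4P[] /eqP ->. Qed.

Lemma odd_mod4 (m : int) : (4 %| m - 1)%Z -> odd `|m|.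
Proof. by case/dvdzP => k; lia. Qed.

Lemma coprime_even_disc D n : D \in even_disc -> odd n -> coprime `|D| n.
Proof.
move=> DD no; apply: coprime_dvdl (even_disc_dvd8 DD) _.
by rewrite (_ : 8 = 2 ^ 3)%N // coprimeXl // coprime2n.
Qed.

Lemma fund_disc_gt0 D m : fund_disc D m -> (0 < absz (D * m)%R)%N.
Proof.
by case/and3P => /even_disc_gt0 D0 sm _; rewrite abszM muln_gt0 D0 sqfree_gt0.
Qed.

Lemma aut_sign_eq_sqr (nu : algCaut) (S T : algC) c : S ^+ 2 = T ^+ 2 ->
  nu T = (-1) ^+ c * T -> nu S = (-1) ^+ c * S.
Proof.
by move=> /eqP; rewrite eqf_sqr => /orP[] /eqP -> // nuT; rewrite rmorphN /= nuT mulrN.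
Qed.

Lemma sqr_rat_int (x : rat) (n : int) : x ^+ 2 = n%:~R -> exists k : int, n = k ^+ 2.
Proof.
move=> x2; suff /intrP[k kE] : x \is a Num.int.
  by exists k; apply/eqP; rewrite -(eqr_int rat) rmorphXn /= -kE x2.
rewrite -Cint_rat; apply: Cint_rat_Aint; first exact: Crat_rat.
apply: (@root_monic_Aint ('X^2 - (n%:~R)%:P)).
- by rewrite rootE !hornerE -rmorphXn /= x2 ratr_int subrr.
- exact: monicXnsubC.
- apply/polyOverP => i; rewrite coefB coefC coefXn rpredB ?rpred_nat //.
  by case: ifP; rewrite ?rpred_int ?rpred0.
Qed.

Lemma star_not_sqr q (k : int) : prime q -> star q <> k ^+ 2.
Proof.
move=> q_pr qk; have : logn q `|star q| = logn q `|k ^+ 2| by rewrite qk.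
rewrite abs_star abszX lognX logn_prime // eqxx.
by case: (logn q `|k|%N) => [|[|]].
Qed.

(* A prime factor of the discriminant not dividing [n] ramifies outside
   Q(zeta_n), so its square root can be negated while [zeta n] is fixed. *)
Lemma flip_sqrt_disc D m n S : fund_disc D m -> (0 < n)%N ->
  S ^+ 2 = (D * m)%:~R -> ~~ (absz (D * m)%R %| n)%N ->
  exists2 nu : algCaut, nu (zeta n) = zeta n & nu S = - S.
Proof.
move=> fD n0 S2 ndvd; have [DD sm m4] := and3P fD.
have D0 := even_disc_gt0 DD.
have [mn|mn] := boolP (`|m| %| n)%N; last first.
  have [q [q_pr qm qn]] : exists q, [/\ prime q, (q %| `|m|)%N & ~~ (q %| n)%N].
    have /allPn[q] : ~~ all (fun q => q %| n)%N (primes `|m|).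
      apply: contra mn => /allP H; apply: (sqfree_dvdn sm) => p p_pr pm.
      apply: H; by rewrite mem_primes p_pr (sqfree_gt0 sm) pm.
    by rewrite mem_primes => /and3P[q_pr _ qm] qn; exists q.
  have q_odd : odd q.
    exact: dvdn_odd qm (odd_mod4 m4).
  have [Sq Zq Sq2] := sqrt_star q_pr q_odd.
  have /dvdzP[m' mE] : (star q %| m)%Z by rewrite dvdzE abs_star.
  have [qm' sm'] : ~~ (q %| `|m'|)%N /\ sqfree `|m'|.
    apply/andP; rewrite -sqfreeMp //.
    by move: sm; rewrite mE abszM abs_star mulnC.
  have m4' : (4 %| m' - 1)%Z.
    by rewrite mE in m4; apply: mod4_divr (star_mod4 q_odd) m4.
  have fD' : fund_disc D m' by apply/and3P.
  have [S' ZS' S'2] := sqrt_disc fD'.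
  have N0 : (0 < n * absz (D * m')%R)%N by rewrite muln_gt0 n0 fund_disc_gt0.
  have q0 := prime_gt0 q_pr.
  have [nu0 nu0q] : exists nu0 : algCaut, nu0 Sq <> Sq.
    apply: contrapT => H; have /CratP[x xE] : Sq \in Crat.
      by apply: fixes_Crat => nu _; apply: contrapT => nuq; apply: H; exists nu.
    have [k /star_not_sqr] : exists k, star q = k ^+ 2; last exact.
    apply: (@sqr_rat_int x); apply: (fmorph_inj (ratr : rat -> algC)).
    by rewrite rmorphXn /= -xE Sq2 ratr_int.
  have [a aq nu0a] := aut_zeta_exp nu0 q0.
  have qN : ~~ (q %| n * absz (D * m')%R)%N.
    rewrite Euclid_dvdM // negb_or qn abszM Euclid_dvdM // negb_or qm' andbT.
    by rewrite -prime_coprime // coprime_sym coprime_even_disc.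
  have [|nu [nuq nuN]] := aut_chinese q0 N0 aq (coprime1n _) (b := 1).
    by rewrite (eqP (_ : coprime _ _)) ?prime_coprime // !modn1.
  rewrite expr1 in nuN.
  exists nu.
    by rewrite (aut_zeta_dvd N0 (dvdn_mulr _ (dvdnn n)) (a := 1)) ?expr1.
  suff : nu (Sq * S') = (-1) ^+ 1 * (Sq * S').
    move/(aut_sign_eq_sqr (S := S)); rewrite expr1 mulN1r; apply.
    by rewrite S2 exprMn Sq2 S'2 -intrM mE; congr (_%:~R); ring.
  rewrite rmorphM /= (Zin_aut _ (Zin_zeta_dvd N0 (dvdn_mull _ (dvdnn _)) ZS')) //.
  rewrite expr1 mulN1r -mulNr; congr (_ * _).
  have -> : nu Sq = nu0 Sq by apply: Zin_eq_aut Zq; rewrite nuq.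
  have : (nu0 Sq) ^+ 2 == Sq ^+ 2 by rewrite -rmorphXn Sq2 /= rmorph_int.
  by rewrite eqf_sqr => /orP[] /eqP.
have mo := odd_mod4 m4.
have Dm1 : ~~ (`|D| %| n * `|m|)%N.
  rewrite Gauss_dvdl ?coprime_even_disc //.
  by apply: contra ndvd => Dn; rewrite abszM Gauss_dvd ?Dn ?coprime_even_disc.
have [Sm ZSm Sm2] := sqrt_odd_disc sm m4.
have N0 : (0 < n * `|m|)%N by rewrite muln_gt0 n0 sqfree_gt0.
have [a a8 [aN aD]] : exists2 a, coprime a 8 & a = 1 %[mod gcdn 8 (n * `|m|)] /\
    forall nu : algCaut, nu (zeta 8) = zeta 8 ^+ a -> nu (sqrt_even D) = - sqrt_even D.
  have g8 := dvdn_gcdl 8 (n * `|m|); have gN := dvdn_gcdr 8 (n * `|m|).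
  have z8 := zeta8_4; have z4 := zeta4_sqr.
  move: DD Dm1; rewrite !inE => /or4P[] /eqP -> //= Dm1.
  - by rewrite dvd1n in Dm1.
  - exists 3%N => //; split=> [|nu nuE].
      move: g8 gN Dm1; set g := gcdn _ _; rewrite dvdn_divisors // !inE.
      by move=> /or4P[] /eqP -> // H /negP[]; apply: dvdn_trans H.
    have nu4 : nu (zeta 4) = zeta 4 ^+ 3 by apply: aut_zeta_dvd nuE.
    by rewrite -[sqrt_even _]/(2 * zeta 4) rmorphM /= nu4 rmorph_nat; ring: z4.
  - exists 5%N => //; split=> [|nu nuE].
      move: g8 gN Dm1; set g := gcdn _ _; rewrite dvdn_divisors // !inE.
      by move=> /or4P[] /eqP -> // H /negP[]; apply: dvdn_trans H.
    rewrite -[sqrt_even _]/(2 * (zeta 8 - zeta 8 ^+ 3)).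
    have n3 : nu (zeta 8 ^+ 3) = (zeta 8 ^+ 5) ^+ 3 by rewrite rmorphXn nuE.
    by rewrite rmorphM rmorphB /= n3 nuE rmorph_nat; ring: z8.
  - exists 5%N => //; split=> [|nu nuE].
      move: g8 gN Dm1; set g := gcdn _ _; rewrite dvdn_divisors // !inE.
      by move=> /or4P[] /eqP -> // H /negP[]; apply: dvdn_trans H.
    rewrite -[sqrt_even _]/(2 * zeta 8 ^+ 2 * (zeta 8 - zeta 8 ^+ 3)).
    have n3 : nu (zeta 8 ^+ 3) = (zeta 8 ^+ 5) ^+ 3 by rewrite rmorphXn nuE.
    have n2 : nu (zeta 8 ^+ 2) = (zeta 8 ^+ 5) ^+ 2 by rewrite rmorphXn nuE.
    by rewrite rmorphM rmorphB /= n3 nuE rmorphM /= n2 rmorph_nat; ring: z8.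
have [nu [nu8 nuN]] := aut_chinese (isT : 0 < 8)%N N0 a8 (coprime1n _) aN.
exists nu; first by rewrite (aut_zeta_dvd N0 (dvdn_mulr _ (dvdnn n)) nuN) expr1.
suff : nu (sqrt_even D * Sm) = (-1) ^+ 1 * (sqrt_even D * Sm).
  move/(aut_sign_eq_sqr (S := S)); rewrite expr1 mulN1r; apply.
  by rewrite S2 exprMn Sm2 sqrt_even_sqr // intrM.
rewrite rmorphM /= aD // (Zin_aut _ (Zin_zeta_dvd N0 (dvdn_mull _ (dvdnn _)) ZSm)) //.
by rewrite expr1 mulN1r mulNr.
Qed.

Lemma Aint_dvdz (n : int) (p : nat) (y : algC) : (0 < p)%N -> y \in Aint ->
  n%:~R = p%:R * y -> (p %| n)%Z.
Proof.
move=> p0 yA nE; have pN0 : p%:R != 0 :> algC by rewrite pnatr_eq0 -lt0n.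
have /intrP[k kE] : y \in Num.int.
  apply: Cint_rat_Aint => //; apply/CratP; exists (n%:~R / p%:R).
  by rewrite fmorph_div /= ratr_int ratr_nat nE mulrC mulKf.
by apply/dvdzP; exists k; apply/eqP; rewrite -(eqr_int algC) nE kE intrM mulrC.
Qed.

(** * The Kronecker symbol as a Galois action *)

Lemma Fp_sqr_expr p (c : 'F_p) : prime p -> odd p -> c != 0 ->
  c ^+ p./2 = if [exists x, x ^+ 2 == c] then 1 else -1.
Proof.
move=> p_pr po c0.
have pE : p.-1 = (2 * p./2)%N by have := odd_double_half p; lia.
have fermat (x : 'F_p) : x != 0 -> x ^+ p.-1 = 1.
  move=> x0; apply: (mulfI x0); rewrite mulr1 -exprS prednK ?prime_gt0 //.
  by have := expf_card x; rewrite card_Fp.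
have : (c ^+ p./2) ^+ 2 == 1 by rewrite -exprM mulnC -pE fermat.
rewrite sqrf_eq1; case: ifP => [/existsP[x /eqP xE] _|nex].
  by rewrite -xE -exprM -pE fermat //; apply: contraNneq c0 => x0; rewrite -xE x0 expr0n.
case/orP => /eqP // c1; case/existsP: nex.
pose rs := [seq x <- enum 'F_p | x != 0].
have p0 : (0 < p.-1)%N by have := prime_gt1 p_pr; lia.
have /hasP[w _ pw] : has (p.-1).-primitive_root rs.
  apply: has_prim_root => //.
  - by apply/allP => x; rewrite mem_filter => /andP[x0 _]; apply/unity_rootP/fermat.
  - by rewrite filter_uniq ?enum_uniq.
  - have <- : #|predC1 (0 : 'F_p)| = p.-1 by rewrite cardC1 card_Fp.
    rewrite cardE uniq_leq_size ?enum_uniq // => x.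
    by rewrite !mem_enum mem_filter mem_enum !inE andbT.
have [i cE] := prim_rootP pw (fermat _ c0).
have : (p.-1 %| i * p./2)%N by rewrite (prim_order_dvd pw) exprM -cE c1.
rewrite [X in (X %| _)%N]pE dvdn_pmul2r; last by lia.
by case/dvdnP => k iE; exists (w ^+ k); rewrite -exprM -iE cE.
Qed.

Lemma kronecker_prime_expr p (c : int) : prime p -> odd p -> ~~ (p %| c)%Z ->
  (p %| c ^+ p./2 - kronecker_prime c p)%Z.
Proof.
move=> p_pr po pc; have pF := pchar_Fp p_pr.
rewrite (dvdz_pcharf pF) rmorphB rmorphXn /= subr_eq0; apply/eqP.
rewrite Fp_sqr_expr -?(dvdz_pcharf pF) // /kronecker_prime (negPf pc).
have -> : (p == 2) = false by case: eqP po => // ->.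
have -> : [exists x : 'F_p, x ^+ 2 == c%:~R] = [exists x : 'I_p, (p %| x%:Z ^+ 2 - c)%Z].
  have FI : p = (Zp_trunc (pdiv p)).+2 by rewrite (Fp_cast p_pr).
  apply/existsP/existsP => -[x xc].
    exists (cast_ord (esym FI) x); rewrite (dvdz_pcharf pF) rmorphB rmorphXn /= subr_eq0.
    by rewrite -pmulrn natr_Zp.
  exists (cast_ord FI x); move: xc; rewrite (dvdz_pcharf pF) rmorphB rmorphXn /= subr_eq0.
  by rewrite -pmulrn -(natr_Zp (cast_ord FI x)).
by case: ifP.
Qed.

Lemma mod8_parity (t : int) :
  (if ((t * 4 + 1) %% 8 == 1)%Z || ((t * 4 + 1) %% 8 == 7)%Z then 1 else -1 : int) =
  if (2 %| t)%Z then 1 else -1.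
Proof.
have [/dvdzP[k ->]|t2] := boolP (2 %| t)%Z; first by case: ifP => //; lia.
by case: ifP => //; lia.
Qed.

Lemma prod_primes_sub (F : nat -> int) (s : seq nat) n : uniq s ->
  {subset primes n <= s} ->
  \prod_(q <- s) F q ^+ logn q n = \prod_(q <- primes n) F q ^+ logn q n.
Proof.
move=> us sub; rewrite (bigID (mem (primes n))) /= [X in _ * X]big1 ?mulr1.
  rewrite -big_filter; apply: perm_big; apply: uniq_perm; rewrite ?primes_uniq ?filter_uniq //.
  move=> q; rewrite mem_filter /=; apply/andP/idP => [[]//|qn].
  by split=> //; apply: sub.
by move=> q; rewrite -logn_gt0 lt0n negbK => /eqP ->; rewrite expr0.
Qed.

Lemma kroneckerMp c p b : prime p -> (0 < b)%N ->
  kronecker c (p * b) = kronecker_prime c p * kronecker c b.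
Proof.
move=> p_pr b0; have p0 := prime_gt0 p_pr.
rewrite /kronecker muln_eq0 (gtn_eqF p0) (gtn_eqF b0) /=.
rewrite (eq_bigr (fun q => kronecker_prime c q ^+ logn q p * kronecker_prime c q ^+ logn q b)).
  rewrite big_split /= !prod_primes_sub ?primes_uniq //.
  - by rewrite primes_prime // big_seq1 logn_prime // eqxx expr1.
  - by move=> q; rewrite primesM // => ->; rewrite orbT.
  - by move=> q; rewrite primesM // => ->.
by move=> q _; rewrite lognM // exprD.
Qed.

Section KroneckerAut.
Variables (f : nat) (D m : int) (S : algC).
Hypotheses (f0 : (0 < f)%N) (fD : fund_disc D m) (Df : (absz (D * m)%R %| f)%N).
Hypotheses (ZS : Zin (zeta f) S) (S2 : S ^+ 2 = (D * m)%:~R).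

Lemma sqrt_aut_sign (nu : algCaut) : nu S = S \/ nu S = - S.
Proof.
have : (nu S) ^+ 2 == S ^+ 2 by rewrite -rmorphXn S2 /= rmorph_int.
by rewrite eqf_sqr => /orP[] /eqP; auto.
Qed.

Lemma kronecker_prime_sqrt p (nu : algCaut) : prime p -> ~~ (p %| f)%N ->
  nu (zeta f) = zeta f ^+ p -> nu S = (kronecker_prime (D * m) p)%:~R * S.
Proof.
move=> p_pr pf nuE; set c := D * m.
have S2c : S ^+ 2 = c%:~R := S2.
have zA : zeta f \in Aint by apply: Aint_prim_root (zeta_prim f0).
have pc : ~~ (p %| c)%Z by apply: contra pf => /dvdn_trans; apply.
have [y Zy /(_ nu)] := Zin_expr 1 p_pr f0 ZS.
rewrite expn1 => /(_ nuE) SE.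
have k1 : kronecker_prime c p = 1 \/ kronecker_prime c p = -1.
  by rewrite /kronecker_prime (negPf pc); do 2?case: ifP; auto.
have [p2|po] := even_prime p_pr; last first.
  have /dvdzP[l lE] := kronecker_prime_expr p_pr po pc.
  pose w := l%:~R * S - y.
  have wA : w \in Aint.
    by apply: (Zin_Aint zA); apply: ZinD; [apply: ZinM => //; apply: Zin_int|apply: ZinN].
  have nuw : nu S = (kronecker_prime c p)%:~R * S + p%:R * w.
    have Sp : S ^+ p = ((kronecker_prime c p)%:~R + l%:~R * p%:R) * S.
      have -> : (kronecker_prime c p)%:~R + l%:~R * p%:R = (S ^+ 2) ^+ p./2.
        by rewrite S2c -rmorphXn /= -[c ^+ _](subrK (kronecker_prime c p)) lE addrC intrD intrM.
      by rewrite -exprM -exprSr mul2n -add1n -{1}(odd_double_half p) po.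
    have -> : nu S = S ^+ p - p%:R * y by rewrite SE addrK.
    by rewrite Sp /w; ring.
  suff bad : (p%:R * w) ^+ 2 <> 4 * c%:~R.
    have pw : p%:R * w = nu S - (kronecker_prime c p)%:~R * S by rewrite nuw addrAC subrr add0r.
    have [nuS|nuS] := sqrt_aut_sign nu; case: k1 => kE; rewrite kE ?rmorph1 ?rmorphN1 ?mul1r ?mulN1r //.
      by case: bad; rewrite pw nuS kE -S2c; ring.
    by case: bad; rewrite pw nuS kE -S2c; ring.
  move=> w2; have : (p %| 4 * c)%Z.
    apply: (@Aint_dvdz _ _ (p%:R * w ^+ 2)); rewrite ?prime_gt0 //.
      by rewrite rpredM ?rpredX // rpred_nat.
    by rewrite rmorphM /= -[4%:~R]/(4 : algC) -w2; ring.
  rewrite dvdzE abszM Euclid_dvdM // => /orP[|H]; last by case/negP: pc.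
  move=> H4; have {H4} : (p %| 2 ^ 2)%N := H4.
  by rewrite Euclid_dvdX // andbT dvdn_prime2 // => /eqP pE; rewrite pE in po.
rewrite {}p2 in p_pr pf nuE pc SE k1 *.
have fo : odd f by rewrite dvdn2 negbK in pf.
have [DD sm m4] := and3P fD.
have c4 : (4 %| c - 1)%Z.
  have := dvdn_odd Df fo; rewrite abszM oddM => /andP[Do _].
  move: Do; rewrite /c; move: DD; rewrite !inE => /or4P[] /eqP -> //= _.
  by rewrite mul1r.
have /dvdzP[t tE] := c4.
have S2t : S ^+ 2 = 4 * t%:~R + 1.
  by rewrite S2c -[c](subrK 1) tE intrD intrM mulrC.
have [w Zw SwE] : exists2 w, Zin (zeta f) w & S - 1 = 2 * w.
  apply: (@Zin_reduced 2 f _ (2%:~R * t%:~R + 1%:~R - S)) => //.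
  - by apply: ZinD => //; apply: (Zin_int _ (-1)).
  - apply: ZinD; last exact: ZinN.
    by apply: ZinD; [apply: ZinM|]; apply: Zin_int.
  - have -> : (S - 1) ^+ 2 = S ^+ 2 + 1 - 2 * S by ring.
    by rewrite S2t -[2%:~R]/(2 : algC) -[1%:~R]/(1 : algC); ring.
have wt : w ^+ 2 + w = t%:~R.
  have n4 : (4 : algC) != 0 by rewrite pnatr_eq0.
  have SE' : S = 2 * w + 1 by rewrite -SwE subrK.
  apply: (mulfI n4); apply: (addIr 1); rewrite -S2t SE'; ring.
have [v Zv /(_ nu)] := Zin_expr 1 p_pr f0 Zw.
rewrite expn1 => /(_ nuE) wE.
have nuwE : nu S = 2 * nu w + 1.
  by rewrite -[S](subrK 1) SwE rmorphD rmorphM rmorph_nat rmorph1.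
have n2 : (2 : algC) != 0 by rewrite pnatr_eq0.
have vA : v \in Aint by apply: Zin_Aint Zv.
have wA : w \in Aint by apply: Zin_Aint Zw.
have SE' : S = 2 * w + 1 by rewrite -SwE subrK.
have kE : kronecker_prime c 2 = if (2 %| t)%Z then 1 else -1.
  have cE : c = t * 4 + 1 by rewrite -tE subrK.
  rewrite /kronecker_prime (negPf pc) /= cE.
  exact: mod8_parity.
rewrite kE; have [nuS|nuS] := sqrt_aut_sign nu; rewrite nuS.
  have wn : nu w = w by apply: (mulfI n2); move: nuwE; rewrite nuS SE' => /addIr.
  have -> : (2 %| t)%Z; last by rewrite mul1r.
  apply: (@Aint_dvdz _ _ (w + v)) => //; first by rewrite rpredD.
  by rewrite -wt wE wn; ring.
have wn : nu w = - w - 1.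
  by apply: (mulfI n2); apply: (addIr 1); rewrite -nuwE nuS SE'; ring.
have : (2 %| t + 1)%Z.
  by apply: (@Aint_dvdz _ _ v) => //; rewrite rmorphD /= -wt wE wn; ring.
move=> t1; rewrite ifF ?mulN1r //; apply/negP => t2.
have : (2 %| (t + 1) - t)%Z by rewrite rpredB.
by rewrite addrAC subrr.
Qed.

Lemma kronecker_sqrt a (nu : algCaut) : (0 < a)%N -> coprime a f ->
  nu (zeta f) = zeta f ^+ a -> nu S = (kronecker (D * m) a)%:~R * S.
Proof.
elim/ltn_ind: a nu => a IH nu a0 af nuE.
have [a1|a1] := leqP a 1.
  have {a0 a1}aE : a = 1%N by apply/eqP; rewrite eqn_leq a1.
  rewrite (Zin_aut _ ZS) ?nuE aE ?expr1 //.
  by rewrite /kronecker /= big_nil mul1r.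
have p_pr := pdiv_prime a1; have [b aE] := dvdnP (pdiv_dvd a).
move: p_pr aE; set p := pdiv a => p_pr aE; rewrite mulnC in aE.
move: a0 af nuE IH; rewrite {a1}aE muln_gt0 coprimeMl => /andP[p0 b0] /andP[pf bf] nuE IH.
have [nu1 nu1E] := aut_zeta_exists f0 pf.
have [nu2 nu2E] := aut_zeta_exists f0 bf.
have -> : nu S = nu1 (nu2 S).
  apply: (@Zin_eq_aut _ _ nu (nu1 \o nu2)) ZS.
  by rewrite nuE /= nu2E rmorphXn /= nu1E exprM.
have ltb : (b < p * b)%N by rewrite -[X in (X < _)%N]mul1n ltn_pmul2r ?prime_gt1.
rewrite /= (IH b ltb nu2 b0 bf nu2E) rmorphM /= rmorph_int.
rewrite (kronecker_prime_sqrt p_pr _ nu1E) -?prime_coprime //.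
by rewrite kroneckerMp // intrM mulrCA mulrA.
Qed.
End KroneckerAut.

Lemma sqfree_sqr_decomp n : (0 < n)%N -> exists s k, sqfree s /\ n = (s * k ^ 2)%N.
Proof.
elim/ltn_ind: n => n IH n0.
have [sn|] := boolP (sqfree n); first by exists n, 1%N; rewrite muln1.
rewrite /sqfree n0 /= => /allPn[p]; rewrite mem_primes => /and3P[p_pr _ pn] lp.
have p2n : (p ^ 2 %| n)%N.
  rewrite pfactor_dvdn //; have : (0 < logn p n)%N by rewrite logn_gt0 mem_primes p_pr n0.
  by case: (logn p n) lp => [|[|]].
case/dvdnP: p2n => n' nE; have p0 := prime_gt0 p_pr.
have n'0 : (0 < n')%N by move: n0; rewrite nE muln_gt0 => /andP[].
have [|s [k [ss n'E]]] := IH n' _ n'0.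
  by rewrite nE -[X in (X < _)%N]muln1 ltn_pmul2l // -(exp1n 2) ltn_exp2r // prime_gt1.
by exists s, (k * p)%N; rewrite nE n'E expnMn mulnA.
Qed.

Lemma odd_disc_of_odd n : odd n -> exists e : bool, (4 %| (-1) ^+ e * n%:Z - 1)%Z.
Proof.
move=> no; have hE := odd_double_half n; have hhE := odd_double_half n./2.
exists (odd n./2); apply/dvdzP; case: (odd n./2) hhE => hhE.
  by exists (- (n./2./2)%:Z - 1); rewrite expr1; lia.
by exists (n./2./2)%:Z; rewrite expr0; lia.
Qed.

Lemma rat_disc_decomp (g : rat) : g != 0 ->
  exists D m (q : rat), fund_disc D m /\ g = (D * m)%:~R * q ^+ 2.
Proof.
move=> g0; have num0 : numq g != 0 by rewrite numq_eq0.
have den0 := denq_neq0 g.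
pose N := numq g * denq g.
have N0 : (0 < `|N|)%N by rewrite absz_gt0 mulf_neq0.
have [s [k [ss sE]]] := sqfree_sqr_decomp N0.
have [s' [c [s'o sE' ss']]] : exists s' (c : bool), [/\ odd s', s = (2 ^ c * s')%N & sqfree s'].
  have [so|] := boolP (odd s); first by exists s, false; rewrite mul1n.
  rewrite -dvdn2 => /dvdnP[s' s'E]; move: ss; rewrite s'E mulnC sqfreeMp // dvdn2 negbK => /andP[so ss'].
  by exists s', true.
have [e e4] := odd_disc_of_odd s'o; set m : int := (-1) ^+ e * s'%:Z in e4.
have ms : sqfree `|m| by rewrite /m abszMsign.
have NE : N = (-1) ^+ (N < 0)%R * ((-1) ^+ e * 2 ^+ c * m * k%:Z ^+ 2).
  rewrite {1}[N]intEsign; congr (_ * _).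
  rewrite sE sE' /m !PoszM.
  by case: (e); case: (c); rewrite ?expr1 ?expr0 ?expn1 ?expn0; ring.
have gE : g = N%:~R * ((denq g)%:~R^-1) ^+ 2.
  rewrite -{1}[g]divq_num_den intrM expr2 mulrA mulfK // intr_eq0 //.
have d0 : (denq g)%:~R != 0 :> rat by rewrite intr_eq0.
pose b := (N < 0)%R (+) e.
have NE' : N = (-1) ^+ b * 2 ^+ c * m * k%:Z ^+ 2.
  by rewrite {1}NE /b signr_addb !mulrA.
have [bc|bc] := boolP (~~ b && ~~ c).
  exists 1, m, (k%:R / (denq g)%:~R); split; first by rewrite /fund_disc ms e4.
  case/andP: bc => /negPf b0 /negPf c0.
  by rewrite {1}gE NE' b0 c0 !expr0 !mul1r intrM rmorphXn /= -[k%:~R]/(k%:R); field.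
exists (4 * ((-1) ^+ b * 2 ^+ c)), m, (k%:R / (2 * (denq g)%:~R)); split.
  rewrite /fund_disc ms e4 !andbT; case: (b) (c) bc => [] [] //.
rewrite {1}gE NE'; move: ((-1) ^+ b * 2 ^+ c) => U; clearbody m.
by rewrite !intrM -[4%:~R]/(4 : rat) -[k%:~R]/(k%:R); field.
Qed.

(** * Kummer theory over cyclotomic fields *)

Lemma minPoly_Kummer (F : fieldType) (L : fieldExtType F) (K : {subfield L})
    (z a : L) n m : n.-primitive_root z -> z \in K -> a != 0 -> a ^+ n \in K ->
  (0 < m)%N -> a ^+ m \in K -> (forall k, (0 < k < m)%N -> a ^+ k \notin K) ->
  minPoly K a = 'X^m - (a ^+ m)%:P.
Proof.
move=> pz zK a0 anK m0 amK amin; set p := minPoly K a.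
have n0 := prim_order_gt0 pz.
have z0 : z != 0.
  apply/eqP => z0; have /eqP := prim_expr_order pz.
  by rewrite z0 expr0n gtn_eqF // eq_sym oner_eq0.
pose rs := [seq z ^+ i * a | i <- iota 0 n].
have pXK k : a ^+ k \in K -> 'X^k - (a ^+ k)%:P \is a polyOver K.
  by move=> akK; rewrite rpredB ?polyOverXn // polyOverC.
have Xn : 'X^n - (a ^+ n)%:P = \prod_(x <- rs) ('X - x%:P).
  rewrite -[RHS]scale1r -(monicP (monicXnsubC (a ^+ n) n0)).
  apply: all_roots_prod_XsubC.
  - by rewrite size_XnsubC // size_map size_iota.
  - apply/allP => _ /mapP[i _ ->]; rewrite rootE !hornerE.
    by rewrite exprMn exprAC (prim_expr_order pz) expr1n mul1r subrr.
  - rewrite uniq_rootsE map_inj_in_uniq ?iota_uniq // => i j.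
    rewrite !mem_iota !add0n /= => ilt jlt /(mulIf a0)/eqP.
    by rewrite (eq_prim_root_expr pz) !modn_small // => /eqP.
have [msk pE] : {msk | p %= \prod_(x <- mask msk rs) ('X - x%:P)}.
  apply: (@dvdp_prod_XsubC _ _ rs id); rewrite -Xn; apply: minPoly_dvdp; first exact: pXK.
  by rewrite rootE !hornerE subrr.
have {}pE : p = \prod_(x <- mask msk rs) ('X - x%:P).
  by apply/eqP; rewrite -eqp_monic ?monic_minPoly ?monic_prod_XsubC.
set k := size (mask msk rs).
have pk : size p = k.+1 by rewrite pE size_prod_XsubC.
have k0 : (0 < k)%N by rewrite -ltnS -pk size_minPoly.
have [c [cK c0 pc]] : exists c, [/\ c \in K, c != 0 & p.[0] = c * a ^+ k].
  rewrite pE horner_prod /k; have : {subset mask msk rs <= rs} by move=> x; apply: mem_mask.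
  elim: (mask msk rs) => [|x s IH] sub; first by exists 1; rewrite big_nil mem1v oner_eq0 mulr1.
  have [|c [cK c0 cE]] := IH; first by move=> y ys; apply: sub; rewrite in_cons ys orbT.
  have /mapP[i _ xE] := sub x (mem_head _ _).
  exists (- z ^+ i * c); rewrite big_cons cE !hornerE xE; split.
  - by rewrite rpredM // rpredN rpredX.
  - by rewrite mulf_neq0 // oppr_eq0 expf_neq0.
  - by rewrite /= exprS; ring.
have akK : a ^+ k \in K.
  have : p.[0] \in K by rewrite rpred_horner ?minPolyOver ?mem0v.
  by rewrite pc => H; rewrite -(mulKf c0 (a ^+ k)) rpredM // rpredV.
have km : k = m.
  apply/eqP; rewrite eqn_leq; apply/andP; split.
    have : p %| 'X^m - (a ^+ m)%:P.
      by apply: minPoly_dvdp; rewrite ?pXK // rootE !hornerE subrr.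
    move/dvdp_leq; rewrite pk size_XnsubC //; apply.
    by rewrite -size_poly_eq0 size_XnsubC.
  by rewrite leqNgt; apply/negP => km; have := amin k; rewrite k0 km akK => /(_ isT).
apply/eqP; rewrite -eqp_monic ?monic_minPoly ?monicXnsubC //.
rewrite -dvdp_size_eqp ?pk ?size_XnsubC ?km //.
by apply: minPoly_dvdp; rewrite ?pXK // rootE !hornerE subrr.
Qed.

Lemma eq_aut_fixes s x (nu nu' : algCaut) : fixes s x ->
  {in s, nu =1 nu'} -> nu x = nu' x.
Proof.
move=> fx nus; have := fx (algC_invaut nu' \o nu) => /= H.
by rewrite -{2}H ?algC_invautK // => y ys; rewrite nus // algC_autK.
Qed.

(* Together with the commutativity of the Galois group of Q(zeta_L), the
   uniqueness of real roots of odd degree makes a real root in Q(zeta_L) rational. *)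
Lemma real_odd_root_inj p (x y : algC) : odd p -> x \is Num.real -> y \is Num.real ->
  x ^+ p = y ^+ p -> x = y.
Proof.
move=> po xR yR xy; have p0 : (0 < p)%N by case: p po {xy}.
have [y0|y0] := eqVneq y 0.
  by apply/eqP; move/eqP: xy; rewrite y0 expr0n gtn_eqF // expf_eq0 p0.
have yp0 : y ^+ p != 0 by rewrite expf_neq0.
have u1 : (x / y) ^+ p = 1 by rewrite expr_div_n xy divff.
have uR : x / y \is Num.real by rewrite realM // realV.
case/orP: uR => u0.
  by move/eqP: u1; rewrite pexpr_eq1 // => /eqP /(canRL (divfK y0)); rewrite mul1r.
have : 0 <= (- (x / y)) ^+ p by rewrite exprn_ge0 // oppr_ge0.
by rewrite exprNn -signr_odd po u1 mulr1 expr1 oppr_ge0 ler10.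
Qed.

Lemma fixes_root_unity n (x : algC) : (0 < n)%N -> x ^+ n = 1 -> fixes [:: zeta n] x.
Proof.
move=> n0 /(unity_zeta n0)[k ->] nu nuz.
by rewrite rmorphXn /= nuz ?mem_head.
Qed.

Lemma odd_power_cyclotomic p L (g : rat) (x : algC) : odd p -> (0 < L)%N ->
  (p %| L)%N -> fixes [:: zeta L] x -> x ^+ p = ratr g -> exists r : rat, g = r ^+ p.
Proof.
move=> po L0 pL fx xg; have p0 : (0 < p)%N := dvdn_gt0 L0 pL.
have [t tR tg] : exists2 t : algC, t \is Num.real & t ^+ p = ratr g.
  have [g0|g0] := leP 0 g.
    exists (p.-root (ratr g)); last exact: rootCK.
    by rewrite ger0_real // rootC_ge0 // ler0q.
  exists (- p.-root (- ratr g)).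
    by rewrite realN ger0_real // rootC_ge0 // oppr_ge0 lerq0 ltW.
  by rewrite exprNn rootCK // -signr_odd po expr1 mulN1r opprK.
have [g0|g0] := eqVneq g 0; first by exists 0; rewrite g0 expr0n gtn_eqF.
have gC0 : ratr g != 0 :> algC by rewrite fmorph_eq0.
have x0 : x != 0 by apply: contraNneq gC0 => x0; rewrite -xg x0 expr0n gtn_eqF.
have ft : fixes [:: zeta L] t.
  have fu : fixes [:: zeta L] (t / x).
    apply: fixes_root_unity => //; have [k ->] := dvdnP pL.
    by rewrite mulnC exprM expr_div_n tg xg divff // expr1n.
  move=> nu nuz; rewrite -[t](divfK x0) rmorphM /= fu // fx //.
have /CratP[r rE] : t \in Crat.
  apply: fixes_Crat => nu _; apply: (real_odd_root_inj po) => //; last first.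
    by rewrite -rmorphXn tg /= fmorph_rat.
  apply/CrealP; have := CrealP tR => {2}<-.
  apply: (@eq_aut_fixes _ _ (Num.conj \o nu) (nu \o Num.conj)) ft _.
  move=> y; rewrite inE => /eqP -> /=.
  have [a _ aE] := aut_zeta_exp nu L0; have [b _ bE] := aut_zeta_exp Num.conj L0.
  have cE : (zeta L ^+ a)^* = (zeta L)^* ^+ a by rewrite rmorphXn.
  have nE : nu (zeta L ^+ b) = nu (zeta L) ^+ b by rewrite rmorphXn.
  by rewrite /= in bE; rewrite aE bE cE nE aE bE exprAC.
exists r; apply: (fmorph_inj (ratr : rat -> algC)).
by rewrite rmorphXn /= -rE tg.
Qed.

Lemma power_dvd_largest (g : rat) h p : is_largest_power g h -> g != 0 -> prime p ->
  (exists r, g = r ^+ p) -> (p %| h)%N.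
Proof.
move=> [h0 [y gy] hmax] g0 p_pr [r gr]; apply: contraT => ph.
have /eqP co : coprime h p by rewrite coprime_sym prime_coprime.
have [u v uv _] := egcdnP p h0; rewrite co in uv.
have := hmax (h * p)%N; rewrite muln_gt0 h0 prime_gt0 // => /(_ isT).
suff Hex : exists x : rat, g = x ^+ (h * p).
  by move=> /(_ Hex); rewrite leqNgt -[X in (X < _)%N]muln1 ltn_pmul2l ?prime_gt1.
have y0 : y != 0 by apply: contraNneq g0 => y0; rewrite gy y0 expr0n gtn_eqF.
exists (r ^+ u / y ^+ v); rewrite expr_div_n -!exprM.
rewrite (_ : (u * (h * p) = p * (u * h))%N); last by ring.
rewrite (_ : (v * (h * p) = h * (v * p))%N); last by ring.
by rewrite !exprM -gr -gy -[(g ^+ u) ^+ h]exprM uv addn1 -[(g ^+ v) ^+ p]exprM exprS mulfK // expf_neq0.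
Qed.

Lemma odd_largest_power (g : rat) h : is_largest_power g h ->
  (~ exists x, g = x ^+ 2) -> odd h.
Proof.
move=> [h0 [y gy] _] nsq; rewrite -[odd h]negbK -dvdn2; apply/negP => /dvdnP[k hk].
by apply: nsq; exists (y ^+ k); rewrite gy hk exprM.
Qed.

(* The degree of [n.-root g] over Q(zeta_L) is [n / (gcdn n h * disc_eps)]. *)
Definition disc_eps (c : int) (n L : nat) : nat :=
  if (2 %| n)%N && (`|c| %| L)%N then 2 else 1.

Section KummerPowers.
Variables (g : rat) (h : nat) (D m : int) (q : rat) (S al : algC) (n L : nat).
Hypotheses (g0 : g != 0) (hP : is_largest_power g h) (nsq : ~ exists x, g = x ^+ 2).
Hypotheses (fD : fund_disc D m) (gE : g = (D * m)%:~R * q ^+ 2).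
Hypotheses (S2 : S ^+ 2 = (D * m)%:~R).
Hypotheses (sn : sqfree n) (nL : (n %| L)%N) (L0 : (0 < L)%N).
Hypothesis (aln : al ^+ n = ratr g).
Local Notation eps := (disc_eps (D * m) n L).

Let n0 : (0 < n)%N := sqfree_gt0 sn.
Let h_odd : odd h := odd_largest_power hP nsq.

Let gC0 : ratr g != 0 :> algC.
Proof. by rewrite fmorph_eq0. Qed.

Let al0 : al != 0.
Proof. by apply: contraNneq gC0 => a0; rewrite -aln a0 expr0n gtn_eqF. Qed.

Lemma gcd_eps_dvd : (gcdn n h * eps %| n)%N.
Proof.
rewrite /disc_eps; case: ifP => [/andP[n2 _]|_]; last by rewrite muln1 dvdn_gcdl.
rewrite Gauss_dvd ?dvdn_gcdl ?n2 //.
by rewrite coprimen2; apply: dvdn_odd h_odd; apply: dvdn_gcdr.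
Qed.

Let d0 : (0 < gcdn n h * eps)%N := dvdn_gt0 n0 gcd_eps_dvd.

Lemma Kummer_exp_gt0 : (0 < n %/ (gcdn n h * eps))%N.
Proof. by rewrite divn_gt0 // dvdn_leq // gcd_eps_dvd. Qed.

Lemma Kummer_power : exists j (r : rat),
  al ^+ (n %/ (gcdn n h * eps)) = zeta n ^+ j * ratr r * (if eps == 2 then S else 1).
Proof.
set M := (n %/ _)%N; have [hh0 [y gy] _] := hP.
set d := gcdn n h; have dn0 : (0 < d)%N by rewrite gcdn_gt0 n0.
pose r := y ^+ (h %/ d).
have rd : r ^+ d = g by rewrite -exprM divnK ?dvdn_gcdr.
have r0 : r != 0 by apply: contraNneq g0 => r0; rewrite -rd r0 expr0n gtn_eqF.
have rC0 : ratr r != 0 :> algC by rewrite fmorph_eq0.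
have nE : n = (M * (d * eps))%N by rewrite divnK ?gcd_eps_dvd.
have root w : w ^+ (d * eps) = ratr g -> exists j, al ^+ M = zeta n ^+ j * w.
  move=> wE; have w0 : w != 0.
    by apply: contraNneq gC0 => w0; rewrite -wE w0 expr0n gtn_eqF.
  have [|j jE] := @unity_zeta n (al ^+ M / w) n0.
    rewrite nE mulnC exprM expr_div_n wE -exprM -nE aln divff //.
    by rewrite expr1n.
  by exists j; rewrite -jE divfK.
rewrite /= in root *; move: root; rewrite /disc_eps; case: ifP => _ root /=.
  have dodd : odd d by apply: dvdn_odd h_odd; apply: dvdn_gcdr.
  have [|j jE] := root (ratr (q / r ^+ d./2) * S).
    rewrite (mulnC d 2) (exprM _ 2 d) (exprMn 2) S2 -rmorphXn /= -ratr_int -rmorphM /= -rmorphXn /=.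
    congr (ratr _); rewrite mulrC expr_div_n mulrA -gE -exprM muln2.
    rewrite (_ : g / _ = r) //; apply: (canLR (mulfK _)); first by rewrite expf_neq0.
    by rewrite -exprS -rd -[X in r ^+ X = _](odd_double_half d) dodd.
  by exists j, (q / r ^+ d./2); rewrite jE mulrA.
have [|j jE] := root (ratr r); first by rewrite muln1 -rmorphXn /= rd.
by exists j, r; rewrite jE mulr1.
Qed.

Lemma fixes_sqrt (x : algC) : x ^+ 2 = ratr g -> fixes [:: zeta L] x ->
  (absz (D * m)%R %| L)%N.
Proof.
move=> x2 fx; apply: contraT => /(flip_sqrt_disc fD L0 S2)[nu nuL nuS].
have q0 : ratr q != 0 :> algC.
  by rewrite fmorph_eq0; apply: contraNneq g0 => q0; rewrite gE q0 expr0n mulr0.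
have S0 : S != 0.
  by apply: contraNneq gC0 => S0; rewrite gE rmorphM /= ratr_int -S2 S0 expr0n mul0r.
have : x ^+ 2 == (ratr q * S) ^+ 2.
  by rewrite x2 exprMn S2 gE rmorphM rmorphXn /= ratr_int mulrC.
have nux : nu x = x by apply: fx => z; rewrite inE => /eqP ->.
have nuq : nu (ratr q * S) = - (ratr q * S) by rewrite rmorphM /= fmorph_rat nuS mulrN.
rewrite eqf_sqr => /orP[] /eqP xE; move: nux; rewrite xE ?rmorphN /= nuq ?opprK => /eqP.
  by rewrite eq_sym -subr_eq0 opprK -mulr2n mulrn_eq0 /= mulf_eq0 (negPf q0) (negPf S0).
by rewrite -subr_eq0 opprK -mulr2n mulrn_eq0 /= mulf_eq0 (negPf q0) (negPf S0).
Qed.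

Lemma Kummer_minimal k : (0 < k < n %/ (gcdn n h * eps))%N ->
  ~ fixes [:: zeta L] (al ^+ k).
Proof.
case/andP=> k0 kM fk; set d := gcdn n h in kM *.
have [u v uv _] := egcdnP n k0; set k' := gcdn k n in uv.
have k'0 : (0 < k')%N by rewrite gcdn_gt0 k0.
have k'k : (k' <= k)%N by rewrite dvdn_leq // dvdn_gcdl.
have fk' : fixes [:: zeta L] (al ^+ k').
  have -> : al ^+ k' = (al ^+ k) ^+ u / (ratr g) ^+ v.
    by rewrite -aln -!exprM mulnC uv [(n * v)%N]mulnC exprD mulrAC divff ?mul1r // expf_neq0.
  by move=> nu nuL; rewrite rmorphM fmorphV rmorphXn /= (fk nu nuL) rmorphXn /= fmorph_rat.
have [e nE] := dvdnP (dvdn_gcdr k n); rewrite -/k' in nE.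
have e0 : (0 < e)%N by move: n0; rewrite nE muln_gt0 => /andP[].
have en : (e %| n)%N by rewrite nE dvdn_mulr.
have xe : (al ^+ k') ^+ e = ratr g by rewrite -exprM mulnC -nE.
have : (e %| d * eps)%N.
  apply: (sqfree_dvdn (sqfree_dvd en sn)) => p p_pr pe.
  have pn := dvdn_trans pe en; have pL := dvdn_trans pn nL.
  have [e' eE] := dvdnP pe; rewrite eE exprM in xe.
  have fx' : fixes [:: zeta L] ((al ^+ k') ^+ e').
    by move=> nu nuL; rewrite rmorphXn /= (fk' nu nuL).
  have [p2|po] := even_prime p_pr; last first.
    apply/dvdn_mulr; rewrite /d dvdn_gcd pn (power_dvd_largest hP) //.
    exact: odd_power_cyclotomic fx' xe.
  rewrite p2 in pn xe *.
  by rewrite /disc_eps pn (fixes_sqrt xe fx') dvdn_mull.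
move=> /(dvdn_leq d0) ed; have := leq_trans (leq_ltn_trans k'k kM) (leqnn _).
rewrite ltnNge => /negP; apply.
rewrite leq_divLR ?gcd_eps_dvd // {1}nE mulnC leq_mul2l ed orbT //.
Qed.
End KummerPowers.

(** * The decomposition of the discriminant along f *)

Lemma signz_odd (k : int) : (-1) ^ k = (-1) ^+ odd `|k| :> int.
Proof.
case: k => k; first by rewrite -exprnP signr_odd.
by rewrite NegzE -exprnN -exprVn invrN1 abszN signr_odd.
Qed.

Lemma odd_sign_mod4 (b : int) : odd `|b| ->
  (4 %| (-1) ^ ((b - 1) %/ 2)%Z * b - 1)%Z.
Proof.
move=> bo; have [k bE] : exists k, b = 2 * k + 1.
  by exists ((b - 1) %/ 2)%Z; lia.
have -> : ((b - 1) %/ 2)%Z = k by rewrite bE addrK mulKz.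
rewrite signz_odd bE; apply/dvdzP; have := odd_double_half `|k|.
case: (odd `|k|) => kE.
  by exists (- ((k + 1) %/ 2)%Z); rewrite expr1; lia.
by exists (k %/ 2)%Z; rewrite expr0; lia.
Qed.

Section GammaB.
Variables (D m : int) (f : nat).
Hypothesis fD : fund_disc D m.
Local Notation Del := (D * m).
Local Notation b := (b_ f Del).
Local Notation G := (gcdn f `|Del|).

Lemma disc_bE : Del = b * G%:Z.
Proof. by rewrite /b_ /gcdz divzK // dvdzE /= dvdn_gcdr. Qed.

Lemma abs_disc_bE : `|Del|%N = (`|b| * G)%N.
Proof. by rewrite {1}disc_bE abszM. Qed.

(* The discriminant is [gamma * bstar], both factors being discriminants when
   [b] is odd. *)
Definition bstar : int := (-1) ^ ((b - 1) %/ 2)%Z * b.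

Lemma abs_bstar : `|bstar|%N = `|b|%N.
Proof. by rewrite /bstar signz_odd abszMsign. Qed.

Lemma bstar_gamma : Del = gamma_ f Del * bstar.
Proof.
rewrite /bstar /gamma_ !signz_odd mulrACA -expr2 sqrr_sign mul1r [RHS]mulrC.
exact: disc_bE.
Qed.

Hypothesis b_odd : odd `|b|.

Lemma b_dvd_m : (`|b| %| `|m|)%N.
Proof.
have [DD sm m4] := and3P fD.
have : (`|b| %| `|D| * `|m|)%N by rewrite -abszM abs_disc_bE dvdn_mulr.
by rewrite Gauss_dvdr // coprime_sym coprime_even_disc.
Qed.

Lemma gamma_fund_disc : exists2 m', fund_disc D m' & gamma_ f Del = D * m'.
Proof.
have [DD sm m4] := and3P fD; have b4 : (4 %| bstar - 1)%Z by apply: odd_sign_mod4.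
have /dvdzP[m' mE] : (bstar %| m)%Z by rewrite dvdzE abs_bstar b_dvd_m.
have bs0 : bstar != 0.
  by apply: contraTneq sm => bs0; rewrite mE bs0 mulr0.
exists m'.
  apply/and3P; split=> //.
    by apply: sqfree_dvd sm; rewrite mE abszM dvdn_mulr.
  by rewrite mE in m4; apply: mod4_divr b4 m4.
by apply: (mulIf bs0); rewrite -bstar_gamma mE mulrA.
Qed.

Lemma bstar_fund_disc : fund_disc 1 bstar.
Proof.
have [DD sm m4] := and3P fD; apply/and3P; split=> //; last exact: odd_sign_mod4.
by rewrite abs_bstar; apply: sqfree_dvd b_dvd_m sm.
Qed.

Lemma sqfree_b : sqfree `|b|.
Proof. by have [_ + _] := and3P bstar_fund_disc; rewrite abs_bstar. Qed.

Lemma abs_gamma : `|gamma_ f Del|%N = G.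
Proof. by rewrite /gamma_ signz_odd abszMsign. Qed.

Lemma gamma_dvd_f : (`|gamma_ f Del| %| f)%N.
Proof. by rewrite abs_gamma dvdn_gcdl. Qed.

Lemma coprime_b_gcd : coprime `|b| G.
Proof.
have [DD sm m4] := and3P fD.
have [m' fD' gE] := gamma_fund_disc; have := abs_gamma; rewrite gE abszM => <-.
rewrite coprimeMr [coprime _ `|D|]coprime_sym coprime_even_disc //=.
have bs0 := sqfree_gt0 sqfree_b.
have mE : `|m|%N = (`|b| * `|m'|)%N.
  have D0 : D != 0 by have := even_disc_gt0 DD; rewrite absz_gt0.
  have mE0 : m = m' * bstar by apply: (mulfI D0); rewrite mulrA -gE -bstar_gamma.
  by rewrite {1}mE0 abszM abs_bstar mulnC.
rewrite /coprime; apply: contraT => g1.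
have : (1 < gcdn `|b| `|m'|)%N by rewrite ltn_neqAle eq_sym g1 gcdn_gt0 bs0.
case/pdivP => p p_pr; rewrite dvdn_gcd => /andP[/dvdnP[k kE] pm'].
move: sm; rewrite mE kE (mulnC k) -mulnA sqfreeMp // => /andP[/negP[]].
by rewrite dvdn_mull.
Qed.

Lemma coprime_b_f : coprime `|b| f.
Proof.
have : gcdn `|b| f = gcdn (gcdn `|b| f) `|Del|.
  apply/eqP; rewrite eq_sym; apply/eqP/gcdn_idPl.
  by rewrite abs_disc_bE dvdn_mulr // dvdn_gcdl.
rewrite /coprime -gcdnA => ->; exact: coprime_b_gcd.
Qed.

Lemma disc_dvd_lcm n : (`|Del| %| lcmn f n)%N = (`|b| %| n)%N.
Proof.
rewrite abs_disc_bE Gauss_dvd ?coprime_b_gcd //.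
rewrite (dvdn_trans (dvdn_gcdl _ _) (dvdn_lcml f n)) andbT.
apply/idP/idP => [bL|/dvdn_trans->//]; last exact: dvdn_lcmr.
rewrite -(Gauss_dvdr n coprime_b_f) -muln_lcm_gcd.
exact: dvdn_mulr.
Qed.
End GammaB.

Lemma even_b_disc D m f n : fund_disc D m -> (0 < f)%N -> ~~ odd `|b_ f (D * m)| ->
  sqfree n -> (2 %| n)%N -> ~~ (absz (D * m)%R %| lcmn f n)%N.
Proof.
move=> fD f0 b2 sn n2; have Del0 := fund_disc_gt0 fD; have [DD sm m4] := and3P fD.
have [n0 /(_ 2%N) ln] := sqfreeP _ sn.
have ln1 : logn 2 n = 1%N.
  apply/eqP; rewrite eqn_leq ln /=.
  by rewrite logn_gt0 mem_primes n0.
have lm : logn 2 `|m| = 0%N.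
  by apply/eqP; rewrite -leqn0 leqNgt logn_gt0 mem_primes /= dvdn2 negb_and (odd_mod4 m4) orbT.
have lD : logn 2 (absz (D * m)%R) = logn 2 `|D|.
  by rewrite abszM lognM ?lm ?addn0 ?(sqfree_gt0 sm) ?(even_disc_gt0 DD).
apply/negP => /(dvdn_leq_log 2); rewrite lcmn_gt0 f0 n0 => /(_ isT).
rewrite logn_lcm // ln1 leq_max lD => H.
have b0 : (0 < `|b_ f (D * m)|)%N.
  by move: Del0; rewrite (abs_disc_bE D m f) muln_gt0 => /andP[].
have lb : (0 < logn 2 `|b_ f (D * m)|)%N by rewrite logn_gt0 mem_primes b0 /= dvdn2.
have := congr1 (logn 2) (abs_disc_bE D m f).
rewrite lognM ?gcdn_gt0 ?f0 // logn_gcd // lD.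
move: H lb; move: DD; rewrite !inE => /or4P[] /eqP ->; rewrite ?logn1 //=.
- lia.
- rewrite (_ : logn 2 4 = 2)%N //; lia.
- rewrite (_ : logn 2 8 = 3)%N //; lia.
- rewrite (_ : logn 2 8 = 3)%N //; lia.
Qed.

Lemma zeta_lcm f n : (0 < f)%N -> (0 < n)%N ->
  exists i j, zeta (lcmn f n) = zeta f ^+ i * zeta n ^+ j.
Proof.
move=> f0 n0; set L := lcmn f n; have L0 : (0 < L)%N by rewrite lcmn_gt0 f0.
have pL := zeta_prim L0; have [u v uv _] := egcdnP f n0.
set g := gcdn n f in uv; have g0 : (0 < g)%N by rewrite gcdn_gt0 n0.
have nA : n = (n %/ g * g)%N by rewrite divnK ?dvdn_gcdl.
have fB : f = (f %/ g * g)%N by rewrite divnK ?dvdn_gcdr.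
have LE : (L * g = f * n)%N by rewrite /L /g gcdnC muln_lcm_gcd.
have LA : L = (n %/ g * f)%N.
  by apply/eqP; rewrite -(eqn_pmul2r g0) LE mulnAC -nA mulnC.
have LB : L = (f %/ g * n)%N.
  by apply/eqP; rewrite -(eqn_pmul2r g0) LE mulnAC -fB.
have uv1 : (u * (n %/ g) = v * (f %/ g) + 1)%N.
  by apply/eqP; rewrite -(eqn_pmul2r g0) mulnDl mul1n -!mulnA -nA -fB uv.
have zx : (zeta L ^+ (u * (n %/ g))) ^+ f = 1.
  by rewrite -exprM -mulnA -LA mulnC exprM (prim_expr_order pL) expr1n.
have zy : (zeta L ^+ (v * (f %/ g)))^-1 ^+ n = 1.
  by rewrite exprVn -exprM -mulnA -LB mulnC exprM (prim_expr_order pL) expr1n invr1.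
have [i iE] := unity_zeta f0 zx; have [j jE] := unity_zeta n0 zy.
exists i, j; rewrite -iE -jE uv1 exprD expr1 mulrAC divff ?mul1r //.
by rewrite expf_neq0 // zeta_neq0.
Qed.

Lemma dim_adjoin_prim (K : fieldExtType rat) (e : {rmorphism K -> algC}) z n :
  n.-primitive_root (e z) -> \dim <<1; z>> = totient n.
Proof.
move=> pz; rewrite dim_Fadjoin dimv1 muln1.
have [q [qE qmon] qdvd] := minCpolyP (e z).
have inK (p : {poly rat}) : map_poly e (map_poly (in_alg K) p) = pQtoC p.
  rewrite -map_poly_comp; apply: eq_map_poly => c.
  by rewrite /= alg_num_field fmorph_rat.
have [p pE] : exists p, minPoly 1 z = map_poly (in_alg K) p.
  have aP i : (minPoly 1 z)`_i \in 1%VS by apply/polyOverP; apply: minPolyOver.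
  have a_ i := sig_eqW (vlineP _ _ (aP i)).
  exists (\poly_(i < size (minPoly 1 z)) sval (a_ i)).
  apply/polyP=> i; rewrite coef_map coef_poly /=.
  case: ltnP => [_|/(nth_default 0) ->]; last by rewrite /= scale0r.
  by case: (a_ i) => c /= ->.
have qp : (map_poly (in_alg K) q) %= minPoly 1 z.
  apply/andP; split.
    rewrite pE dvdp_map -qdvd -inK -pE fmorph_root; exact: root_minPoly.
  apply: minPoly_dvdp; first by apply/polyOverP => i; rewrite coef_map memvZ ?mem1v.
  rewrite -(fmorph_root e) inK -qE; exact: root_minCpoly.
apply/eqP; rewrite -eqSS -size_minPoly -(eqp_size qp) size_map_poly.
by rewrite -(size_map_poly (ratr : {rmorphism rat -> algC})) -qE (minCpoly_cyclotomic pz) size_cyclotomic.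
Qed.

Lemma fixes_dvd (nu : algCaut) d n : (0 < n)%N -> (d %| n)%N ->
  nu (zeta n) = zeta n -> nu (zeta d) = zeta d.
Proof. by move=> n0 dn; rewrite -{2}(expr1 (zeta n)) => /(aut_zeta_dvd n0 dn) ->. Qed.

Section KummerField.
Variables (g : rat) (h : nat) (D m : int) (q : rat) (S al : algC) (n L : nat).
Hypotheses (g0 : g != 0) (hP : is_largest_power g h) (nsq : ~ exists x, g = x ^+ 2).
Hypotheses (fD : fund_disc D m) (gE : g = (D * m)%:~R * q ^+ 2).
Hypotheses (S2 : S ^+ 2 = (D * m)%:~R).
Hypotheses (sn : sqfree n) (nL : (n %| L)%N) (L0 : (0 < L)%N).
Hypothesis (aln : al ^+ n = ratr g).
Hypothesis SL : (absz (D * m)%R %| L)%N -> fixes [:: zeta L] S.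
Local Notation M := (n %/ (gcdn n h * disc_eps (D * m)%R n L))%N.

Let n0 : (0 < n)%N := sqfree_gt0 sn.

Lemma fixes_Kummer_power : fixes [:: zeta L] (al ^+ M).
Proof.
move=> nu nuL; have [j [r ->]] := @Kummer_power g h D m q S al n L g0 hP nsq gE S2 sn aln.
have nz : nu (zeta n ^+ j) = zeta n ^+ j.
  by rewrite rmorphXn (fixes_dvd L0 nL) // nuL ?mem_head.
rewrite rmorphM /= rmorphM /= nz fmorph_rat; congr (_ * _).
rewrite /disc_eps; case: (2 %| n)%N; case: (boolP (_ %| L)%N) => [/SL fS|_] /=; rewrite ?rmorph1 //.
exact: fS.
Qed.

Lemma minPoly_Kummer_field (K : fieldExtType rat) (e : {rmorphism K -> algC})
    (z x : K) : e z = zeta L -> e x = al ->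
  minPoly <<1; z>> x = 'X^M - (x ^+ M)%:P.
Proof.
move=> ez ex; have [k kE] := zeta_dvd L0 nL.
have memF y : fixes [:: zeta L] (e y) -> y \in <<1; z>>%AS.
  by move=> fy; rewrite /= -adjoin_seq1; apply: (@fixes_mem_adjoin _ e); rewrite /= ez.
apply: (@minPoly_Kummer _ _ <<1; z>>%AS (z ^+ k) x n).
- by rewrite -(fmorph_primitive_root e) rmorphXn ez -kE zeta_prim.
- by rewrite rpredX //= memv_adjoin.
- have gC0 : ratr g != 0 :> algC by rewrite fmorph_eq0.
  by rewrite -(fmorph_eq0 e) ex; apply: contraNneq gC0 => a0; rewrite -aln a0 expr0n gtn_eqF.
- by apply: memF => nu _; rewrite rmorphXn /= ex aln fmorph_rat.
- exact: (Kummer_exp_gt0 D m L hP nsq sn).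
- by apply: memF; rewrite rmorphXn /= ex; apply: fixes_Kummer_power.
- move=> i iM; apply/negP => xi.
  apply: (@Kummer_minimal g h D m q S al n L g0 hP nsq fD gE S2 sn nL L0 aln i iM).
  rewrite -ex -rmorphXn /=; apply: Qin_fixes.
  have := (@mem_adjoinP _ e [:: z] (x ^+ i)).1; rewrite /= ez; apply.
  by rewrite adjoin_seq1.
Qed.

Lemma Kummer_conj y : y ^+ M = al ^+ M ->
  exists2 tau : algCaut, tau (zeta L) = zeta L & tau al = y.
Proof.
move=> yM; have [K [e [s1 s1E _]]] := num_field_exists [:: zeta L; al].
case: s1 s1E => [|z [|x []]] //= [ez ex].
have [|tau tauL taua] := @extend_conj [:: zeta L] al y; last first.
  by exists tau => //; apply: tauL; apply: mem_head.
move=> p pP rp; have [|P PF pE] := @Qin_poly_preim K e [:: z] p.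
  by rewrite /= ez.
have /dvdpP[P1 PE] : minPoly <<1; z>> x %| P.
  apply: minPoly_dvdp; first by apply: (polyOverSv _ PF); rewrite /= adjoin_seq1 subvv.
  by rewrite -(fmorph_root e) -pE ex.
rewrite pE PE rmorphM rootM; apply/orP; right.
rewrite (minPoly_Kummer_field ez ex) rmorphB /= map_polyXn map_polyC /= rmorphXn ex.
by rewrite rootE !hornerE yM subrr.
Qed.

Lemma dim_Kummer_field (K : fieldExtType rat) (e : {rmorphism K -> algC})
    (f : nat) (s1 : seq K) : (0 < f)%N -> L = lcmn f n ->
  map e s1 = [:: zeta f; zeta n; al] -> <<1 & s1>>%VS = fullv ->
  \dim {:K} = (totient L * M)%N.
Proof.
move=> f0 LE s1E gen.
have [zf [zn [x [s1E' ezf ezn ex]]]] : exists zf zn x,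
    [/\ s1 = [:: zf; zn; x], e zf = zeta f, e zn = zeta n & e x = al].
  case: s1 s1E {gen} => [|zf [|zn [|x []]]] //= [E1 E2 E3].
  by exists zf, zn, x.
have [i [j zE]] := zeta_lcm f0 n0; rewrite -LE in zE.
pose z := zf ^+ i * zn ^+ j.
have ez : e z = zeta L.
  by rewrite /z rmorphM /= rmorphXn /= ezf rmorphXn /= ezn zE.
have full : fullv = <<<<1; z>>; x>>%VS.
  apply/esym/vspaceP => y; rewrite memvf -adjoin_seq1 -adjoin_cons.
  apply: (@fixes_mem_adjoin _ e) => nu /= nus.
  have : y \in <<1 & s1>>%VS by rewrite gen memvf.
  move/mem_adjoinP/Qin_fixes; apply; rewrite s1E => w.
  have nuL : nu (zeta L) = zeta L by rewrite -ez nus ?mem_head.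
  rewrite !inE => /or3P[] /eqP ->.
  - by apply: fixes_dvd nuL; rewrite // LE dvdn_lcml.
  - by apply: fixes_dvd nuL.
  - by rewrite -ex nus // !inE eqxx orbT.
have dz : \dim <<1; z>> = totient L by apply: (@dim_adjoin_prim _ e); rewrite ez zeta_prim.
rewrite full dim_Fadjoin dz mulnC.
congr (_ * _)%N; apply/eqP; rewrite -eqSS -size_minPoly.
rewrite (minPoly_Kummer_field ez ex) size_XnsubC //.
exact: (Kummer_exp_gt0 D m L hP nsq sn).
Qed.
End KummerField.

Lemma Qin_nat s k : Qin s k%:R.
Proof. by rewrite -(ratr_nat algC); apply: Qin_rat. Qed.

Lemma Qin_exp s x k : Qin s x -> Qin s (x ^+ k).
Proof.
move=> Qx; elim: k => [|k IH]; first exact: Qin_nat s 1.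
by rewrite exprS; apply: Qin_mul.
Qed.

Lemma Zin_Qin z x : Zin z x -> Qin [:: z] x.
Proof.
case=> p ->; apply: Qin_horner; last by apply: Qin_mem; rewrite mem_head.
by move=> i; rewrite coef_map /= -ratr_int; apply: Qin_rat.
Qed.

Lemma fund_disc_sqrt D m L : fund_disc D m -> (0 < L)%N -> (absz (D * m)%R %| L)%N ->
  exists2 S, Zin (zeta L) S & S ^+ 2 = (D * m)%:~R.
Proof.
move=> fD L0 dL; have [S ZS S2] := sqrt_disc fD.
by exists S => //; apply: Zin_zeta_dvd ZS.
Qed.

Lemma eq_sqr_sign (x y : algC) : x ^+ 2 = y ^+ 2 -> exists e : bool, x = (-1) ^+ e * y.
Proof.
move=> /eqP; rewrite eqf_sqr => /orP[] /eqP ->; first by exists false; rewrite mul1r.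
by exists true; rewrite expr1 mulN1r.
Qed.

Section Intersection.
Variables (g : rat) (h : nat) (D m : int) (q : rat) (al : algC) (f n a : nat).
Hypotheses (g0 : g != 0) (hP : is_largest_power g h) (nsq : ~ exists x, g = x ^+ 2).
Hypotheses (fD : fund_disc D m) (gE : g = (D * m)%:~R * q ^+ 2).
Hypotheses (sn : sqfree n) (f0 : (0 < f)%N) (aln : al ^+ n = ratr g).
Hypotheses (a0 : (0 < a)%N) (af : coprime a f).
Local Notation b := (b_ f (D * m)).
Local Notation gam := (gamma_ f (D * m)).

Let n0 : (0 < n)%N := sqfree_gt0 sn.
Let L0 : (0 < lcmn f n)%N.
Proof. by rewrite lcmn_gt0 f0. Qed.

Lemma disc_eps_lcm : disc_eps (D * m) n (lcmn f n) =
  if [&& odd `|b|, 2 %| n & `|b| %| n]%N then 2%N else 1%N.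
Proof.
rewrite /disc_eps; have [bo|b2] := boolP (odd `|b|).
  by rewrite (disc_dvd_lcm fD bo).
by case: ifP => // /andP[n2]; rewrite (negPf (even_b_disc fD f0 b2 sn n2)).
Qed.

Lemma sqrt_gamma : odd `|b| -> exists2 Sg, Zin (zeta f) Sg & Sg ^+ 2 = gam%:~R /\
  forall nu : algCaut, nu (zeta f) = zeta f ^+ a -> nu Sg = (kronecker gam a)%:~R * Sg.
Proof.
move=> bo; have [m' fD' gamE] := gamma_fund_disc fD bo.
have := gamma_dvd_f D m f; rewrite gamE => gf.
have [Sg ZS S2] := fund_disc_sqrt fD' f0 gf.
exists Sg => //; split=> // nu; exact: kronecker_sqrt.
Qed.

Lemma sqrt_bstar : odd `|b| -> (`|b| %| n)%N ->
  exists2 Sb, Zin (zeta n) Sb & Sb ^+ 2 = (bstar D m f)%:~R.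
Proof.
move=> bo bn; have [|Sb ZS S2] := fund_disc_sqrt (bstar_fund_disc fD bo) n0.
  by rewrite mul1r abs_bstar.
by exists Sb; rewrite // S2 mul1r.
Qed.

Lemma fixing_aut : a = 1 %[mod gcdn f n] ->
  (odd `|b| -> (2 %| n)%N -> (`|b| %| n)%N -> kronecker gam a = 1) ->
  exists nu : algCaut, [/\ nu (zeta f) = zeta f ^+ a, nu (zeta n) = zeta n & nu al = al].
Proof.
move=> a1 kron1; set L := lcmn f n.
have [S ZS S2] := sqrt_disc fD.
have SL : (absz (D * m)%R %| L)%N -> fixes [:: zeta L] S.
  by move=> DL; apply/Qin_fixes/Zin_Qin; apply: Zin_zeta_dvd ZS.
have nL : (n %| L)%N := dvdn_lcmr f n.
have [nu0 [nu0f nu0n]] := aut_chinese f0 n0 af (coprime1n n) a1.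
rewrite expr1 in nu0n.
set M := (n %/ (gcdn n h * disc_eps (D * m)%R n L))%N.
have alM : nu0 (al ^+ M) = al ^+ M.
  have [j [r ->]] := @Kummer_power g h D m q S al n L g0 hP nsq gE S2 sn aln.
  have nz : nu0 (zeta n ^+ j) = zeta n ^+ j by rewrite rmorphXn nu0n.
  rewrite rmorphM /= rmorphM /= nz fmorph_rat; congr (_ * _).
  rewrite disc_eps_lcm; case: (boolP [&& odd `|b|, 2 %| n & `|b| %| n]%N); last by rewrite rmorph1.
  move=> /and3P[bo n2 bn] /=.
  have [Sg ZSg [Sg2 /(_ nu0 nu0f) nuSg]] := sqrt_gamma bo.
  have [Sb ZSb Sb2] := sqrt_bstar bo bn.
  have nuSb : nu0 Sb = Sb by apply: Zin_aut ZSb.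
  have [|e ->] := @eq_sqr_sign S (Sg * Sb).
    by rewrite exprMn Sg2 Sb2 S2 -intrM -bstar_gamma.
  by rewrite rmorphM rmorph_sign rmorphM /= nuSb nuSg kron1 // rmorph1 mul1r.
have al0 : al != 0.
  have gC0 : ratr g != 0 :> algC by rewrite fmorph_eq0.
  by apply: contraNneq gC0 => al0; rewrite -aln al0 expr0n gtn_eqF.
have [|i iE] := @unity_zeta n (nu0 al / al) n0.
  by rewrite expr_div_n -rmorphXn aln /= fmorph_rat divff // fmorph_eq0.
have nual : nu0 al = zeta n ^+ i * al by rewrite -iE divfK.
have zi0 : zeta n ^+ i != 0 by rewrite expf_neq0 // zeta_neq0.
have ziM : (zeta n ^+ i) ^+ M = 1.
  have : nu0 al ^+ M = al ^+ M by rewrite -rmorphXn.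
  rewrite nual exprMn => /(canRL (mulfK (expf_neq0 M al0))) ->.
  by rewrite divff // expf_neq0.
have [|tau tauL taual] :=
    @Kummer_conj g h D m q S al n L g0 hP nsq fD gE S2 sn nL L0 aln SL ((zeta n ^+ i)^-1 * al).
  by rewrite exprMn exprVn ziM invr1 mul1r.
exists (nu0 \o tau); split=> /=.
- by rewrite (fixes_dvd L0 (dvdn_lcml f n) tauL).
- by rewrite (fixes_dvd L0 nL tauL).
- have nz : nu0 (zeta n ^+ i) = zeta n ^+ i by rewrite rmorphXn nu0n.
  by rewrite taual rmorphM fmorphV /= nz nual mulKf.
Qed.

Lemma gamma_in_intersection : odd `|b| -> (2 %| n)%N -> (`|b| %| n)%N ->
  exists Sg, [/\ Sg != 0, Qin [:: zeta f] Sg, Qin [:: zeta n; al] Sg &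
    forall nu : algCaut, nu (zeta f) = zeta f ^+ a -> nu Sg = (kronecker gam a)%:~R * Sg].
Proof.
move=> bo n2 bn; have [Sg ZSg [Sg2 nuSg]] := sqrt_gamma bo.
have [Sb ZSb Sb2] := sqrt_bstar bo bn.
have gC0 : ratr g != 0 :> algC by rewrite fmorph_eq0.
have DE : (ratr g : algC) = (ratr q * (Sg * Sb)) ^+ 2.
  rewrite exprMn [(Sg * Sb) ^+ 2]exprMn Sg2 Sb2 -intrM -bstar_gamma gE.
  by rewrite rmorphM rmorphXn /= ratr_int [LHS]mulrC.
have [q0 Sg0 Sb0] : [/\ ratr q != 0 :> algC, Sg != 0 & Sb != 0].
  by move: gC0; rewrite DE expf_eq0 /= !mulf_eq0 !negb_or => /and3P[].
exists Sg; split=> //; first exact: Zin_Qin.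
have [|e eE] := @eq_sqr_sign (al ^+ n./2) (ratr q * (Sg * Sb)).
  rewrite -DE -exprM muln2 -aln; congr (_ ^+ _).
  by rewrite -[RHS]odd_double_half -[odd n]negbK -dvdn2 n2.
have -> : Sg = (-1) ^+ e * (al ^+ n./2 * (Sb * ratr (q * (bstar D m f)%:~R)^-1)).
  rewrite eE fmorphV rmorphM /= ratr_int -Sb2.
  have s2 : (-1) ^+ e * (-1) ^+ e = 1 :> algC by rewrite -expr2 sqrr_sign.
  rewrite -[LHS]mul1r -[X in X * Sg = _]s2; move: ((-1) ^+ e) => s.
  by field; rewrite q0 Sb0.
have Qm : forall s, Qin s ((-1) ^+ e).
  by move=> s; rewrite -(rmorph_sign (ratr : {rmorphism rat -> algC})); apply: Qin_rat.
apply: Qin_mul => //; apply: Qin_mul.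
  by apply/Qin_exp/Qin_mem; rewrite !inE eqxx orbT.
apply: Qin_mul; last exact: Qin_rat.
by apply: Qin_sub (Zin_Qin ZSb) => z; rewrite !inE => /eqP ->; rewrite eqxx.
Qed.
End Intersection.

(** * The discriminant of a quadratic field *)

Lemma field_trace_linear (K : fieldExtType rat) (c : rat) (x y : K) :
  field_trace (c *: x + y) = c * field_trace x + field_trace y.
Proof.
rewrite /field_trace.
have -> : amull (c *: x + y) = c *: amull x + amull y by exact: amull_is_linear.
by rewrite passmx.mxof_linear mxtraceD mxtraceZ.
Qed.

Lemma field_traceD (K : fieldExtType rat) (x y : K) :
  field_trace (x + y) = field_trace x + field_trace y.
Proof. by rewrite -{1}[x]scale1r field_trace_linear mul1r. Qed.

Lemma field_traceZ (K : fieldExtType rat) (c : rat) (x : K) :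
  field_trace (c *: x) = c * field_trace x.
Proof.
have T0 : field_trace (0 : K) = 0.
  by have := field_traceD (0 : K) 0; rewrite addr0 => /eqP; rewrite -subr_eq0 opprD addNKr oppr_eq0 => /eqP.
by rewrite -[c *: x]addr0 field_trace_linear T0 addr0.
Qed.

Lemma field_trace1 (K : fieldExtType rat) : field_trace (1 : K) = (\dim {:K})%:R.
Proof.
by rewrite /field_trace amull1 passmx.mxof1 ?mxtrace1 // (basis_free (vbasisP _)).
Qed.

Lemma field_trace_aut (K : fieldExtType rat) (phi : {lrmorphism K -> K}) (x : K) :
  field_trace (phi x) = field_trace x.
Proof.
rewrite /field_trace; pose p := linfun phi.
have bK := vbasisP {:K}.
have comm : (amull (phi x) \o p = p \o amull x)%VF.
  apply/lfunP => y; rewrite !comp_lfunE !lfunE /=.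
  by rewrite (rmorphM phi).
have := congr1 (passmx.mxof (vbasis {:K}) (vbasis {:K})) comm.
rewrite !(passmx.mxof_comp _ _ bK) //.
set P := passmx.mxof _ _ p => PM.
have Pu : P \in unitmx.
  have ker0 : lker p == 0%VS.
    by apply/lker0P => y z; rewrite !lfunE; apply: fmorph_inj.
  have : passmx.mxof (vbasis {:K}) (vbasis {:K}) (p^-1 \o p)%VF = 1%:M.
    by rewrite lker0_compVf // passmx.mxof1 // (basis_free bK).
  by rewrite (passmx.mxof_comp _ _ bK) // => /mulmx1_unit[].
rewrite -[X in \tr X](mulKmx Pu) PM mxtrace_mulC -mulmxA mulmxV ?mulmx1 //.
Qed.

Definition disc2 (K : fieldExtType rat) (x y : K) : rat :=
  field_trace (x * x) * field_trace (y * y) - field_trace (x * y) ^+ 2.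

Lemma disc2_change (K : fieldExtType rat) (u v : K) (a b c d : rat) :
  disc2 (a *: u + b *: v) (c *: u + d *: v) = (a * d - b * c) ^+ 2 * disc2 u v.
Proof.
have exp (a1 b1 c1 d1 : rat) : (a1 *: u + b1 *: v) * (c1 *: u + d1 *: v) =
    (a1 * c1) *: (u * u) + ((a1 * d1 + b1 * c1) *: (u * v) + (b1 * d1) *: (v * v)).
  rewrite !mulrDl !mulrDr -!scalerAl -!scalerAr !scalerA scalerDl (mulrC v u).
  by rewrite !addrA.
by rewrite /disc2 !exp !field_traceD !field_traceZ; ring.
Qed.

Lemma sqr_sqfree_int (x : rat) (d : int) : sqfree `|d|%N ->
  d%:~R * x ^+ 2 \is a Num.int -> x \is a Num.int.
Proof.
move=> sd /intrP[k kE].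
have den0 : (denq x)%:~R != 0 :> rat by rewrite intr_eq0 denq_neq0.
have nE : d * numq x ^+ 2 = k * denq x ^+ 2.
  apply/eqP; rewrite -(eqr_int rat) (intrM _ d) (intrM _ k) !rmorphXn /= -kE.
  by rewrite numqE exprMn mulrA.
have co := coprime_num_den x.
have den1 : `|denq x|%N = 1%N.
  apply/eqP; rewrite eqn_leq absz_gt0 denq_neq0 andbT leqNgt; apply/negP => /pdivP[p p_pr pd].
  have pn : ~~ (p %| `|numq x|)%N.
    apply/negP => pn; have : (p %| gcdn `|numq x| `|denq x|)%N by rewrite dvdn_gcd pn.
    by move/eqP: co => ->; rewrite dvdn1 => /eqP p1; rewrite p1 in p_pr.
  have : (p ^ 2 %| `|d|)%N.
    rewrite -(@Gauss_dvdl _ _ (`|numq x| ^ 2)); last first.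
      by rewrite coprimeXl // coprimeXr // prime_coprime.
    have -> : (`|d| * `|numq x| ^ 2)%N = (`|k| * `|denq x| ^ 2)%N.
      by rewrite -!abszX -!abszM nE.
    by rewrite dvdn_mull // dvdn_exp2r.
  case/dvdnP => l lE; move: sd; rewrite lE mulnC -mulnA sqfreeMp // => /andP[].
  by rewrite dvdn_mulr.
rewrite Qint_def; move: den1 (denq_gt0 x); case: (denq x) => [[|[|]]|] //.
Qed.

Lemma int_sqr_mod4 (x : int) : exists i (e : bool) j, x * x = 4 * i + e%:Z /\ x = 2 * j + e%:Z.
Proof.
have [e [j xE]] : exists (e : bool) (j : int), x = 2 * j + e%:Z.
  by exists (odd `|x|%N), ((x - (odd `|x|%N)%:Z) %/ 2)%Z; case: (boolP (odd _)); lia.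
exists (j * j + e%:Z * j), e, j; split=> //; rewrite xE; case: (e) => /=; ring.
Qed.

Lemma fund_disc_mod4 D m : fund_disc D m -> exists t (e : bool), D * m = 4 * t + e%:Z.
Proof.
case/and3P => + _ /dvdzP[k kE]; have -> : m = k * 4 + 1 by rewrite -kE subrK.
rewrite !inE => /or4P[] /eqP ->.
- by exists k, true => /=; ring.
- by exists (- (k * 4 + 1)), false => /=; ring.
- by exists (2 * (k * 4 + 1)), false => /=; ring.
- by exists (- 2 * (k * 4 + 1)), false => /=; ring.
Qed.

Lemma half_int_even (c d a : int) (n : int) : c * c * d = a * a - 4 * n ->
  (4 %| d - 2)%Z || (4 %| d - 3)%Z -> exists c', c = 2 * c'.
Proof.
move=> E dm; have [i [e [j [cc cE]]]] := int_sqr_mod4 c.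
have [i' [e' [j' [aa aE]]]] := int_sqr_mod4 a.
case: e cc cE => cc cE; last by exists j; rewrite cE addr0.
have [k dE] : exists k, d = 4 * k + 2 \/ d = 4 * k + 3.
  by case/orP: dm => /dvdzP[k kE]; exists k; [left|right]; lia.
exfalso; move: E; rewrite cc aa; case: dE => ->; clear; case: e'; nia.
Qed.

Lemma coord_parity (i i' j j' t n : int) (e e1 e' : bool) :
  (4 * i + e1%:Z) * (4 * t + e%:Z) = 4 * i' + e'%:Z - 4 * n ->
  exists c, 2 * j' + e'%:Z = 2 * c + (2 * j + e1%:Z) * (4 * t + e%:Z).
Proof.
move=> E; have {E}e'E : e'%:Z = e1%:Z * e%:Z.
  have : e'%:Z = e1%:Z * e%:Z + 4 * (i * (4 * t + e%:Z) + e1%:Z * t - i' + n).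
    have -> : e'%:Z = (4 * i' + e'%:Z - 4 * n) - 4 * i' + 4 * n by ring.
    by rewrite -E; ring.
  clear E; move: (_ + n) => s; case: e; case: e1; case: e' => /=; lia.
exists (j' - j * (4 * t + e%:Z) - 2 * t * e1%:Z).
by rewrite e'E; ring.
Qed.

Lemma fund_disc_ring D m (y : rat) (a n : int) : fund_disc D m ->
  y ^+ 2 * (D * m)%:~R = (a * a - 4 * n)%:~R ->
  exists b c : int, y = b%:~R /\ a = 2 * c + b * (D * m).
Proof.
move=> fD yE; have [DD sm m4] := and3P fD; have mo := odd_mod4 m4.
have [k mE] : exists k, m = 4 * k + 1.
  by case/dvdzP: m4 => k kE; exists k; lia.
have halfD (d : int) : sqfree `|d|%N -> D * m = 4 * d -> (4 %| d - 2)%Z || (4 %| d - 3)%Z ->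
    y \is a Num.int.
  move=> sd dE d4; have /intrP[c cE] : 2 * y \is a Num.int.
    apply: (sqr_sqfree_int sd); apply/intrP; exists (a * a - 4 * n).
    by rewrite -yE dE intrM; ring.
  have [|c' c'E] := @half_int_even c d a n _ d4.
    apply/eqP; rewrite -(eqr_int rat) -yE dE; apply/eqP.
    by rewrite !intrM -cE; ring.
  apply/intrP; exists c'; apply: (@mulfI _ (2 : rat)) => //.
  by rewrite cE c'E intrM.
have s2 : sqfree (2 * `|m|%N) by rewrite sqfreeMp // dvdn2 mo.
have /intrP[b bE] : y \is a Num.int.
  move: DD; rewrite !inE => /or4P[] /eqP DE.
  - apply: (sqr_sqfree_int sm); apply/intrP; exists (a * a - 4 * n).
    by rewrite -yE DE mul1r mulrC.
  - apply: (halfD (- m)); rewrite ?abszN // ?DE ?mE; first by ring.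
    by apply/orP; right; apply/dvdzP; exists (- k - 1); ring.
  - apply: (halfD (2 * m)); rewrite ?abszM // ?DE ?mE; first by ring.
    by apply/orP; left; apply/dvdzP; exists (2 * k); ring.
  - apply: (halfD (- 2 * m)); rewrite ?abszM // ?DE ?mE; first by ring.
    by apply/orP; left; apply/dvdzP; exists (- 2 * k - 1); ring.
have E : b * b * (D * m) = a * a - 4 * n.
  apply/eqP; rewrite -(eqr_int rat) -yE bE; apply/eqP; rewrite !intrM; ring.
have [t [e DE]] := fund_disc_mod4 fD.
have [i [e1 [j [bb bE']]]] := int_sqr_mod4 b.
have [i' [e' [j' [aa aE]]]] := int_sqr_mod4 a.
have [c cE] : exists c, a = 2 * c + b * (D * m).
  rewrite aE bE' DE; apply: (@coord_parity i i' j j' t n).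
  by rewrite -bb -aa -DE.
by exists b, c.
Qed.

Lemma det_trace2 (K : fieldExtType rat) n (w : n.-tuple K) : n = 2%N ->
  \det (\matrix_(i < n, j < n) field_trace (w`_i * w`_j)) = disc2 w`_0 w`_1.
Proof.
move=> n2; subst n; rewrite (expand_det_row _ 0) !big_ord_recl big_ord0 addr0.
rewrite /cofactor !det_mx11 !mxE /disc2 /= expr0 expr1 (mulrC w`_1 w`_0).
by ring.
Qed.

Lemma IntSpan2 (K : fieldExtType rat) n (w : n.-tuple K) x : n = 2%N ->
  inIntSpan w x -> exists a b : int, x = a%:~R *: w`_0 + b%:~R *: w`_1.
Proof.
move=> n2; subst n; case=> a ->; exists (a ord0), (a (lift ord0 ord0)).
by rewrite !big_ord_recl big_ord0 addr0 !scaler_int.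
Qed.

Lemma mem_IntSpan (K : fieldExtType rat) n (w : n.-tuple K) (i : 'I_n) : inIntSpan w w`_i.
Proof.
exists [ffun j => (j == i)%:R]; rewrite (bigD1 i) //= ffunE eqxx big1 ?addr0 //.
by move=> j ji; rewrite ffunE (negPf ji).
Qed.

Lemma mutual_sqr_mul_eq (x y p r : int) : x = p ^+ 2 * y -> y = r ^+ 2 * x -> x = y.
Proof.
move=> xy yx; have [y0|y0] := eqVneq y 0; first by rewrite xy y0 mulr0.
have rp : (r * p) ^+ 2 = 1.
  by apply: (mulIf y0); rewrite mul1r {2}yx xy exprMn mulrA.
have : (`|p| %| 1)%N.
  have -> : 1%N = `|(r * p) ^+ 2|%N by rewrite rp.
  by rewrite abszX abszM dvdn_exp // dvdn_mull.
rewrite dvdn1 => /eqP p1; rewrite xy.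
by have [->|->] : p = 1 \/ p = -1 by [clear -p1; lia]; rewrite ?sqrrN expr1n mul1r.
Qed.

Lemma quadratic_mul (K : fieldExtType rat) (d : K) (c r s r' s' : rat) : d * d = c *: 1 ->
  (r *: 1 + s *: d) * (r' *: 1 + s' *: d) =
  (r * r' + s * s' * c) *: 1 + (r * s' + s * r') *: d.
Proof.
move=> dd; rewrite mulrDl !mulrDr -!scalerAl -!scalerAr !mul1r !mulr1 !scalerA dd scalerA.
rewrite !scalerDl -!addrA; congr (_ + _).
by rewrite addrA addrC.
Qed.

Section QuadraticDiscriminant.
Variables (g : rat) (D m : int) (q : rat).
Hypotheses (nsq : ~ exists x, g = x ^+ 2).
Hypotheses (fD : fund_disc D m) (gE : g = (D * m)%:~R * q ^+ 2).
Variables (K : fieldExtType rat) (e : {rmorphism K -> algC}) (t : K).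
Hypotheses (et : e t = sqrtC (ratr g)) (gen : <<1; t>>%VS = fullv).

Let q0 : q != 0.
Proof.
by apply/eqP => q0; apply: nsq; exists 0; rewrite gE q0 expr0n mulr0.
Qed.

Let d : K := q^-1 *: t.

Lemma sqr_d : (e d) ^+ 2 = (D * m)%:~R.
Proof.
rewrite rmorphZ_num exprMn et sqrtCK fmorphV exprVn gE rmorphM rmorphXn /= ratr_int.
by rewrite mulrC mulfK // expf_neq0 // fmorph_eq0.
Qed.

Lemma dim_quadratic : \dim {:K} = 2%N.
Proof.
have t2 : t ^+ 2 = g%:A.
  by apply: (fmorph_inj e); rewrite rmorphXn /= et sqrtCK alg_num_field fmorph_rat.
have -> : \dim {:K} = adjoin_degree 1 t by rewrite -gen dim_Fadjoin dimv1 muln1.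
apply/eqP; rewrite -eqSS -size_minPoly (@minPoly_Kummer _ _ 1%AS (-1) t 2 2) ?size_XnsubC //.
- by rewrite -(fmorph_primitive_root e) rmorphN1; have := @rootN1_prim 1 isT; rewrite root1C.
- by rewrite rpredN mem1v.
- apply/eqP => t0; apply: nsq; exists 0; rewrite expr0n.
  by apply: (fmorph_inj (in_alg K)); rewrite /= -t2 t0 expr0n scale0r.
- by rewrite t2 rpredZ ?mem1v.
- by rewrite t2 rpredZ ?mem1v.
- move=> [|[|]] // _; apply/negP => /vlineP[c tc]; apply: nsq; exists c.
  apply: (fmorph_inj (in_alg K)); rewrite expr1 in tc.
  by rewrite /= -t2 tc !expr2 -scalerAl mul1r scalerA.
Qed.

Lemma quadratic_coord x : exists r s : rat, x = r *: 1 + s *: d.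
Proof.
have : x \in <<1 & [:: t]>>%VS by rewrite adjoin_seq1 gen memvf.
rewrite (mem_adjoinP e).
have tE : t = q *: d by rewrite scalerA divff // scale1r.
suff H X : Qin (map e [:: t]) X -> exists r s : rat, X = e (r *: 1 + s *: d).
  by move=> /H[r [s /fmorph_inj ->]]; exists r, s.
elim=> [c|{}X|{}X Y _ [r [s ->]] _ [r' [s' ->]]|{}X Y _ [r [s ->]] _ [r' [s' ->]]].
- by exists c, 0; rewrite scale0r addr0 alg_num_field fmorph_rat.
- by rewrite inE => /eqP ->; exists 0, q; rewrite scale0r add0r -tE.
- exists (r + r'), (s + s'); rewrite -rmorphD; congr (e _).
  by rewrite !scalerDl addrACA.
have dd : d * d = (D * m)%:~R *: 1.
  by apply: (fmorph_inj e); rewrite rmorphM /= -expr2 sqr_d rmorphZ_num ratr_int rmorph1 mulr1.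
exists (r * r' + s * s' * (D * m)%:~R), (r * s' + s * r'); rewrite -rmorphM; congr (e _).
exact: quadratic_mul.
Qed.

Lemma conj_d : exists nu : algCaut, nu (e d) = - e d.
Proof.
have [|nu _ nud] := flip_sqrt_disc fD (isT : 0 < 1)%N sqr_d _; last by exists nu.
apply/negP; rewrite dvdn1 => /eqP Dm1; apply: nsq; exists q.
have [DD sm /dvdzP[k kE]] := and3P fD.
suff Dm : D * m = 1 by rewrite gE Dm mul1r.
have D1 : D = 1.
  by move: DD Dm1; rewrite !inE abszM => /or4P[] /eqP -> // /eqP; rewrite muln_eq1.
by rewrite D1 mul1r in Dm1 *; lia.
Qed.
Let Dm := D * m.
(* [1, w] is an integral basis. *)
Let w : K := (Dm%:~R / 2) *: 1 + 2^-1 *: d.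

Lemma e_quad r s : e (r *: 1 + s *: d) = ratr r + ratr s * e d.
Proof. by rewrite rmorphD /= !rmorphZ_num rmorph1 mulr1. Qed.

Lemma trace_d : field_trace d = 0.
Proof.
have [nu nud] := conj_d.
have [x|phi phiE] := @restrict_aut_to_num_field _ e nu.
  have [r [s ->]] := quadratic_coord x; exists (r *: 1 + (- s) *: d).
  rewrite !e_quad rmorphD /= fmorph_rat rmorphM /= fmorph_rat nud rmorphN /=.
  by rewrite mulNr mulrN.
have phid : phi d = (-1) *: d.
  by rewrite scaleN1r; apply: (fmorph_inj e); rewrite phiE nud rmorphN.
have := field_trace_aut phi d; rewrite phid field_traceZ.
by move=> /eqP; rewrite mulN1r eq_sym -subr_eq0 opprK -mulr2n mulrn_eq0 => /eqP.
Qed.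

Lemma disc2_1w : disc2 1 w = Dm%:~R.
Proof.
have dd : d * d = Dm%:~R *: 1.
  by apply: (fmorph_inj e); rewrite rmorphM /= -expr2 sqr_d rmorphZ_num ratr_int rmorph1 mulr1.
have -> : disc2 1 w = disc2 (1 *: 1 + 0 *: d) w by rewrite scale1r scale0r addr0.
rewrite disc2_change /disc2 !mul1r dd field_traceZ field_trace1 dim_quadratic trace_d.
by field.
Qed.

Lemma integral_w : integralOver (intr : int -> K) w.
Proof.
have [k [c DmE]] := fund_disc_mod4 fD.
pose k' := 4 * k * k + 2 * k * c%:Z - k.
have k'E : 4 * k'%:~R = Dm%:~R ^+ 2 - Dm%:~R :> rat.
  rewrite /Dm DmE /k' !(rmorphD, rmorphB, rmorphM) /=; case: (c) => /=.
    by ring.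
  by ring.
exists ('X^2 - (Dm%:P * 'X - k'%:P)).
  rewrite monicE lead_coefDl ?lead_coefXn //.
  rewrite size_polyXn size_polyN (leq_ltn_trans (size_polyD _ _)) // size_polyN gtn_max.
  rewrite (leq_ltn_trans (size_polyC_leq1 _)) // andbT.
  rewrite (leq_ltn_trans (size_polyMleq _ _)) // size_polyX addn2 /= ltnS.
  by rewrite !ltnS size_polyC_leq1.
have -> : map_poly (intr : int -> K) ('X^2 - (Dm%:P * 'X - k'%:P)) =
    'X^2 - ((Dm%:~R)%:P * 'X - (k'%:~R)%:P).
  by rewrite rmorphB rmorphB /= map_polyXn rmorphM /= map_polyX !map_polyC.
rewrite rootE !hornerE.
have dd : d * d = Dm%:~R *: 1.
  by apply: (fmorph_inj e); rewrite rmorphM /= -expr2 sqr_d rmorphZ_num ratr_int rmorph1 mulr1.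
have -> : w ^+ 2 = ((Dm%:~R / 2) ^+ 2 + 2^-1 ^+ 2 * Dm%:~R) *: 1 + (Dm%:~R / 2) *: d.
  rewrite expr2 (quadratic_mul _ _ _ _ dd); congr (_ *: _ + _ *: _); by field.
have -> : (k'%:~R : K) = ((Dm%:~R ^+ 2 - Dm%:~R) / 4) *: 1.
  by rewrite -k'E mulrC mulKf // scaler_int.
have -> : (Dm%:~R : K) * w = (Dm%:~R * (Dm%:~R / 2)) *: 1 + (Dm%:~R / 2) *: d.
  have -> : (Dm%:~R : K) * w = (Dm%:~R : rat) *: w.
    by rewrite -mulr_algl -in_algE rmorph_int.
  by transitivity ((Dm%:~R : rat) *: ((Dm%:~R / 2) *: 1 + 2^-1 *: d) : K); rewrite // scalerDr !scalerA.
rewrite opprB addrCA opprD addrACA subrr addr0 -scalerBl -scalerDl.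
by rewrite [X in X *: 1](_ : _ = 0) ?scale0r //; field.
Qed.

Lemma integral_coord x : integralOver (intr : int -> K) x ->
  exists b c : int, x = c%:~R *: 1 + b%:~R *: w.
Proof.
case=> p pmon px; have [r [s xE]] := quadratic_coord x.
have xA : e x \in Aint.
  apply: (@root_monic_Aint (map_poly intr p)).
  - rewrite -(eq_map_poly (_ : e \o intr =1 intr)) ?map_poly_comp ?fmorph_root // => i.
    by rewrite /= rmorph_int.
  - exact: monic_map.
  - by apply/polyOverP => i; rewrite coef_map /= rpred_int.
have [nu nud] := conj_d.
have exE : e x = ratr r + ratr s * e d by rewrite xE e_quad.
have nuxE : nu (e x) = ratr r - ratr s * e d.
  by rewrite exE rmorphD /= fmorph_rat rmorphM /= fmorph_rat nud mulrN.
have nuA : nu (e x) \in Aint by rewrite Aint_aut.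
have /intrP[a aE] : 2 * r \is a Num.int.
  rewrite -Cint_rat; apply: Cint_rat_Aint; first exact: Crat_rat.
  have -> : ratr (2 * r) = e x + nu (e x).
    by rewrite nuxE exE rmorphM /= ratr_nat; ring.
  by rewrite rpredD.
have /intrP[n nE] : r ^+ 2 - s ^+ 2 * Dm%:~R \is a Num.int.
  rewrite -Cint_rat; apply: Cint_rat_Aint; first exact: Crat_rat.
  have -> : ratr (r ^+ 2 - s ^+ 2 * Dm%:~R) = e x * nu (e x).
    have -> : ratr (r ^+ 2 - s ^+ 2 * Dm%:~R) = ratr r ^+ 2 - ratr s ^+ 2 * (e d) ^+ 2 :> algC.
      have r2 c : ratr (c ^+ 2) = ratr c ^+ 2 :> algC by rewrite rmorphXn.
      by rewrite sqr_d rmorphB /= r2 [ratr (_ * _)]rmorphM /= r2 ratr_int.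
    by rewrite nuxE exE; ring.
  by rewrite rpredM.
have [|b [c [sE rE]]] := @fund_disc_ring D m (2 * s) a n fD.
  have -> : (a * a - 4 * n)%:~R = a%:~R * a%:~R - 4 * n%:~R :> rat by rewrite rmorphB !rmorphM.
  by rewrite -aE -nE -/Dm; ring.
exists b, c; rewrite xE /w scalerDr !scalerA addrA -scalerDl; congr (_ *: _ + _ *: _).
  apply: (@mulfI _ (2 : rat)) => //; rewrite aE rE.
  have -> : (2 * c + b * (D * m))%:~R = 2 * c%:~R + b%:~R * Dm%:~R :> rat.
    by rewrite rmorphD !rmorphM.
  by field.
by rewrite -sE; field.
Qed.

Lemma quadratic_discriminant Delta : is_discriminant K Delta -> Delta = Dm.
Proof.
case=> v [vb vP]; have K2 := dim_quadratic.
rewrite (det_trace2 v K2) => DE.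
have i0 : (0 < \dim {:K})%N by rewrite K2.
have i1 : (1 < \dim {:K})%N by rewrite K2.
have /vP/integral_coord[b0 [c0 v0E]] := mem_IntSpan v (Ordinal i0).
have /vP/integral_coord[b1 [c1 v1E]] := mem_IntSpan v (Ordinal i1).
have int1 : integralOver (intr : int -> K) 1 by apply: integral1.
have /vP/(IntSpan2 K2)[a [b oneE]] := int1.
have /vP/(IntSpan2 K2)[c [d' wE]] := integral_w.
apply: (@mutual_sqr_mul_eq _ _ (c0 * b1 - b0 * c1) (a * d' - b * c)).
  apply/eqP; rewrite -(eqr_int rat) DE v0E v1E disc2_change disc2_1w.
  by rewrite !(rmorphM, rmorphB, rmorphXn).
apply/eqP; rewrite -(eqr_int rat) -disc2_1w oneE wE disc2_change -DE.
by rewrite !(rmorphM, rmorphB, rmorphXn).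
Qed.
End QuadraticDiscriminant.

(** * The terms of the series *)

Lemma in_numfieldE (s : seq algC) X : in_numfield s X <-> Qin s X.
Proof.
have [s1 s1E gen] := numfield_embP s; rewrite -[in Qin s X]s1E.
split=> [[y <-]|/Qin_preim[y _ <-]]; last by exists y.
by apply/mem_adjoinP; rewrite gen memvf.
Qed.

Lemma numfield_degree_Kummer (g : rat) h D m q f n :
  g != 0 -> is_largest_power g h -> ~ (exists x, g = x ^+ 2) -> fund_disc D m ->
  g = (D * m)%:~R * q ^+ 2 -> sqfree n -> (0 < f)%N ->
  numfield_degree (zeta f :: Qkummer_gens g n) =
  (totient (lcmn f n) * (n %/ (gcdn n h * disc_eps (D * m)%R n (lcmn f n))))%N.
Proof.
move=> g0 hP nsq fD gE sn f0; have n0 := sqfree_gt0 sn.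
have [s1 s1E gen] := numfield_embP (zeta f :: Qkummer_gens g n).
have [S ZS S2] := sqrt_disc fD.
have L0 : (0 < lcmn f n)%N by rewrite lcmn_gt0 f0.
have SL : (absz (D * m)%R %| lcmn f n)%N -> fixes [:: zeta (lcmn f n)] S.
  by move=> DL; apply/Qin_fixes/Zin_Qin; apply: Zin_zeta_dvd ZS.
exact: (@dim_Kummer_field g h D m q S (n.-root (ratr g)) n (lcmn f n) g0 hP nsq fD gE S2 sn
  (dvdn_lcmr f n) L0 (rootCK n0 _) SL _ _ f s1 f0 erefl s1E gen).
Qed.

Section Restriction.
Variables (f a : nat).
Hypotheses (f0 : (0 < f)%N) (af : coprime a f).
Local Notation e := (numfield_emb [:: zeta f]).

Lemma emb_sigma (nu : algCaut) (x : Qzeta f) : nu (zeta f) = zeta f ^+ a ->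
  e (sigma f a x) = nu (e x).
Proof.
move=> nuE.
suff H X : Qin [:: zeta f] X -> forall y, e y = X -> e (sigma f a y) = nu X.
  by apply: H => //; apply/in_numfieldE; exists x.
elim=> {X x} [r|Y YE|Y Z QY IHY QZ IHZ|Y Z QY IHY QZ IHZ] x xE.
- rewrite fmorph_rat; have -> : x = r%:A.
    by apply: (fmorph_inj e); rewrite xE alg_num_field fmorph_rat.
  by rewrite alg_num_field !fmorph_rat.
- by move: YE xE; rewrite mem_seq1 => /eqP -> xE; rewrite (sigmaP f0 af xE) rmorphXn /= xE nuE.
- have [y yE] := (in_numfieldE _ _).2 QY; have [z zE] := (in_numfieldE _ _).2 QZ.
  have -> : x = y + z by apply: (fmorph_inj e); rewrite rmorphD yE zE.
  by rewrite !rmorphD /= (IHY y yE) (IHZ z zE).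
- have [y yE] := (in_numfieldE _ _).2 QY; have [z zE] := (in_numfieldE _ _).2 QZ.
  have -> : x = y * z by apply: (fmorph_inj e); rewrite rmorphM yE zE.
  by rewrite rmorphM rmorphM /= (IHY y yE) (IHZ z zE) rmorphM.
Qed.

Lemma c_Kummer (g : rat) h D m q n : (0 < a)%N ->
  g != 0 -> is_largest_power g h -> ~ (exists x, g = x ^+ 2) -> fund_disc D m ->
  g = (D * m)%:~R * q ^+ 2 -> sqfree n ->
  c_ f g a n = (a == 1 %[mod gcdn f n])%N &&
    ([&& odd `|b_ f (D * m)|, 2 %| n & `|b_ f (D * m)| %| n]%N ==>
      (kronecker (gamma_ f (D * m)) a == 1)).
Proof.
move=> a0 g0 hP nsq fD gE sn; have n0 := sqfree_gt0 sn.
have aln := rootCK n0 (ratr g : algC).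
have [nu nuE] := aut_zeta_exists f0 af.
apply/asboolP/andP => [H|[/eqP a1 kron1] x].
  have fixed X : Qin [:: zeta f] X -> Qin (Qkummer_gens g n) X -> nu X = X.
    move=> /in_numfieldE[x <-] /in_numfieldE Qx.
    by rewrite -(emb_sigma x nuE) H.
  split.
    set d := gcdn f n; have d0 : (0 < d)%N by rewrite gcdn_gt0 f0.
    have [i iE] := zeta_dvd f0 (dvdn_gcdl f n); have [j jE] := zeta_dvd n0 (dvdn_gcdr f n).
    have : nu (zeta d) = zeta d.
      apply: fixed; first by rewrite iE; apply/Qin_exp/Qin_mem; rewrite mem_head.
      by rewrite jE; apply/Qin_exp/Qin_mem; rewrite mem_head.
    rewrite (aut_zeta_dvd f0 (dvdn_gcdl f n) nuE) -[RHS]expr1 => /eqP.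
    by rewrite (eq_prim_root_expr (zeta_prim d0)).
  apply/implyP => /and3P[bo n2 bn].
  have [Sg [Sg0 QS QS' nuS]] := gamma_in_intersection g0 fD gE sn f0 aln a0 af bo n2 bn.
  have := nuS nu nuE; rewrite fixed // => /eqP.
  by rewrite -{1}[Sg]mul1r (inj_eq (mulIf Sg0)) eq_sym -(eqr_int algC).
have [|nu' [nu'f nu'n nu'a]] := fixing_aut g0 hP nsq fD gE sn f0 aln a0 af a1.
  by move=> bo n2 bn; apply/eqP; move: kron1; rewrite bo n2 bn.
move=> /in_numfieldE /Qin_fixes fx; apply: (fmorph_inj e).
rewrite (emb_sigma x nu'f); apply: fx => y.
by rewrite !inE => /orP[] /eqP ->.
Qed.
End Restriction.

(** * Sums over squarefree integers and Euler products *)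

Section EulerSum.
Variable R : realType.
Implicit Types y : nat -> R.

Definition sqfree_prod y (n : nat) : R :=
  if sqfree n then \prod_(p <- primes n) y p else 0.

Lemma sqfree_prod1 y : sqfree_prod y 1 = 1.
Proof. by rewrite /sqfree_prod /= big_nil. Qed.

Lemma sqfree_prod_coprime y m n : (0 < m)%N -> (0 < n)%N -> coprime m n ->
  sqfree_prod y (m * n) = sqfree_prod y m * sqfree_prod y n.
Proof.
move=> m0 n0 mn; rewrite /sqfree_prod.
have [sm|sm] := boolP (sqfree m); last first.
  rewrite mul0r; case: ifP => // smn; case/negP: sm.
  exact: sqfree_dvd (dvdn_mulr n (dvdnn m)) smn.
have [sn|sn] := boolP (sqfree n); last first.
  rewrite mulr0; case: ifP => // smn; case/negP: sn.
  exact: sqfree_dvd (dvdn_mull m (dvdnn n)) smn.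
rewrite sqfree_coprime // -big_cat; apply: perm_big; apply: uniq_perm.
- exact: primes_uniq.
- rewrite cat_uniq !primes_uniq andbT /=; apply/hasPn => p /=.
  rewrite !mem_primes => /and3P[p_pr _ pn]; rewrite p_pr m0 /=.
  by apply: contraL mn => pm; apply/negP => /(coprime_dvdl pm); rewrite prime_coprime // pn.
- by move=> p; rewrite primesM // mem_cat.
Qed.

Lemma sqfree_prod_prime y p n : prime p -> ~~ (p %| n)%N -> (0 < n)%N ->
  sqfree_prod y (p * n) = y p * sqfree_prod y n.
Proof.
move=> p_pr pn n0; have p0 := prime_gt0 p_pr.
rewrite sqfree_prod_coprime ?prime_coprime //.
by congr (_ * _); rewrite /sqfree_prod sqfree_prime // primes_prime // big_seq1.
Qed.

Definition primorial (N : nat) : nat := \prod_(0 <= p < N | prime p) p.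

Lemma primorialS N : primorial N.+1 = if prime N then (N * primorial N)%N else primorial N.
Proof.
by rewrite /primorial big_mkcond big_nat_recr //= -big_mkcond /=; case: ifP; rewrite ?muln1 // mulnC.
Qed.

Lemma primorial_gt0 N : (0 < primorial N)%N.
Proof. by rewrite /primorial prodn_cond_gt0 // => p /prime_gt0. Qed.

Lemma prime_dvd_primorial p N : prime p -> (p %| primorial N)%N = (p < N)%N.
Proof.
move=> p_pr; elim: N => [|N IH]; first by rewrite /primorial big_nil ltn0 Euclid_dvd1.
rewrite primorialS ltnS leq_eqVlt; case: ifP => N_pr.
  by rewrite Euclid_dvdM // dvdn_prime2 // IH.
by rewrite IH; case: eqP => // pN; rewrite -pN p_pr in N_pr.
Qed.

Lemma sqfree_dvd_primorial n N : sqfree n -> (n <= N)%N -> (n %| primorial N.+1)%N.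
Proof.
move=> sn nN; apply: (sqfree_dvdn sn) => p p_pr pn.
by rewrite prime_dvd_primorial // ltnS (leq_trans _ nN) // dvdn_leq // sqfree_gt0.
Qed.

Lemma sum_divisors_primorial y N :
  \sum_(d <- divisors (primorial N)) sqfree_prod y d = \prod_(0 <= p < N | prime p) (1 + y p).
Proof.
elim: N => [|N IH]; first by rewrite /primorial !big_nil big_seq1 sqfree_prod1.
have -> : \prod_(0 <= p < N.+1 | prime p) (1 + y p) =
    (\prod_(0 <= p < N | prime p) (1 + y p)) * (if prime N then 1 + y N else 1).
  by rewrite big_mkcond big_nat_recr //= -big_mkcond.
rewrite -IH primorialS.
case: ifP => N_pr; last by rewrite mulr1.
set Q := primorial N; have Q0 : (0 < Q)%N by apply: primorial_gt0.
have NQ : ~~ (N %| Q)%N by rewrite prime_dvd_primorial // ltnn.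
have N0 := prime_gt0 N_pr.
have mem_div d n : (0 < n)%N -> (d \in divisors n) = (d %| n)%N by move=> ?; rewrite -dvdn_divisors.
rewrite (perm_big (divisors Q ++ [seq (N * d)%N | d <- divisors Q])) /=.
  rewrite big_cat /= big_map mulrDr mulr1; congr (_ + _).
  rewrite mulr_suml; apply: eq_big_seq => d; rewrite mem_div // => dQ.
  rewrite sqfree_prod_prime ?(dvdn_gt0 Q0 dQ) 1?mulrC //.
  by apply: contra NQ => Nd; apply: dvdn_trans dQ.
apply: uniq_perm; first exact: divisors_uniq.
  rewrite cat_uniq divisors_uniq map_inj_uniq ?divisors_uniq ?andbT /=; last first.
    by move=> d1 d2 /eqP; rewrite eqn_pmul2l // => /eqP.
  apply/hasPn => _ /mapP[d _ ->] /=; rewrite mem_div //.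
  by apply: contra NQ => /(dvdn_trans (dvdn_mulr _ (dvdnn N))).
move=> d; rewrite mem_div ?muln_gt0 ?N0 // mem_cat mem_div //.
apply/idP/orP => [dNQ|[dQ|/mapP[d' + ->]]]; last 2 first.
- exact: dvdn_mull.
- by rewrite mem_div // => d'Q; rewrite dvdn_pmul2l.
have [Nd|Nd] := boolP (N %| d)%N; last first.
  by left; rewrite -(Gauss_dvdr _ (_ : coprime d N)) // coprime_sym prime_coprime.
right; case/dvdnP: Nd dNQ => d' ->; rewrite mulnC dvdn_pmul2l // => d'Q.
by apply/mapP; exists d'; rewrite ?mem_div.
Qed.

Lemma sum_upto_dvd y N :
  \sum_(1 <= n < N.+1) sqfree_prod y n =
  \sum_(1 <= n < N.+1 | (n %| primorial N.+1)%N) sqfree_prod y n.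
Proof.
rewrite [RHS]big_mkcond; apply: eq_big_nat => n /andP[n1 nN].
case: ifP => // /negbT ndvd; rewrite /sqfree_prod; case: ifP => // sn.
by case/negP: ndvd; apply: sqfree_dvd_primorial.
Qed.

Lemma sum_divisors_nat (F : nat -> R) Q M : (0 < Q)%N -> (Q <= M)%N ->
  \sum_(d <- divisors Q) F d = \sum_(1 <= n < M.+1 | (n %| Q)%N) F n.
Proof.
move=> Q0 QM; rewrite -[RHS]big_filter; apply: perm_big; apply: uniq_perm.
- exact: divisors_uniq.
- by rewrite filter_uniq // iota_uniq.
move=> d; rewrite mem_filter mem_index_iota -dvdn_divisors //.
case: (boolP (d %| Q)%N) => //= dQ; apply/esym.
by rewrite (dvdn_gt0 Q0 dQ) ltnS (leq_trans _ QM) // dvdn_leq.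
Qed.

Lemma sum_upto_le_prod y N : (forall p, 0 <= y p) ->
  \sum_(1 <= n < N.+1) sqfree_prod y n <= \prod_(0 <= p < N.+1 | prime p) (1 + y p).
Proof.
move=> y0; have V0 n : 0 <= sqfree_prod y n.
  by rewrite /sqfree_prod; case: ifP => // _; apply: prodr_ge0.
rewrite sum_upto_dvd -sum_divisors_primorial.
rewrite (@sum_divisors_nat _ _ (primorial N.+1 + N)) ?primorial_gt0 ?leq_addr //.
rewrite [leRHS](big_cat_nat (n := N.+1)) //=; last by rewrite ltnS leq_addl.
by rewrite lerDl sumr_ge0.
Qed.

Lemma prod_le_expR y N : (forall p, 0 <= y p) ->
  \prod_(0 <= p < N | prime p) (1 + y p) <= expR (\sum_(0 <= p < N | prime p) y p).
Proof.
move=> y0; rewrite big_mkcond [in leRHS]big_mkcond.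
elim: N => [|N IH]; first by rewrite !big_nil expR0.
rewrite !big_nat_recr //= expRD ler_pM //.
- by apply: prodr_ge0 => p _; case: ifP => // _; rewrite addr_ge0.
- by case: ifP => // _; rewrite addr_ge0.
- by case: ifP => _; rewrite ?expR0 // expR_ge1Dx.
Qed.

Lemma norm_sqfree_prod y n : `|sqfree_prod y n| = sqfree_prod (fun p => `|y p|) n.
Proof. by rewrite /sqfree_prod; case: ifP; rewrite ?normr0 // normr_prod. Qed.

(* The product over primes up to [N] is the sum over the divisors of the
   primorial, which differs from the partial sum by at most a tail of the
   absolutely convergent series. *)
Lemma euler_sum y (c l : R) :
  (forall N, \sum_(0 <= p < N | prime p) `|y p| <= c) ->
  (fun N => \prod_(0 <= p < N | prime p) (1 + y p)) @ \oo --> l ->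
  (fun N => \sum_(1 <= n < N.+1) sqfree_prod y n) @ \oo --> l.
Proof.
move=> yc El; pose A N := \sum_(1 <= n < N.+1) `|sqfree_prod y n|.
have A_bound N : A N <= expR c.
  rewrite /A (eq_bigr (fun n => sqfree_prod (fun p => `|y p|) n)) => [|n _]; last exact: norm_sqfree_prod.
  apply: le_trans (sum_upto_le_prod _ _) _ => //.
  by apply: le_trans (prod_le_expR _ _) _ => //; rewrite ler_expR.
have A_nd : nondecreasing_seq A.
  by apply/nondecreasing_seqP => N; rewrite /A [leRHS]big_nat_recr //= lerDl.
have A_cvg : cvgn A.
  by apply: nondecreasing_is_cvgn => //; exists (expR c) => _ [N _ <-].
have A_le N : A N <= limn A by apply: nondecreasing_cvgn_le.
pose E N := \prod_(0 <= p < N | prime p) (1 + y p).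
pose S N := \sum_(1 <= n < N.+1) sqfree_prod y n.
have ES N : `|E N.+1 - S N| <= limn A - A N.
  set Q := primorial N.+1; pose M := (Q + N)%N.
  rewrite /E -sum_divisors_primorial (@sum_divisors_nat _ _ M) ?primorial_gt0 ?leq_addr //.
  rewrite /S sum_upto_dvd -/Q (big_cat_nat (n := N.+1)) //=; last by rewrite ltnS leq_addl.
  rewrite addrAC subrr add0r (le_trans (ler_norm_sum _ _ _)) //.
  apply: (@le_trans _ _ (\sum_(N.+1 <= n < M.+1) `|sqfree_prod y n|)).
    by rewrite big_mkcond ler_sum // => n _; case: ifP.
  rewrite lerBrDl; have -> : A N + \sum_(N.+1 <= n < M.+1) `|sqfree_prod y n| = A M.
    by rewrite /A [RHS](big_cat_nat (n := N.+1)) //= ltnS leq_addl.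
  exact: A_le.
have E1 : (fun N => E N.+1) @ \oo --> l by have := El; rewrite -cvg_shiftS.
have D0 : (fun N => E N.+1 - S N) @ \oo --> (0 : R).
  apply/norm_cvg0P; apply: (@squeeze_cvgr _ _ _ _ (fun=> 0) (fun N => limn A - A N)).
  - by near=> N; rewrite normr_ge0 ES.
  - exact: cvg_cst.
  - by rewrite -[X in _ --> X](subrr (limn A)); apply: cvgB => //; apply: cvg_cst.
have SE : S = (fun N => E N.+1 - (E N.+1 - S N)).
  by apply/funext => N; rewrite opprB addrCA subrr addr0.
change (S @ \oo --> l); rewrite SE -[X in _ --> X]subr0.
exact: cvgB.
Unshelve. all: by end_near.
Qed.
End EulerSum.

Section EulerSumMultiples.
Variable R : realType.
Implicit Types y : nat -> R.

Lemma sum_multiples (F : nat -> R) c N : (0 < c)%N ->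
  \sum_(1 <= n < N.+1 | (c %| n)%N) F n = \sum_(1 <= k < (N %/ c).+1) F (c * k)%N.
Proof.
move=> c0; rewrite -(big_map (muln c) xpredT F) -[LHS]big_filter.
apply: perm_big; apply: uniq_perm.
- by rewrite filter_uniq // iota_uniq.
- by rewrite map_inj_uniq ?iota_uniq // => i j /eqP; rewrite eqn_pmul2l // => /eqP.
move=> n; rewrite mem_filter mem_index_iota; apply/andP/mapP => [[/dvdnP[k ->]]|[k + ->]].
  rewrite muln_gt0 ltnS => /andP[/andP[k0 _] kN]; exists k; last by rewrite mulnC.
  by rewrite mem_index_iota k0 ltnS leq_divRL.
rewrite mem_index_iota ltnS leq_divRL // => /andP[k0 kN].
by rewrite dvdn_mulr // muln_gt0 c0 k0 ltnS mulnC.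
Qed.

Definition prime_to_part (c : nat) y (p : nat) : R := if (p %| c)%N then 0 else y p.

Lemma sqfree_prod_mul y c k : sqfree c -> (0 < k)%N ->
  sqfree_prod y (c * k) = sqfree_prod y c * sqfree_prod (prime_to_part c y) k.
Proof.
move=> sc k0; have c0 := sqfree_gt0 sc.
have [co|nco] := boolP (coprime c k).
  rewrite sqfree_prod_coprime //; congr (_ * _); rewrite /sqfree_prod; case: ifP => // sk.
  apply: eq_big_seq => p; rewrite mem_primes /prime_to_part => /and3P[p_pr _ pk].
  by case: ifP => // pc; move: co => /(coprime_dvdl pc); rewrite prime_coprime // pk.
have [p [p_pr pc pk]] : exists p, [/\ prime p, (p %| c)%N & (p %| k)%N].
  have : (1 < gcdn c k)%N by rewrite ltn_neqAle eq_sym nco gcdn_gt0 c0.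
  by case/pdivP => p p_pr; rewrite dvdn_gcd => /andP[pc pk]; exists p.
have -> : sqfree_prod y (c * k) = 0.
  rewrite /sqfree_prod ifF //; apply/negP; case/dvdnP: pc => c' ->; rewrite (mulnC c') -mulnA.
  by rewrite sqfreeMp // => /andP[/negP[]]; rewrite dvdn_mull.
suff -> : sqfree_prod (prime_to_part c y) k = 0 by rewrite mulr0.
rewrite /sqfree_prod; case: ifP => // _; apply/eqP; rewrite prodf_seq_eq0.
by apply/hasP; exists p; rewrite ?mem_primes ?p_pr ?k0 // /prime_to_part pc eqxx.
Qed.

Lemma cvg_divn c : (0 < c)%N -> (fun N => (N %/ c)%N) @ \oo --> \oo.
Proof.
move=> c0; apply/cvgnyPge => A; near=> N; rewrite leq_divRL //.
by near: N; exists (A * c)%N.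
Unshelve. all: by end_near.
Qed.

Lemma euler_sum_multiples y c (K l : R) : sqfree c ->
  (forall N, \sum_(0 <= p < N | prime p) `|y p| <= K) ->
  (fun N => \prod_(0 <= p < N | prime p) (1 + prime_to_part c y p)) @ \oo --> l ->
  (fun N => \sum_(1 <= n < N.+1 | (c %| n)%N) sqfree_prod y n) @ \oo --> sqfree_prod y c * l.
Proof.
move=> sc yK El; have c0 := sqfree_gt0 sc.
have -> : (fun N => \sum_(1 <= n < N.+1 | (c %| n)%N) sqfree_prod y n) =
    (fun N => sqfree_prod y c *
      \sum_(1 <= n < (N %/ c).+1) sqfree_prod (prime_to_part c y) n).
  apply/funext => N; rewrite sum_multiples // mulr_sumr.
  by apply: eq_big_nat => k /andP[k0 _]; rewrite sqfree_prod_mul.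
apply: cvgM; first exact: cvg_cst.
have yK' N : \sum_(0 <= p < N | prime p) `|prime_to_part c y p| <= K.
  apply: le_trans (yK N); apply: ler_sum => p _.
  by rewrite /prime_to_part; case: ifP; rewrite ?normr0.
exact: cvg_comp (cvg_divn c0) (euler_sum yK' El).
Qed.

Lemma telescope_bound y (K : R) : 0 <= K ->
  (forall p, prime p -> `|y p| <= K / (p%:R * (p%:R - 1))) ->
  forall N, \sum_(0 <= p < N | prime p) `|y p| <= K.
Proof.
move=> K0 yK N; apply: (@le_trans _ _ (\sum_(0 <= p < N.+2 | prime p) `|y p|)).
  by rewrite [leRHS](big_cat_nat (n := N)) //= ?lerDl ?sumr_ge0 // -addn2 leq_addr.
apply: (@le_trans _ _ (K * (1 - N.+1%:R^-1))); last first.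
  by rewrite ler_piMr // lerBlDr lerDl invr_ge0.
elim: N => [|N IH].
  by rewrite big_mkcond !big_nat_recr //= big_nil !addr0 invr1 subrr mulr0.
rewrite big_mkcond big_nat_recr //= -big_mkcond /=.
have -> : K * (1 - N.+2%:R^-1) = K * (1 - N.+1%:R^-1) + K / (N.+2%:R * (N.+2%:R - 1)).
  have -> : N.+2%:R - 1 = N.+1%:R :> R by rewrite -[N.+2]addn1 natrD addrK.
  have n1 : N.+1%:R != 0 :> R by rewrite pnatr_eq0.
  have n2 : N.+2%:R != 0 :> R by rewrite pnatr_eq0.
  have E : N.+2%:R = N.+1%:R + 1 :> R by rewrite -[N.+2]addn1 natrD.
  by move: n1 n2; rewrite E; move: (N.+1%:R : R) => x n1 n2; field; rewrite n1 n2.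
apply: lerD => //; case: ifP => [/yK //|_].
by rewrite divr_ge0 // mulr_ge0 // subr_ge0 ler1n.
Qed.
End EulerSumMultiples.

(** * Local factors *)

Lemma moebius_sqfree n : moebius n = if sqfree n then (-1) ^+ size (primes n) else 0.
Proof. by []. Qed.

Lemma moebius_primeM p n : prime p -> ~~ (p %| n)%N -> sqfree n ->
  moebius (p * n) = - moebius n.
Proof.
move=> p_pr pn sn; rewrite !moebius_sqfree sqfreeMp // pn sn /=.
have -> : size (primes (p * n)) = (size (primes n)).+1.
  rewrite -(size_map id (primes n)) map_id -/(size (p :: primes n)).
  apply: perm_size; apply: uniq_perm; rewrite /= ?primes_uniq ?andbT //.
    by rewrite mem_primes p_pr (negPf pn) !andbF.
  by move=> q; rewrite primesM ?(prime_gt0 p_pr) ?(sqfree_gt0 sn) // primes_prime // !inE.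
by rewrite exprS mulN1r.
Qed.

Lemma gcdn_primeMl p k x : prime p -> ~~ (p %| k)%N ->
  gcdn (p * k) x = (gcdn p x * gcdn k x)%N.
Proof.
move=> p_pr pk; have co : coprime p k by rewrite prime_coprime.
have [/dvdnP[x' ->]|px] := boolP (p %| x)%N; last first.
  have : coprime p x by rewrite prime_coprime.
  by move=> cx; rewrite (eqP cx) mul1n gcdnC Gauss_gcdr ?[coprime x p]coprime_sym // gcdnC.
have -> : gcdn p (x' * p) = p by apply/gcdn_idPl/dvdn_mull.
by rewrite (mulnC x') -muln_gcdr Gauss_gcdr // coprime_sym.
Qed.

Lemma eqn_mod_dvd1 a d : (0 < a)%N -> (a == 1 %[mod d])%N = (d %| a - 1)%N.
Proof. by move=> a0; rewrite eqn_mod_dvd. Qed.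

Lemma totient_lcm_primeM f p k : prime p -> ~~ (p %| k)%N ->
  totient (lcmn f (p * k)) =
  ((if p %| f then 1 else p.-1) * totient (lcmn f k))%N.
Proof.
move=> p_pr pk; have co : coprime p k by rewrite prime_coprime.
have lE : lcmn f (p * k) = lcmn p (lcmn f k).
  have -> : (p * k = lcmn p k)%N by rewrite /lcmn (eqP co) divn1.
  by rewrite lcmnCA.
rewrite lE; case: ifP => pf.
  by rewrite mul1n lcmnA (lcmn_idPr pf).
have cL : coprime p (lcmn f k).
  rewrite prime_coprime //; apply/negP => pL.
  have : (p %| f * k)%N by rewrite -muln_lcm_gcd dvdn_mulr.
  by rewrite Euclid_dvdM // pf (negPf pk).
by rewrite {1}/lcmn (eqP cL) divn1 totient_coprime // totient_prime.
Qed.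

Section Term.
Variables (R : realType) (f a h : nat).
Hypotheses (f0 : (0 < f)%N) (a0 : (0 < a)%N).

Definition local_factor (p : nat) : R :=
  - (if (p %| f)%N then (p %| a - 1)%N%:R * (gcdn p h)%:R / p%:R
     else (gcdn p h)%:R / (p%:R * (p%:R - 1))).

Lemma moebius_term n : sqfree n ->
  (moebius n)%:~R * (a == 1 %[mod gcdn f n])%N%:R * (gcdn n h)%:R
    / ((totient (lcmn f n))%:R * n%:R) =
  sqfree_prod local_factor n / (totient f)%:R.
Proof.
have tf0 : (totient f)%:R != 0 :> R by rewrite pnatr_eq0 -lt0n totient_gt0.
elim/sqfree_ind: n / => [|p n p_pr pn sn IH].
  by rewrite gcdn1 modn1 gcd1n lcmn1 eqxx sqfree_prod1 !mulr1 /moebius /= expr0.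
have n0 := sqfree_gt0 sn; have p0 := prime_gt0 p_pr.
rewrite sqfree_prod_prime // -[RHS]mulrA -IH moebius_primeM // !eqn_mod_dvd1 //.
rewrite gcdn_primeMl // [gcdn f (p * n)]gcdnC gcdn_primeMl // totient_lcm_primeM //.
rewrite [gcdn n f]gcdnC.
have pR0 : p%:R != 0 :> R by rewrite pnatr_eq0 -lt0n.
have nR0 : n%:R != 0 :> R by rewrite pnatr_eq0 -lt0n.
have tR0 : (totient (lcmn f n))%:R != 0 :> R.
  by rewrite pnatr_eq0 -lt0n totient_gt0 lcmn_gt0 f0.
rewrite /local_factor; case: ifP => pf.
  have -> : gcdn p f = p by apply/gcdn_idPl.
  rewrite Gauss_dvd ?[in (p * gcdn f n %| _)%N](_ : coprime p (gcdn f n)) //; last first.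
    by rewrite prime_coprime //; apply: contra pn => /dvdn_trans; apply; apply: dvdn_gcdr.
  rewrite mul1n -mulnb !natrM rmorphN /=; field.
  by rewrite pR0 nR0 tR0.
have -> : gcdn p f = 1%N by apply/eqP; rewrite -/(coprime p f) prime_coprime // pf.
rewrite mul1n !natrM rmorphN /=.
have p1 : p.-1%:R = p%:R - 1 :> R by rewrite -subn1 natrB.
rewrite p1; field.
rewrite pR0 nR0 tR0 andbT -p1 pnatr_eq0 -lt0n -subn1 subn_gt0 prime_gt1 //.
Qed.
End Term.

Section DeltaTerm.
Variables (R : realType) (g : rat) (h : nat) (D m : int) (q : rat) (f a : nat).
Hypotheses (g0 : g != 0) (hP : is_largest_power g h) (nsq : ~ exists x, g = x ^+ 2).
Hypotheses (fD : fund_disc D m) (gE : g = (D * m)%:~R * q ^+ 2).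
Hypotheses (f0 : (0 < f)%N) (a0 : (0 < a)%N) (af : coprime a f).
Local Notation b := (`|b_ f (D * m)|%N).
Local Notation kron := (kronecker (gamma_ f (D * m)) a).
Local Notation y := (local_factor R f a h).

Lemma kronecker_gamma_sign : odd b -> kron = 1 \/ kron = -1.
Proof.
move=> bo; have [Sg ZSg [Sg2 nuSg]] := sqrt_gamma fD f0 a0 af bo.
have [nu nuE] := aut_zeta_exists f0 af.
have Sg0 : Sg != 0.
  have : Sg ^+ 2 != 0 by rewrite Sg2 intr_eq0 -absz_gt0 abs_gamma gcdn_gt0 f0.
  by rewrite expf_eq0.
have : (nu Sg) ^+ 2 == Sg ^+ 2 by rewrite -rmorphXn Sg2 /= rmorph_int.
rewrite nuSg // exprMn -subr_eq0 -[X in _ - X]mul1r -mulrBl mulf_eq0 expf_eq0 (negPf Sg0) orbF.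
rewrite subr_eq0 sqrf_eq1 => /orP[] /eqP kE; [left|right]; apply/eqP; rewrite -(eqr_int algC) kE //.
Qed.

Definition kron_coef : R := if odd b then kron%:~R else 0.

Lemma delta_termE n : (0 < n)%N -> delta_term R a f g n =
  (totient f)%:R^-1 * (sqfree_prod y n +
     kron_coef * (if (2 * b %| n)%N then sqfree_prod y n else 0)).
Proof.
move=> n0; have [sn|nsn] := boolP (sqfree n); last first.
  rewrite /delta_term moebius_sqfree /sqfree_prod (negPf nsn) !mul0r.
  by rewrite if_same mulr0 addr0 mulr0.
rewrite /delta_term (numfield_degree_Kummer g0 hP nsq fD gE sn f0).
rewrite (c_Kummer f0 af a0 g0 hP nsq fD gE sn).
rewrite natrM natf_div; last exact: gcd_eps_dvd hP nsq.
have nR0 : n%:R != 0 :> R by rewrite pnatr_eq0 -lt0n.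
have tR0 : (totient (lcmn f n))%:R != 0 :> R.
  by rewrite pnatr_eq0 -lt0n totient_gt0 lcmn_gt0 f0.
have dR0 : (gcdn n h)%:R != 0 :> R by rewrite pnatr_eq0 -lt0n gcdn_gt0 n0.
pose cond := [&& odd b, 2 %| n & b %| n]%N.
have epsE : disc_eps (D * m) n (lcmn f n) = if cond then 2%N else 1%N.
  exact: disc_eps_lcm fD sn f0.
have condE : kron_coef * (if (2 * b %| n)%N then sqfree_prod y n else 0) =
    (if cond then kron%:~R else 0) * sqfree_prod y n.
  rewrite /kron_coef /cond; case: (boolP (odd b)) => bo /=; last by rewrite !mul0r.
  by rewrite Gauss_dvd ?coprime2n //; case: ifP; rewrite ?mulr0 ?mul0r.
have VE : (totient f)%:R^-1 * (sqfree_prod y n + (if cond then kron%:~R else 0) * sqfree_prod y n)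
    = sqfree_prod y n / (totient f)%:R * (1 + if cond then kron%:~R else 0).
  by ring.
rewrite condE VE -(moebius_term R h f0 a0 sn) epsE natrM -/cond.
have -> : ((a == 1 %[mod gcdn f n])%N && (cond ==> (kron == 1)))%:R =
    (a == 1 %[mod gcdn f n])%N%:R * (1 + if cond then kron%:~R else 0) /
     (if cond then 2 else 1)%N%:R :> R.
  case: (boolP cond) => [/and3P[bo _ _]|_]; last by rewrite andbT addr0 mulr1 divr1.
  case: (kronecker_gamma_sign bo) => -> /=.
    by rewrite andbT -mulrA divff ?mulr1 // pnatr_eq0.
  by rewrite andbF subrr mulr0 mul0r.
have e0 : (if cond then 2 else 1)%N%:R != 0 :> R by case: (cond).
move: e0; move: ((if cond then 2 else 1)%N%:R) => ee e0.
move: nR0 tR0 dR0; move: (n%:R : R) ((totient _)%:R : R) ((gcdn n h)%:R : R) => x1 x2 x3.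
move: ((moebius n)%:~R : R) ((_ == _)%:R : R) (1 + _ : R) => x4 x5 x6 n1 n2 n3.
by field; rewrite n1 n2 n3 e0.
Qed.
End DeltaTerm.

Lemma prod_primes_nat (R : comNzRingType) (F : nat -> R) (P : pred nat) G N :
  (0 < G)%N -> (G < N)%N ->
  \prod_(p <- primes G | P p) F p =
  \prod_(0 <= p < N | [&& prime p, (p %| G)%N & P p]) F p.
Proof.
move=> G0 GN; rewrite -big_filter -[RHS]big_filter; apply: perm_big; apply: uniq_perm.
- by rewrite filter_uniq // primes_uniq.
- by rewrite filter_uniq // iota_uniq.
move=> p; rewrite !mem_filter mem_index_iota /= mem_primes G0 /=.
rewrite andbC -!andbA; case: (boolP (prime p)) => //= p_pr.
case: (boolP (p %| G)%N) => //= pG; first by rewrite (leq_ltn_trans (dvdn_leq G0 pG) GN) andbT.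
Qed.

Section EulerFactors.
Variables (R : realType) (f a h : nat).
Hypotheses (f0 : (0 < f)%N) (a0 : (0 < a)%N) (h0 : (0 < h)%N).
Local Notation y := (local_factor R f a h).

Let pR0 p : prime p -> p%:R != 0 :> R.
Proof. by move=> /prime_gt0 p0; rewrite pnatr_eq0 -lt0n. Qed.

Let p1R p : prime p -> p%:R - 1 != 0 :> R.
Proof. by move=> /prime_gt1 p1; rewrite -(natrB _ (ltnW p1)) pnatr_eq0 subn_eq0 -ltnNge. Qed.

Lemma local_factor_h p : prime p -> ~~ (p %| f)%N -> (p %| h)%N -> y p = - (p%:R - 1)^-1.
Proof.
move=> p_pr pf ph; rewrite /local_factor (negPf pf) (gcdn_idPl ph).
by congr (- _); field; rewrite p1R // pR0.
Qed.

Lemma local_factor_nh p : prime p -> ~~ (p %| f)%N -> ~~ (p %| h)%N ->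
  y p = - (p%:R * (p%:R - 1))^-1.
Proof.
move=> p_pr pf ph; rewrite /local_factor (negPf pf).
have -> : gcdn p h = 1%N by apply/eqP; rewrite -/(coprime p h) prime_coprime.
by rewrite mul1r.
Qed.

Lemma local_factor_prod N : coprime (gcdn (a - 1) f) h -> (f < N)%N -> (h < N)%N ->
  \prod_(0 <= p < N | prime p) (1 + y p) =
  \prod_(p <- primes (gcdn (a - 1) f)) (1 - p%:R^-1)
    * \prod_(p <- primes h | ~~ (p %| f)%N) (1 - (p%:R - 1)^-1)
    * artin_partial R f h N.
Proof.
move=> co fN hN; have G0 : (0 < gcdn (a - 1) f)%N by rewrite gcdn_gt0 f0 orbT.
have GN : (gcdn (a - 1) f < N)%N by apply: leq_ltn_trans fN; rewrite dvdn_leq // dvdn_gcdr.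
rewrite (prod_primes_nat _ _ G0 GN) (prod_primes_nat _ _ h0 hN) /artin_partial.
rewrite big_mkcond [X in _ = X * _ * _]big_mkcond [X in _ = _ * X * _]big_mkcond.
rewrite [X in _ = _ * _ * X]big_mkcond -!big_split /=; apply: eq_bigr => p _.
case: (boolP (prime p)) => p_pr; rewrite ?mulr1 //= dvdn_gcd andbT.
case: (boolP (p %| f)%N) => pf; rewrite ?andbT ?andbF /= ?mulr1 ?mul1r.
  rewrite /local_factor pf; case: (boolP (p %| a - 1)%N) => pa /=; last by rewrite !mul0r oppr0 addr0.
  have ph : coprime p h by apply: coprime_dvdl co; rewrite dvdn_gcd pa.
  by rewrite (eqP ph) !mul1r.
case: (boolP (p %| h)%N) => ph /=; rewrite ?mulr1 ?mul1r.
  by rewrite local_factor_h.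
by rewrite local_factor_nh.
Qed.

Lemma artin_A_cvg :
  (fun N => \prod_(0 <= p < N | prime p) (1 + y p)) @ \oo --> artin_A R a f h.
Proof.
rewrite /artin_A; case: ifPn => [co|nco].
  apply: (@cvg_trans _ ((fun N => \prod_(p <- primes (gcdn (a - 1) f)) (1 - p%:R^-1)
    * \prod_(p <- primes h | ~~ (p %| f)%N) (1 - (p%:R - 1)^-1)
    * artin_partial R f h N) @ \oo)).
    apply: near_eq_cvg; near=> N; apply/esym; apply: local_factor_prod => //.
      by near: N; exists f.+1.
    by near: N; exists h.+1.
  by apply: cvgM; [apply: cvg_cst | apply: artin_partial_cvg].
have [p [p_pr pa pf ph]] : exists p, [/\ prime p, (p %| a - 1)%N, (p %| f)%N & (p %| h)%N].
  have : (1 < gcdn (gcdn (a - 1) f) h)%N by rewrite ltn_neqAle eq_sym nco gcdn_gt0 h0 orbT.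
  case/pdivP => p p_pr; rewrite !dvdn_gcd => /andP[/andP[pa pf] ph].
  by exists p.
apply: (@cvg_trans _ ((fun=> 0 : R) @ \oo)); last exact: cvg_cst.
apply: near_eq_cvg; near=> N; apply/esym/eqP; rewrite prodf_seq_eq0.
apply/hasP; exists p; first by rewrite mem_index_iota /=; near: N; exists p.+1.
rewrite p_pr /= /local_factor pf pa (gcdn_idPl ph) mul1r divff ?pR0 //.
by rewrite subrr.
Unshelve. all: by end_near.
Qed.

Lemma prime_to_part_cvg c : (0 < c)%N -> (forall p, prime p -> (p %| c)%N -> 1 + y p != 0) ->
  (fun N => \prod_(0 <= p < N | prime p) (1 + prime_to_part c y p)) @ \oo -->
    artin_A R a f h / \prod_(p <- primes c) (1 + y p).
Proof.
move=> c0 nz; apply: (@cvg_trans _ ((fun N => (\prod_(0 <= p < N | prime p) (1 + y p)) /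
    \prod_(p <- primes c) (1 + y p)) @ \oo)); last first.
  by apply: cvgM; [apply: artin_A_cvg | apply: cvg_cst].
apply: near_eq_cvg; near=> N; have cN : (c < N)%N by near: N; exists c.+1.
have nz' : \prod_(p <- primes c) (1 + y p) != 0.
  rewrite prodf_seq_neq0; apply/allP => p; rewrite mem_primes => /and3P[p_pr _ pc].
  exact: nz.
apply: (canLR (mulfK nz')); rewrite (prod_primes_nat _ _ c0 cN) big_mkcond.
rewrite [X in _ = X * _]big_mkcond [X in _ = _ * X]big_mkcond -big_split /=.
apply: eq_bigr => p _; case: (boolP (prime p)) => p_pr; rewrite ?mulr1 //= andbT /prime_to_part.
by case: ifP; rewrite ?mulr1 // addr0 mul1r.
Unshelve. all: by end_near.
Qed.

Lemma local_factor_bound p : prime p -> `|y p| <= (h * f)%:R / (p%:R * (p%:R - 1)).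
Proof.
move=> p_pr; rewrite /local_factor normrN.
have p1 := prime_gt1 p_pr; have p0 := ltnW p1.
have pE : p%:R - 1 = p.-1%:R :> R by rewrite -subn1 natrB.
have gh : (gcdn p h <= h)%N by rewrite dvdn_leq // dvdn_gcdr.
have p0R : 0 < p%:R :> R by rewrite ltr0n.
have p1R' : 0 < p%:R - 1 :> R by rewrite subr_gt0 ltr1n.
case: ifP => pf.
  rewrite normrM normfV normrM !normr_nat invfM mulrA [_ * _^-1 * _]mulrAC ler_pM2r ?invr_gt0 //.
  rewrite ler_pdivlMr // pE -!natrM ler_nat.
  have pf' : (p.-1 <= f)%N by rewrite (leq_trans (leq_pred p)) // dvdn_leq.
  apply: leq_mul => //; apply: leq_trans gh; case: (_ %| _)%N; rewrite ?mul1n //.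
rewrite normrM normfV normr_nat gtr0_norm ?mulr_gt0 //.
rewrite ler_pM2r ?invr_gt0 ?mulr_gt0 // ler_nat.
by rewrite (leq_trans gh) // leq_pmulr.
Qed.

Lemma local_factor_summable N : \sum_(0 <= p < N | prime p) `|y p| <= (h * f)%:R.
Proof. by apply: telescope_bound => //; apply: local_factor_bound. Qed.
End EulerFactors.

Section CorrectionTerm.
Variables (R : realType) (f a h : nat).
Hypotheses (f0 : (0 < f)%N) (a0 : (0 < a)%N) (af : coprime a f) (ho : odd h).
Local Notation y := (local_factor R f a h).

Lemma local_factor2 : y 2 = - 2^-1.
Proof.
have gh : gcdn 2 h = 1%N by apply/eqP; rewrite -/(coprime 2 h) coprime2n.
rewrite /local_factor gh; case: ifP => [f2|_]; last by rewrite div1r -[2 - 1]/(1 + 1 - 1) addrK mulr1.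
have ao : odd a by move: af => /(coprime_dvdr f2); rewrite coprimen2.
have -> : (2 %| a - 1)%N by rewrite dvdn2 oddB // ao.
by rewrite !mul1r.
Qed.

Lemma local_factor_ratio p : prime p -> odd p -> ~~ (p %| f)%N ->
  1 + y p != 0 /\
  y p / (1 + y p) = - (if (p %| h)%N then p%:R - 2 else p%:R ^+ 2 - p%:R - 1)^-1.
Proof.
move=> p_pr po pf; have p3 : (2 < p)%N by apply: odd_prime_gt2.
have p3R : 3 <= p%:R :> R by rewrite ler_nat.
have p0 : p%:R != 0 :> R by apply: lt0r_neq0; lra.
have p1 : p%:R - 1 != 0 :> R by apply: lt0r_neq0; lra.
have p2 : p%:R - 2 != 0 :> R by apply: lt0r_neq0; lra.
have pp : p%:R ^+ 2 - p%:R - 1 != 0 :> R by apply: lt0r_neq0; nra.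
case: ifPn => ph; [rewrite local_factor_h // | rewrite local_factor_nh //];
  move: p0 p1 p2 pp; move: (p%:R : R) => x x0 x1 x2 xx.
  have E : 1 - (x - 1)^-1 = (x - 2) / (x - 1) by field.
  by rewrite E mulf_neq0 ?invr_neq0 //; split=> //; field; rewrite x2.
have E : 1 - (x * (x - 1))^-1 = (x ^+ 2 - x - 1) / (x * (x - 1)) by field; rewrite x1.
rewrite E mulf_neq0 ?invr_neq0 ?mulf_neq0 //; split=> //; field.
by rewrite xx x0 x1.
Qed.

Lemma sqfree_prod_ratio b : odd b -> sqfree b -> coprime b f ->
  sqfree_prod y (2 * b) / \prod_(p <- primes (2 * b)) (1 + y p) =
  (moebius (2 * b))%:~R / (\prod_(p <- primes b | (p %| h)%N) (p%:R - 2)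
       * \prod_(p <- primes b | ~~ (p %| h)%N) (p%:R ^+ 2 - p%:R - 1)).
Proof.
move=> bo sb bf; have b0 := sqfree_gt0 sb.
have b2 : ~~ (2 %| b)%N by rewrite dvdn2 bo.
have pb : perm_eq (primes (2 * b)) (2 :: primes b)%N.
  apply: uniq_perm; rewrite /= ?primes_uniq ?andbT //.
    by rewrite mem_primes negb_and negb_and b2 !orbT.
  by move=> p; rewrite primesM // primes_prime // !inE.
rewrite (perm_big _ pb) big_cons sqfree_prod_prime // moebius_primeM //.
rewrite moebius_sqfree /sqfree_prod sb local_factor2 rmorphN rmorph_sign /=.
have -> : (- 2^-1 * \prod_(p <- primes b) y p) /
    ((1 - 2^-1) * \prod_(p <- primes b) (1 + y p)) =
    - \prod_(p <- primes b) (y p / (1 + y p)).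
  rewrite -mulf_div prodf_div; have -> : 1 - 2^-1 = 2^-1 :> R by field.
  by rewrite mulNr divff ?invr_neq0 // mulN1r.
rewrite mulNr; congr (- _).
have -> : \prod_(p <- primes b | (p %| h)%N) (p%:R - 2)
       * \prod_(p <- primes b | ~~ (p %| h)%N) (p%:R ^+ 2 - p%:R - 1) =
   \prod_(p <- primes b) (if (p %| h)%N then p%:R - 2 else p%:R ^+ 2 - p%:R - 1) :> R.
  by rewrite [RHS](bigID (fun p => p %| h)%N) /=; congr (_ * _); apply: eq_bigr => p;
    [move=> -> | move=> /negPf ->].
have -> : (-1) ^+ size (primes b) = \prod_(p <- primes b) (-1 : R).
  by rewrite big_const_seq count_predT -Monoid.iteropE.
rewrite -prodf_div; apply: eq_big_seq => p; rewrite mem_primes => /and3P[p_pr _ pb'].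
have po : odd p by apply: dvdn_odd bo.
have pf : ~~ (p %| f)%N by rewrite -prime_coprime //; apply: coprime_dvdl bf.
by rewrite (local_factor_ratio p_pr po pf).2 mulN1r.
Qed.

Lemma local_factor_neqN1 b p : odd b -> coprime b f -> prime p -> (p %| 2 * b)%N ->
  1 + y p != 0.
Proof.
move=> bo bf p_pr; rewrite Euclid_dvdM // => /orP[|pb].
  rewrite dvdn_prime2 // => /eqP ->; rewrite local_factor2.
  by have -> : 1 - 2^-1 = 2^-1 :> R by [field]; rewrite invr_neq0.
apply: (local_factor_ratio p_pr _ _).1; first by apply: dvdn_odd bo.
by rewrite -prime_coprime //; apply: coprime_dvdl bf.
Qed.
End CorrectionTerm.

Lemma delta_series_cvg (R : realType) (g : rat) h D m (q : rat) f a :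
  g != 0 -> is_largest_power g h -> ~ (exists x, g = x ^+ 2) ->
  fund_disc D m -> g = (D * m)%:~R * q ^+ 2 ->
  (0 < f)%N -> (0 < a)%N -> coprime a f ->
  delta_series R a f g @ \oo -->
    artin_A R a f h / (totient f)%:R * (1 + correction R a f h (D * m)).
Proof.
move=> g0 hP nsq fD gE f0 a0 af.
have ho : odd h by apply: odd_largest_power hP nsq.
have h0 : (0 < h)%N by case: hP.
pose y := local_factor R f a h; pose b := `|b_ f (D * m)|%N.
have ysum := local_factor_summable R a f0 h0.
have cvg1 := euler_sum ysum (@artin_A_cvg R f a h f0 h0).
have -> : delta_series R a f g = (fun N => (totient f)%:R^-1 *
    (\sum_(1 <= n < N.+1) sqfree_prod y n +
     kron_coef R D m f a * \sum_(1 <= n < N.+1 | (2 * b %| n)%N) sqfree_prod y n)).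
  apply/funext => N; rewrite /delta_series [X in _ + _ * X]big_mkcond.
  rewrite !mulr_sumr -big_split mulr_sumr; apply: eq_big_nat => n /andP[n0 _].
  by rewrite (delta_termE R g0 hP nsq fD gE f0 a0 af n0).
have -> : artin_A R a f h / (totient f)%:R * (1 + correction R a f h (D * m)) =
    (totient f)%:R^-1 * (artin_A R a f h + artin_A R a f h * correction R a f h (D * m)).
  by rewrite mulrAC mulrDr mulr1 mulrC.
apply: cvgM; first exact: cvg_cst.
apply: cvgD; first exact: cvg1.
rewrite /correction -/b /kron_coef -/b; case: ifPn => bo; last first.
  rewrite mulr0 (_ : (fun _ => _) = fun=> 0); first exact: cvg_cst.
  by apply/funext => N; rewrite mul0r.
have sb : sqfree b := sqfree_b fD bo.
have bf : coprime b f := coprime_b_f fD bo.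
have s2b : sqfree (2 * b) by rewrite sqfreeMp // dvdn2 bo.
have b0 := sqfree_gt0 s2b.
have nz p : prime p -> (p %| 2 * b)%N -> 1 + y p != 0.
  by move=> p_pr pb; apply: (local_factor_neqN1 _ _ _ _ bo bf).
have := euler_sum_multiples s2b ysum (prime_to_part_cvg f0 h0 b0 nz).
rewrite mulrCA (sqfree_prod_ratio _ _ _ _ bo sb bf) // => cvg2.
rewrite -mulrA mulrCA; apply: cvgM; first exact: cvg_cst.
exact: cvg2.
Qed.

Theorem theorem2 (R : realType) (g : rat) (h : nat) (Delta : int) (f a : nat)
    (g_neq0 : g != 0) (g_neqN1 : g != -1)
    (g_nonsquare : ~ exists x : rat, g = x ^+ 2)
    (h_largest : is_largest_power g h)
    (Delta_disc : is_discriminant (numfield [:: sqrtC (ratr g)]) Delta)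
    (f_ge1 : (1 <= f)%N) (a_range : (1 <= a <= f)%N) (a_f_coprime : coprime a f) :
  cvgn (delta_series R a f g) /\
  delta R a f g =
    artin_A R a f h / (totient f)%:R * (1 + correction R a f h Delta).
Proof.
have [D [m [q [fD gE]]]] := rat_disc_decomp g_neq0.
have DeltaE : Delta = D * m.
  have [s1 s1E gen] := numfield_embP [:: sqrtC (ratr g)].
  case: s1 s1E gen => [|t [|? ?]] //= [tE]; rewrite adjoin_seq1 => gen.
  exact: (quadratic_discriminant g_nonsquare fD gE tE gen Delta_disc).
have [a0 _] := andP a_range.
have cvg := @delta_series_cvg R _ _ _ _ _ _ _ g_neq0 h_largest g_nonsquare fD gE f_ge1 a0 a_f_coprime.
rewrite DeltaE; split; first exact: cvgP cvg.
exact: cvg_lim cvg.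
Qed.
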